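(* Let $K$ be any infinite field with $\mathrm{char}(K)\neq 2$. Let $L/K$ be a separable extension of finite degree $d$. (1) If $d\leq 9$, then there exists an elliptic curve $X/K$ with a new special point in $X(L)$. (2) If $d=10$, then there exists an elliptic curve $X/K$ with a new point in $X(L)$. (3) Let $g\geq 2$. Suppose that $g\geq \lfloor d/4\rfloor -1$ if $d\equiv 0,1 \bmod 4$, and that $g\geq \lfloor d/4\rfloor$ if $d\equiv 2,3\bmod 4$. Then there exists a hyperelliptic curve $X/K$ of genus $g$ with a $K$-rational point and a new special point in $X(L)$. When $d\equiv 2\bmod 4$ and $g=\lfloor d/4\rfloor-1\geq 2$, there exists a hyperelliptic curve $X/K$ of genus $g$ with a new special point in $X(L)$. In all three cases, there are infinitely many such curves, pairwise non-isomorphic over $\overline{K}$.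
   Context: A hyperelliptic curve over a field $K$ is any smooth projective geometrically connected curve $X/K$ of genus $g\geq 1$ admitting a $K$-morphism of degree $2$ to $\mathbb{P}^1_K$ (genus $1$ is allowed). For a scheme $X$ of finite type over $K$ and a finite extension $L/K$, a point of $X(L)$ is new if it does not belong to $\bigcup_F X(F)$, where $F$ runs over all proper subfields $K\subseteq F\subset L$; equivalently, the residue field of the image closed point of $\operatorname{Spec} L\to X$ is isomorphic to $L$ via the induced $K$-embedding. Let $X/K$ be a hyperelliptic curve with a morphism $\pi:X\to\mathbb{P}^1_K$ of degree $2$. A closed point $P\in X$ is special if $\pi^*:K(\pi(P))\to K(P)$ (residue fields) is an isomorphism; when $g=1$ this notion depends on the choice of a degree-$2$ morphism $\pi$. A point of $X(L)$ is special if its image closed point is. *)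

(* Defs.v *)
From HB Require Import structures.
From mathcomp Require Import all_boot all_order all_algebra all_field.
From mathcomp Require Import mpoly.

Import GRing.Theory.
Local Open Scope ring_scope.

(* A point of P^n with values in a field F is a nonzero row vector of
   homogeneous coordinates in 'rV[F]_n.+1, up to [proj_eq].  Polynomials have
   coefficients in K, and F is an extension of K through a ring morphism f. *)

Definition proj_eq {F : fieldType} {n} (v w : 'rV[F]_n.+1) : Prop :=
  exists2 c : F, c != 0 & v = c *: w.

Definition peval {K F : fieldType} (f : {rmorphism K -> F}) {n}
    (v : 'rV[F]_n) (p : {mpoly K[n]}) : F :=
  mmap f (v 0) p.

Definition homogeneous {K : fieldType} {n} (p : {mpoly K[n]}) : Prop :=
  exists d : nat, p \is d.-homog.

(* The closed subscheme of P^pdim over K cut out by homogeneous equations. *)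
Record proj_scheme (K : fieldType) := ProjScheme {
  pdim : nat;
  eqs : seq {mpoly K[pdim.+1]};
  eqs_homog : forall p, p \in eqs -> homogeneous p
}.

Arguments pdim {K} _.
Arguments eqs {K} _.
Arguments eqs_homog {K} _ _ _.

Lemma homog_nil (K : fieldType) n (p : {mpoly K[n]}) :
  p \in [::] -> homogeneous p.
Proof. by []. Qed.

Definition proj_space (K : fieldType) (m : nat) : proj_scheme K :=
  ProjScheme K m [::] (homog_nil K m.+1).

Lemma homog_map (K F : fieldType) (f : {rmorphism K -> F}) n
    (s : seq {mpoly K[n]}) :
  (forall p, p \in s -> homogeneous p) ->
  forall p, p \in [seq map_mpoly f q | q <- s] -> homogeneous p.
Proof.
move=> hs p /mapP [q /hs [d /dhomogP hq] ->]; exists d; apply/dhomogP => m hm.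
apply: hq; move: hm; rewrite !mcoeff_msupp mcoeff_map_mpoly.
by apply: contraNneq => ->; apply/eqP; exact: raddf0.
Qed.

Definition base_change {K F : fieldType} (f : {rmorphism K -> F})
    (X : proj_scheme K) : proj_scheme F :=
  ProjScheme F (pdim X) [seq map_mpoly f q | q <- eqs X]
    (homog_map K F f (pdim X).+1 (eqs X) (eqs_homog X)).

Definition is_point {K F : fieldType} (f : {rmorphism K -> F})
    (X : proj_scheme K) (v : 'rV[F]_(pdim X).+1) : Prop :=
  v != 0 /\ forall p, p \in eqs X -> peval f v p = 0.

(* The residue field, as a subfield of F, of the image of Spec F -> P^n: the
   values at v of the rational functions defined there. *)
Definition residue {K F : fieldType} (f : {rmorphism K -> F}) {n}
    (v : 'rV[F]_n.+1) (a : F) : Prop :=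
  exists (d : nat) (p q : {mpoly K[n.+1]}),
    [/\ p \is d.-homog, q \is d.-homog, peval f v q != 0
      & a = peval f v p / peval f v q].

(* Data for a rational map from X to Y: a list of tuples of forms.  It is a
   morphism, with these tuples as local representatives, under
   [is_morphism]. *)
Definition rep {K : fieldType} (X Y : proj_scheme K) : Type :=
  seq 'rV[{mpoly K[(pdim X).+1]}]_(pdim Y).+1.

Definition maps_to {K F : fieldType} (f : {rmorphism K -> F})
    {X Y : proj_scheme K} (phi : rep X Y)
    (v : 'rV[F]_(pdim X).+1) (w : 'rV[F]_(pdim Y).+1) : Prop :=
  w != 0 /\ exists2 s, s \in phi & w = map_mx (peval f v) s.

(* E and E' are subfields of F, with E' contained in E; [E : E'] = N. *)
Definition subfield_degree {F : fieldType} (E E' : F -> Prop) (N : nat) : Prop :=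
  exists e : 'rV[F]_N,
    (forall i, E (e 0 i)) /\
    forall a, E a -> exists! c : 'rV[F]_N,
      (forall i, E' (c 0 i)) /\ a = \sum_i c 0 i * e 0 i.

(* In the geometric notions below, k is an algebraic closure of K. *)

Definition vanishes_on {K : fieldType} {k : closedFieldType}
    (iota : {rmorphism K -> k}) (X : proj_scheme K)
    (p : {mpoly K[(pdim X).+1]}) : Prop :=
  forall v, is_point iota X v -> peval iota v p = 0.

(* For X geometrically reduced this is exactly the notion of a K-morphism:
   representatives may then be compared on geometric points. *)
Definition is_morphism {K : fieldType} {k : closedFieldType}
    (iota : {rmorphism K -> k}) {X Y : proj_scheme K} (phi : rep X Y) : Prop :=
  [/\ forall s, s \in phi -> exists d : nat, forall i, s 0 i \is d.-homog,
      forall v, is_point iota X v -> exists w, maps_to iota phi v w,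
      forall s t, s \in phi -> t \in phi ->
        forall i j, vanishes_on iota X (s 0 i * t 0 j - s 0 j * t 0 i)
    & forall v w, is_point iota X v -> maps_to iota phi v w ->
        is_point iota Y w].

Definition jacobian {K : fieldType} {k : closedFieldType}
    (iota : {rmorphism K -> k}) (X : proj_scheme K)
    (v : 'rV[k]_(pdim X).+1) : 'M[k]_(size (eqs X), (pdim X).+1) :=
  \matrix_(i, j) peval iota v (mderiv j (eqs X)`_i).

Definition zero_of {k : fieldType} {n} (S : seq {mpoly k[n.+1]})
    (v : 'rV[k]_n.+1) : Prop :=
  forall p, p \in S -> p.@[v 0] = 0.

Definition geom_connected {K : fieldType} {k : closedFieldType}
    (iota : {rmorphism K -> k}) (X : proj_scheme K) : Prop :=
  forall S T : seq {mpoly k[(pdim X).+1]},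
    (forall p, p \in S ++ T -> homogeneous p) ->
    (forall v, is_point iota X v -> zero_of S v \/ zero_of T v) ->
    (exists v, is_point iota X v /\ zero_of S v) ->
    (exists v, is_point iota X v /\ zero_of T v) ->
    exists v, [/\ is_point iota X v, zero_of S v & zero_of T v].

Definition geom_infinite {K : fieldType} {k : closedFieldType}
    (iota : {rmorphism K -> k}) (X : proj_scheme K) : Prop :=
  forall s : seq 'rV[k]_(pdim X).+1, exists v,
    is_point iota X v /\ forall w, w \in s -> ~ proj_eq v w.

(* The second condition is the Jacobian criterion with tangent spaces of
   dimension 1.  Given connectedness, X is then smooth of pure dimension 1 or
   has a single point; the first condition excludes the latter. *)
Definition smooth_geom_connected_curve {K : fieldType} {k : closedFieldType}
    (iota : {rmorphism K -> k}) (X : proj_scheme K) : Prop :=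
  [/\ geom_infinite iota X,
      forall v, is_point iota X v -> (\rank (jacobian iota X v)).+1 = pdim X
    & geom_connected iota X].

(* The degree m part of the homogeneous coordinate ring of X has dimension h. *)
Definition hilbert_function {K : fieldType} {k : closedFieldType}
    (iota : {rmorphism K -> k}) (X : proj_scheme K) (m h : nat) : Prop :=
  exists b : 'I_h -> {mpoly K[(pdim X).+1]},
    (forall i, b i \is m.-homog) /\
    forall p, p \is m.-homog -> exists! c : 'rV[K]_h,
      vanishes_on iota X (p - \sum_i c 0 i *: b i).

(* The Hilbert polynomial of X is D * m + 1 - g.  For a smooth projective
   geometrically connected curve this g = h^1(O_X) is the genus. *)
Definition genus {K : fieldType} {k : closedFieldType}
    (iota : {rmorphism K -> k}) (X : proj_scheme K) (g : nat) : Prop :=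
  exists D N : nat, forall m, (N <= m)%N ->
    exists2 h, hilbert_function iota X m h & (h + g = D * m + 1)%N.

(* v is the generic point of X, with values in some extension F of K;
   [residue f v] is then the function field of X. *)
Definition generic_point {K : fieldType} {k : closedFieldType}
    (iota : {rmorphism K -> k}) (X : proj_scheme K)
    {F : fieldType} (f : {rmorphism K -> F}) (v : 'rV[F]_(pdim X).+1) : Prop :=
  is_point f X v /\
  forall p, homogeneous p -> peval f v p = 0 -> vanishes_on iota X p.

(* The degree of phi is that of the extension of function fields
   [K(X) : phi^* K(Y)]; finiteness forces phi(v) to be generic in Y when X and
   Y are curves. *)
Definition morphism_degree {K : fieldType} {k : closedFieldType}
    (iota : {rmorphism K -> k}) {X Y : proj_scheme K} (phi : rep X Y)
    (N : nat) : Prop :=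
  exists (F : fieldType) (f : {rmorphism K -> F}) v w,
    [/\ generic_point iota X f v, maps_to f phi v w
      & subfield_degree (residue f v) (residue f w) N].

Definition double_cover {K : fieldType} {k : closedFieldType}
    (iota : {rmorphism K -> k}) {X : proj_scheme K}
    (pi : rep X (proj_space K 1)) : Prop :=
  is_morphism iota pi /\ morphism_degree iota pi 2.

Definition has_rational_point {K : fieldType} (X : proj_scheme K) : Prop :=
  exists v : 'rV[K]_(pdim X).+1, is_point idfun X v.

Definition hyperelliptic {K : fieldType} {k : closedFieldType}
    (iota : {rmorphism K -> k}) (X : proj_scheme K) (g : nat) : Prop :=
  [/\ smooth_geom_connected_curve iota X, genus iota X g, (1 <= g)%N
    & exists pi : rep X (proj_space K 1), double_cover iota pi].

Definition elliptic {K : fieldType} {k : closedFieldType}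
    (iota : {rmorphism K -> k}) (X : proj_scheme K) : Prop :=
  [/\ smooth_geom_connected_curve iota X, genus iota X 1
    & has_rational_point X].

Definition new_point {K : fieldType} (L : fieldExtType K) (X : proj_scheme K)
    (v : 'rV[L]_(pdim X).+1) : Prop :=
  is_point (in_alg L) X v /\
  forall M : {subfield L}, (M != fullv :> {vspace L}) ->
    ~ exists w, proj_eq w v /\ forall i, w 0 i \in M.

Definition special_point {K : fieldType} (L : fieldExtType K)
    {X : proj_scheme K} (pi : rep X (proj_space K 1))
    (v : 'rV[L]_(pdim X).+1) : Prop :=
  exists2 w, maps_to (in_alg L) pi v w &
    forall a, residue (in_alg L) w a <-> residue (in_alg L) v a.

Definition has_new_point {K : fieldType} (L : fieldExtType K)
    (X : proj_scheme K) : Prop :=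
  exists v, new_point L X v.

(* Special with respect to some morphism of degree 2 to P^1. *)
Definition has_new_special_point {K : fieldType} {k : closedFieldType}
    (iota : {rmorphism K -> k}) (L : fieldExtType K)
    (X : proj_scheme K) : Prop :=
  exists (pi : rep X (proj_space K 1)) v,
    [/\ double_cover iota pi, new_point L X v & special_point L pi v].

Definition isomorphic {k : closedFieldType} (X Y : proj_scheme k) : Prop :=
  exists (phi : rep X Y) (psi : rep Y X),
    [/\ is_morphism idfun phi, is_morphism idfun psi,
        forall v w v', is_point idfun X v -> maps_to idfun phi v w ->
          maps_to idfun psi w v' -> proj_eq v' v
      & forall w v w', is_point idfun Y w -> maps_to idfun psi w v ->
          maps_to idfun phi v w' -> proj_eq w' w].

Definition infinitely_many {K : fieldType} {k : closedFieldType}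
    (iota : {rmorphism K -> k}) (P : proj_scheme K -> Prop) : Prop :=
  exists X : nat -> proj_scheme K,
    (forall i, P (X i)) /\
    forall i j, i <> j ->
      ~ isomorphic (base_change iota (X i)) (base_change iota (X j)).

(* Main.v *)
(* For alpha generating L, let F be the product of the minimal polynomial of
   alpha with factors X - c_j, c_j in K, adjusted so that deg F = 2m = 4g + 6.
   Completing the square, F = q^2 - h with deg q = m and deg h < m, so that
   deg h = 2g + 2 in general and the curve y^2 = h(x) of genus g carries the
   points (alpha, q(alpha)) and (c_j, q(c_j)).  Every h of degree less than m
   arises in this way from the roots of q^2 - h, so a generic choice of alpha
   and of the c_j makes h squarefree and keeps the j-invariants of all
   quadruples of its roots away from finitely many values, which rules out
   isomorphisms with finitely many given curves.
   For d = 10 and g = 1 there is no room for a c_j; one passes to the Jacobian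
   of the genus 1 curve, which is an elliptic curve with the same invariants,
   and the image of the point is still new for generic alpha. *)

Require Import Defs.
From Stdlib Require Import IndefiniteDescription.
From mathcomp Require Import all_boot all_order all_fingroup all_algebra all_field.
From mathcomp Require Import mpoly ring zify generic_quotient.
Import GRing.Theory.
Set Implicit Arguments.
Unset Strict Implicit.
Unset Printing Implicit Defensive.
Local Open Scope ring_scope.

(** * The curve y^2 = h(x) as a projective scheme *)

Section Peval.
Variables (K F : fieldType) (f : {rmorphism K -> F}) (n : nat) (v : 'rV[F]_n).

Lemma peval0 : peval f v 0 = 0. Proof. exact: rmorph0. Qed.
Lemma pevalD p q : peval f v (p + q) = peval f v p + peval f v q.
Proof. exact: rmorphD. Qed.
Lemma pevalB p q : peval f v (p - q) = peval f v p - peval f v q.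
Proof. exact: rmorphB. Qed.
Lemma pevalM p q : peval f v (p * q) = peval f v p * peval f v q.
Proof. exact: rmorphM. Qed.
Lemma pevalXn p m : peval f v (p ^+ m) = peval f v p ^+ m.
Proof. exact: rmorphXn. Qed.
Lemma peval_sum I (r : seq I) P G :
  peval f v (\sum_(i <- r | P i) G i) = \sum_(i <- r | P i) peval f v (G i).
Proof. exact: rmorph_sum. Qed.
Lemma peval_prod I (r : seq I) P G :
  peval f v (\prod_(i <- r | P i) G i) = \prod_(i <- r | P i) peval f v (G i).
Proof. exact: rmorph_prod. Qed.
Lemma pevalZ c p : peval f v (c *: p) = f c * peval f v p.
Proof. exact: mmapZ. Qed.
Lemma pevalX i : peval f v 'X_i = v 0 i.
Proof. by rewrite /peval mmapX mmap1U. Qed.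
Lemma peval_homog c d p : p \is d.-homog ->
  peval f (c *: v) p = c ^+ d * peval f v p.
Proof.
move=> /dhomogP hp; rewrite /peval /mmap mulr_sumr big_seq [RHS]big_seq.
apply: eq_bigr => m /hp <-.
rewrite /mmap1 mulrCA; congr (_ * _).
under eq_bigr => i _ do rewrite mxE exprMn.
by rewrite big_split /= prodrXr mdegE.
Qed.
End Peval.

Section Model.
Variables (K : fieldType) (n : nat) (h : {poly K}).

(* With X_i = x^i for i <= n and X_(n+1) = y: the cone over the rational normal
   curve of degree n, cut by y^2 = h(x), where deg h = 2n and the genus is n - 1. *)
Definition minor_eq (i j : nat) : {mpoly K[n.+2]} :=
  'X_(inord i) * 'X_(inord j.+1) - 'X_(inord i.+1) * 'X_(inord j).

Definition quad_form : {mpoly K[n.+2]} :=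
  \sum_(k < n.*2.+1) h`_k *: ('X_(inord k./2) * 'X_(inord (uphalf k))).

Definition model_eqs : seq {mpoly K[n.+2]} :=
  ('X_ord_max ^+ 2 - quad_form) ::
  [seq minor_eq ij.1 ij.2 | ij : 'I_n * 'I_n].

Lemma homogX (i : 'I_n.+2) : ('X_i : {mpoly K[n.+2]}) \is 1.-homog.
Proof. by rewrite dhomogX; apply/eqP; exact: mdeg1. Qed.

Lemma homogXX (i j : 'I_n.+2) : ('X_i * 'X_j : {mpoly K[n.+2]}) \is 2.-homog.
Proof. exact: (dhomogM (homogX i) (homogX j)). Qed.

Lemma model_homog2 p : p \in model_eqs -> p \is 2.-homog.
Proof.
rewrite inE => /orP [/eqP ->|/imageP [ij _ ->]].
  apply: rpredB; first by rewrite expr2 homogXX.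
  by apply: rpred_sum => k _; apply: rpredZ; exact: homogXX.
by apply: rpredB; exact: homogXX.
Qed.

Lemma model_homog p : p \in model_eqs -> homogeneous p.
Proof. by move=> hp; exists 2%N; exact: model_homog2. Qed.

Definition model := ProjScheme K n.+1 model_eqs model_homog.

End Model.

Definition emb (F : fieldType) n (x : nat -> F) (y : F) : 'rV[F]_n.+2 :=
  \row_i (if (i < n.+1)%N then x i else y).
Definition aff (F : fieldType) n (t y : F) : 'rV[F]_n.+2 :=
  emb n (fun i => t ^+ i) y.
Definition infp (F : fieldType) n (y : F) : 'rV[F]_n.+2 :=
  emb n (fun i => (i == n)%:R) y.

Lemma emb_inord (F : fieldType) n (x : nat -> F) y i : (i <= n)%N ->
  emb n x y 0 (inord i) = x i.
Proof. by move=> hi; rewrite mxE inordK ?ltnS ?hi // leqW. Qed.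

Lemma emb_max (F : fieldType) n (x : nat -> F) y : emb n x y 0 ord_max = y.
Proof. by rewrite mxE /= ltnn. Qed.

Lemma aff_neq0 (F : fieldType) n (t y : F) : aff n t y != 0 :> 'rV[F]__.
Proof.
apply/eqP => /rowP /(_ (inord 0)); rewrite emb_inord // expr0 mxE => /eqP.
by rewrite oner_eq0.
Qed.

Lemma infp_neq0 (F : fieldType) n (y : F) : infp n y != 0 :> 'rV[F]__.
Proof.
apply/eqP => /rowP /(_ (inord n)); rewrite emb_inord // eqxx mxE => /eqP.
by rewrite oner_eq0.
Qed.

Lemma row_split (F : fieldType) n (v w : 'rV[F]_n.+2) : v 0 ord_max = w 0 ord_max ->
  (forall i, (i <= n)%N -> v 0 (inord i) = w 0 (inord i)) -> v = w.
Proof.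
move=> hm hi; apply/rowP => i.
have [hin|hin] := leqP i n; first by have := hi i hin; rewrite inord_val.
have -> // : i = ord_max by apply/val_inj; have := ltn_ord i => /=; lia.
Qed.

Lemma half_bounds n k : (k < n.*2.+1)%N -> (k./2 <= n)%N /\ (uphalf k <= n)%N.
Proof. by move=> hk; split; lia. Qed.

Section Points.
Variables (K F : fieldType) (f : {rmorphism K -> F}) (n : nat) (h : {poly K}).
Hypothesis n_gt0 : (0 < n)%N.
Hypothesis size_h : (size h <= n.*2.+1)%N.

Lemma peval_quad (v : 'rV[F]_n.+2) : peval f v (quad_form n h) =
  \sum_(k < n.*2.+1) f h`_k * (v 0 (inord k./2) * v 0 (inord (uphalf k))).
Proof.
by rewrite peval_sum; apply: eq_bigr => k _; rewrite pevalZ pevalM !pevalX.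
Qed.

Lemma quad_aff c t y :
  peval f (c *: aff n t y) (quad_form n h) = c ^+ 2 * (map_poly f h).[t].
Proof.
rewrite peval_quad (@horner_coef_wide _ n.*2.+1) ?size_map_poly //.
rewrite mulr_sumr; apply: eq_bigr => k _.
have [h1 h2] := half_bounds (ltn_ord k).
rewrite !mxE -/(aff n t y) !inordK ?ltnS ?h1 ?h2 ?(leqW h1) ?(leqW h2) //.
rewrite coef_map /=.
have -> : t ^+ k = t ^+ k./2 * t ^+ uphalf k by rewrite -exprD; congr (_ ^+ _); lia.
ring.
Qed.

Lemma quad_inf c y :
  peval f (c *: infp n y) (quad_form n h) = c ^+ 2 * f h`_(n.*2).
Proof.
rewrite peval_quad big_ord_recr /= big1 ?add0r => [|k _].
  by rewrite uphalf_double doubleK !mxE !inordK ?leqnSn // ltnSn eqxx !mulr1 mulrC -expr2.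
have [h1 h2] := half_bounds (leqW (ltn_ord k)).
rewrite !mxE !inordK ?ltnS ?h1 ?h2 ?(leqW h1) ?(leqW h2) //.
have -> : (k./2 == n) = false by have := ltn_ord k; lia.
by rewrite !(mulr0, mul0r).
Qed.

Lemma is_point_eqs (v : 'rV[F]_n.+2) : is_point f (model n h) v <->
  [/\ v != 0, v 0 ord_max ^+ 2 = peval f v (quad_form n h) &
      forall i j, (i < n)%N -> (j < n)%N ->
       v 0 (inord i) * v 0 (inord j.+1) = v 0 (inord i.+1) * v 0 (inord j)].
Proof.
split=> [[v0 hv]|[v0 hq hm]].
  split=> //.
    have := hv _ (mem_head _ _).
    by rewrite pevalB pevalXn pevalX => /eqP; rewrite subr_eq0 => /eqP.
  move=> i j hi hj; have := hv (minor_eq K n i j).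
  rewrite inE (_ : _ \in [seq _ | _ : _]) ?orbT; last first.
    by apply/imageP; exists (Ordinal hi, Ordinal hj).
  rewrite pevalB !pevalM !pevalX => /(_ isT) /eqP.
  by rewrite subr_eq0 => /eqP.
split=> // p; rewrite inE => /orP [/eqP ->|/imageP [[i j] _ ->]].
  by rewrite pevalB pevalXn pevalX hq subrr.
by rewrite pevalB !pevalM !pevalX /= hm ?ltn_ord // subrr.
Qed.

Lemma affP c t y : c != 0 -> y ^+ 2 = (map_poly f h).[t] ->
  is_point f (model n h) (c *: aff n t y).
Proof.
move=> c0 hy; apply/is_point_eqs; split.
- by rewrite scaler_eq0 negb_or c0 aff_neq0.
- by rewrite quad_aff -hy mxE emb_max exprMn.
- move=> i j hi hj; rewrite ![(_ *: _ : matrix _ _ _) _ _]mxE !emb_inord //; try lia.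
  by rewrite !exprS; ring.
Qed.

Lemma infpP c y : c != 0 -> y ^+ 2 = f h`_(n.*2) ->
  is_point f (model n h) (c *: infp n y).
Proof.
move=> c0 hy; apply/is_point_eqs; split.
- by rewrite scaler_eq0 negb_or c0 infp_neq0.
- by rewrite quad_inf -hy mxE emb_max exprMn.
- move=> i j hi hj; rewrite ![(_ *: _ : matrix _ _ _) _ _]mxE !emb_inord //; try lia.
  have -> : (i == n) = false by lia.
  have -> : (j == n) = false by lia.
  by rewrite !(mulr0, mul0r).
Qed.

Lemma is_pointE (v : 'rV[F]_n.+2) : is_point f (model n h) v <->
  exists2 c, c != 0 &
    (exists t y, y ^+ 2 = (map_poly f h).[t] /\ v = c *: aff n t y)
    \/ (exists y, y ^+ 2 = f h`_(n.*2) /\ v = c *: infp n y).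
Proof.
split; last first.
  by case=> c c0 [[t [y [hy ->]]]|[y [hy ->]]]; [exact: affP|exact: infpP].
move=> /is_point_eqs [v0 hq hm].
pose X i := v 0 (inord i).
have [X0|X0] := eqVneq (X 0) 0; last first.
  exists (X 0) => //; left; exists (X 1 / X 0), (v 0 ord_max / X 0).
  suff hv : v = X 0 *: aff n (X 1 / X 0) (v 0 ord_max / X 0).
    split=> //; apply: (mulfI (expf_neq0 2 X0)).
    by rewrite -(quad_aff _ _ (v 0 ord_max / X 0)) -hv -hq expr_div_n; field.
  apply: row_split; first by rewrite mxE emb_max mulrC divfK.
  move=> i hi; rewrite mxE emb_inord //.
  elim: i hi => [|i IH] hi; first by rewrite expr0 mulr1.
  apply: (mulfI X0); rewrite hm // -/(X _) IH 1?ltnW // exprS; field.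
  by [].
have Xi i : (i < n)%N -> X i = 0.
  elim: i => [//|i IH hi]; have := hm i i.+1 (ltnW hi) hi.
  by rewrite -!/(X _) IH 1?ltnW // mul0r => /esym/eqP; rewrite mulf_eq0 orbb => /eqP.
have Xn : X n != 0.
  apply: contraNneq v0 => Xn.
  have Xi' i : (i <= n)%N -> X i = 0.
    by rewrite leq_eqVlt => /orP [/eqP ->|/Xi].
  apply/eqP/row_split => [|i hi]; last by rewrite mxE; exact: Xi'.
  rewrite mxE; apply/eqP; rewrite -sqrf_eq0 hq peval_quad big1 // => k _.
  have [h1 h2] := half_bounds (ltn_ord k).
  by rewrite -/(X _) Xi' // mul0r mulr0.
exists (X n) => //; right; exists (v 0 ord_max / X n).
suff hv : v = X n *: infp n (v 0 ord_max / X n).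
  split=> //; apply: (mulfI (expf_neq0 2 Xn)).
  by rewrite -(quad_inf _ (v 0 ord_max / X n)) -hv -hq expr_div_n; field.
apply: row_split; first by rewrite mxE emb_max mulrC divfK.
move=> i hi; rewrite mxE emb_inord //.
have [->|ni] := eqVneq i n; first by rewrite mulr1.
by rewrite mulr0; apply: Xi; rewrite ltn_neqAle ni.
Qed.

End Points.

Lemma squarefree_dvdp (F : fieldType) (h S D E : {poly F}) :
  separable_poly h -> D != 0 -> E ^+ 2 * h = D ^+ 2 * S -> h %| S.
Proof.
move=> hsep D0 eqn; set g := gcdp D E.
have g0 : g != 0 by rewrite gcdp_eq0 negb_and D0.
have cop : coprimep (D %/ g) (E %/ g) by apply: coprimep_div_gcd; rewrite D0.
have eD : D = D %/ g * g by rewrite divpK // dvdp_gcdl.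
have eE : E = E %/ g * g by rewrite divpK // dvdp_gcdr.
move: cop eD eE; set D1 := D %/ g; set E1 := E %/ g => cop eD eE.
have eqn1 : E1 ^+ 2 * h = D1 ^+ 2 * S.
  apply: (mulfI (expf_neq0 2 g0)).
  have -> : g ^+ 2 * (E1 ^+ 2 * h) = (E1 * g) ^+ 2 * h by ring.
  have -> : g ^+ 2 * (D1 ^+ 2 * S) = (D1 * g) ^+ 2 * S by ring.
  by rewrite -eD -eE.
have D1h : D1 ^+ 2 %| h.
  have cop2 : coprimep (D1 ^+ 2) (E1 ^+ 2).
    by rewrite coprimep_expl // coprimep_expr.
  by rewrite -(Gauss_dvdpr h cop2) eqn1 dvdp_mulr.
have sD1 : size D1 == 1.
  by apply: contraTT D1h => sD1; rewrite (separable_nosquare hsep).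
have : h %| D1 ^+ 2 * S by rewrite -eqn1 dvdp_mull.
rewrite Gauss_dvdpr // coprimep_sym coprimep_expl //.
by move: sD1; rewrite size_poly_eq1 => /eqp_coprimepl ->; exact: coprime1p.
Qed.

Lemma squarefree_norm (F : fieldType) (h A B : {poly F}) :
  separable_poly h -> (1 < size h)%N -> A ^+ 2 = B ^+ 2 * h -> A = 0 /\ B = 0.
Proof.
move=> hsep sh eqn.
have h0 : h != 0 by rewrite -size_poly_gt0 ltnW.
have [A0|A0] := eqVneq A 0.
  split=> //; move: eqn; rewrite A0 expr0n /= => /esym/eqP.
  by rewrite mulf_eq0 (negbTE h0) orbF sqrf_eq0 => /eqP.
have : h %| 1 by apply: (squarefree_dvdp hsep A0); rewrite mulr1 eqn.
by rewrite dvdp1 => /eqP s1; rewrite s1 in sh.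
Qed.

Section ClosedField.
Variable k : closedFieldType.

Lemma closed_poly0 (p : {poly k}) : (forall t, p.[t] = 0) -> p = 0.
Proof.
move=> hp; have /closed_rootP : ~ exists x, root (p + 1) x.
  by case=> x; rewrite /root hornerD hp add0r hornerC oner_eq0.
move=> /size_poly1P [c _ /eqP].
move=> /eqP ep; have ep' : p = (c - 1)%:P by rewrite polyCB -ep polyC1 addrK.
by have := hp 0; rewrite ep' hornerC => ->.
Qed.

Lemma closed_neq0 (p : {poly k}) : p != 0 -> exists t, p.[t] != 0.
Proof.
move=> p0; have [/size_poly1P [c c0 ->]|s1] := boolP (size p == 1).
  by exists 0; rewrite hornerC.
have : size (p - 1) != 1.
  have sp : (1 < size p)%N by rewrite ltn_neqAle eq_sym s1 size_poly_gt0.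
  by rewrite size_polyDl // size_polyN size_poly1.
case/closed_rootP => x; rewrite /root hornerD hornerN hornerC subr_eq0 => /eqP px.
by exists x; rewrite px oner_neq0.
Qed.

Lemma closed_sqrt (a : k) : exists y, y ^+ 2 = a.
Proof.
have : size ('X^2 - a%:P) != 1 by rewrite size_XnsubC.
case/closed_rootP => y; rewrite /root !hornerE subr_eq0 => /eqP hy.
by exists y.
Qed.

Lemma closed_curve0 (h A B : {poly k}) : 2%:R != 0 :> k -> h != 0 ->
  (forall t y, y ^+ 2 = h.[t] -> A.[t] + B.[t] * y = 0) -> A = 0 /\ B = 0.
Proof.
move=> two0 h0 hAB.
have A0 : A = 0.
  apply: closed_poly0 => t; have [y hy] := closed_sqrt h.[t].
  have h1 := hAB t y hy; have h2 := hAB t (- y); rewrite sqrrN in h2.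
  apply: (mulfI two0); rewrite mulr0 -[RHS](addr0 0) -{1}h1 -(h2 hy); ring.
split=> //; apply/eqP; rewrite -sqrf_eq0 -(mulIr_eq0 _ (mulIf h0)); apply/eqP.
apply: closed_poly0 => t; have [y hy] := closed_sqrt h.[t].
rewrite hornerM horner_exp -hy -exprMn; have := hAB t y hy.
by rewrite A0 horner0 add0r => ->; rewrite expr0n.
Qed.

End ClosedField.

Section NormalForm.
Variables (K : fieldType) (n : nat) (h : {poly K}).
Hypothesis n_gt0 : (0 < n)%N.
Hypothesis size_h : (size h <= n.*2.+1)%N.

(* p restricts to A(x) + B(x) y on the curve; the top coefficients of A and B
   give its values at the points at infinity. *)
Definition normal_form (m : nat) (p : {mpoly K[n.+2]}) (A B : {poly K}) :=
  [/\ (size A <= (m * n).+1)%N, (size B <= (m * n).+1 - n)%N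
    & forall (F : fieldType) (f : {rmorphism K -> F}),
      (forall t y, y ^+ 2 = (map_poly f h).[t] ->
        peval f (aff n t y) p = (map_poly f A).[t] + (map_poly f B).[t] * y) /\
      (forall y, y ^+ 2 = f h`_(n.*2) ->
        peval f (infp n y) p = f A`_(m * n) + f B`_(m * n - n) * y)].

Lemma normal_formD m p q A B A' B' : normal_form m p A B ->
  normal_form m q A' B' -> normal_form m (p + q) (A + A') (B + B').
Proof.
move=> [sA sB hp] [sA' sB' hq]; split.
- by rewrite (leq_trans (size_polyD _ _)) // geq_max sA.
- by rewrite (leq_trans (size_polyD _ _)) // geq_max sB.
- move=> F f; have [hp1 hp2] := hp F f; have [hq1 hq2] := hq F f.
  split=> [t y hy|y hy].
    by rewrite pevalD hp1 // hq1 // !rmorphD !hornerD /=; ring.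
  by rewrite pevalD hp2 // hq2 // !coefD !rmorphD /=; ring.
Qed.

Lemma normal_formZ m c p A B : normal_form m p A B ->
  normal_form m (c *: p) (c *: A) (c *: B).
Proof.
move=> [sA sB hp]; split.
- exact: leq_trans (size_scale_leq _ _) sA.
- exact: leq_trans (size_scale_leq _ _) sB.
- move=> F f; have [hp1 hp2] := hp F f; split=> [t y hy|y hy].
    by rewrite pevalZ hp1 // !map_polyZ !hornerZ /=; ring.
  by rewrite pevalZ hp2 // !coefZ !rmorphM /=; ring.
Qed.

Lemma normal_formX m (i : 'I_n.+2) p A B : normal_form m p A B ->
  exists A' B', normal_form m.+1 ('X_i * p) A' B'.
Proof.
move=> [sA sB hp]; have [hin|hin] := leqP i n.
  exists (A * 'X^i), (B * 'X^i); split.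
  - by rewrite (leq_trans (size_polyMleq _ _)) // size_polyXn; lia.
  - have [->|B0] := eqVneq B 0; first by rewrite mul0r size_poly0.
    rewrite -size_poly_gt0 in B0.
    by rewrite (leq_trans (size_polyMleq _ _)) // size_polyXn; move: sB B0; lia.
  - move=> F f; have [hp1 hp2] := hp F f; split=> [t y hy|y hy].
      rewrite pevalM pevalX hp1 // !rmorphM /= !map_polyXn !hornerM !hornerXn.
      by rewrite mxE ltnS hin; ring.
    rewrite pevalM pevalX hp2 // mxE ltnS hin !coefMXn.
    have -> : (m.+1 * n < i)%N = false by lia.
    have [->|ni] := eqVneq (i : nat) n.
      rewrite mul1r mulSn addKn; congr (_ + _).
      have [m0|m0] := posnP m; last first.
        have mn : (n <= m * n)%N by rewrite leq_pmull.
        by rewrite ltnNge mn.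
      have -> : B = 0.
        by apply/eqP; rewrite -size_poly_eq0; move: sB; rewrite m0; lia.
      by rewrite !coef0 if_same.
    have {}hin : (i < n)%N by rewrite ltn_neqAle ni hin.
    rewrite [LHS]mul0r [A`_(_ - _)]nth_default; last by apply: leq_trans sA _; lia.
    rewrite [B`__]nth_default; last by apply: leq_trans sB _; lia.
    by rewrite if_same rmorph0 mul0r addr0.
have -> : i = ord_max by apply/val_inj; have := ltn_ord i => /=; lia.
exists (B * h), A; split.
- have [->|B0] := eqVneq B 0; first by rewrite mul0r size_poly0.
  rewrite -size_poly_gt0 in B0.
  by rewrite (leq_trans (size_polyMleq _ _)) //; move: size_h sB B0; lia.
- by move: sA; lia.
- move=> F f; have [hp1 hp2] := hp F f; split=> [t y hy|y hy].
    rewrite pevalM pevalX hp1 // emb_max rmorphM hornerM /= -hy; ring.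
  rewrite pevalM pevalX hp2 // emb_max.
  have -> : (m.+1 * n - n = m * n)%N by lia.
  have -> : (B * h)`_(m.+1 * n) = B`_(m * n - n) * h`_(n.*2).
    have [m0|m0] := posnP m.
      have -> : B = 0.
        by apply/eqP; rewrite -size_poly_eq0; move: sB; rewrite m0; lia.
      by rewrite mul0r !coef0 mul0r.
    have mn : (n <= m * n)%N by rewrite leq_pmull.
    rewrite coefM; have hlt : (m * n - n < (m.+1 * n).+1)%N by lia.
    rewrite (bigD1 (Ordinal hlt)) //= big1 ?addr0.
      by congr (_ * _`_ _); lia.
    move=> j /eqP hj; have [ltj|gtj|ej] := ltngtP (j : nat) (m * n - n)%N.
    - by rewrite [h`__]nth_default ?mulr0 //; apply: leq_trans size_h _; lia.
    - by rewrite [B`__]nth_default ?mul0r //; apply: leq_trans sB _; lia.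
    - by case: hj; apply/val_inj.
  rewrite rmorphM -hy /=; ring.
Qed.

Lemma normal_form_monomial (mm : 'X_{1..n.+2}) :
  exists A B, normal_form (mdeg mm) 'X_[mm] A B.
Proof.
have [m] := ubnP (mdeg mm); elim: m mm => // m IH mm; rewrite ltnS => hm.
have [m0|m0] := eqVneq mm 0%MM.
  exists 1, 0; rewrite m0 mdeg0 mpolyX0; split.
  - by rewrite size_poly1.
  - by rewrite size_poly0.
  - move=> F f; split=> [t y _|y _].
      by rewrite /peval rmorph1 !rmorph1 rmorph0 /= !hornerE.
    by rewrite /peval rmorph1 mul0n !coefC /= rmorph1 rmorph0 mul0r addr0.
have [i hi] : exists i, mm i != 0%N.
  apply/existsP; apply: contraR m0 => /existsPn hi; apply/eqP/mnmP => i.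
  by have := hi i; rewrite negbK mnm0E => /eqP.
have hle : (U_(i) <= mm)%MM by rewrite lep1mP.
have e : mm = (U_(i) + (mm - U_(i)))%MM by rewrite addmC submK.
have ed : mdeg mm = (mdeg (mm - U_(i))).+1 by rewrite {1}e mdegD mdeg1.
have [|A [B hAB]] := IH (mm - U_(i))%MM; first by rewrite -ed.
by rewrite ed {2}e mpolyXD; exact: normal_formX hAB.
Qed.

Lemma normal_form_exists m p : p \is m.-homog -> exists A B, normal_form m p A B.
Proof.
move=> /dhomogP hp; rewrite (mpolyE p).
elim: (msupp p) hp => [|mm s IH] hp.
  exists 0, 0; rewrite big_nil; split; rewrite ?size_poly0 // => F f.
  by split=> [t|] y _; rewrite peval0 ?rmorph0 ?horner0 ?coef0 ?rmorph0 mul0r addr0.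
rewrite big_cons; have [|A [B h1]] := IH.
  by move=> x hx; apply: hp; rewrite inE hx orbT.
have [A' [B' h2]] := normal_form_monomial mm.
rewrite (hp mm (mem_head _ _)) in h2.
by do 2!eexists; apply: normal_formD h1; exact: normal_formZ h2.
Qed.

Lemma affine_normal_form (p : {mpoly K[n.+2]}) :
  exists A B : {poly K}, forall (F : fieldType) (f : {rmorphism K -> F}) t y,
    y ^+ 2 = (map_poly f h).[t] ->
    peval f (aff n t y) p = (map_poly f A).[t] + (map_poly f B).[t] * y.
Proof.
elim/mpolyind: p => [|c mm p _ _ [A [B hAB]]].
  by exists 0, 0 => F f t y _; rewrite peval0 !rmorph0 horner0 mul0r addr0.
have [A' [B' [_ _ h2]]] := normal_form_monomial mm.
exists (c *: A' + A), (c *: B' + B) => F f t y hy.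
rewrite pevalD pevalZ hAB // (proj1 (h2 F f)) // !rmorphD /= !map_polyZ.
by rewrite !hornerD !hornerZ /=; ring.
Qed.

End NormalForm.

Lemma fraction_numden (R : idomainType) (z : {fraction R}) :
  exists a b : R, b != 0 /\ z = tofrac a / tofrac b.
Proof.
have hd := denom_ratioP (repr z).
exists (frac (repr z)).1, (frac (repr z)).2; split=> //.
have hd' : tofrac (frac (repr z)).2 != 0 by rewrite tofrac_eq0.
apply: (mulIf hd'); rewrite divfK //; apply/eqP.
rewrite -[X in X * _]reprK; rewrite !piE /=.
rewrite /FracField.mulf FracField.equivfE !numden_Ratio ?mulf_neq0 ?oner_neq0 //.
by rewrite !mulr1 mulrC.
Qed.

Lemma horner_map_polyX (K : fieldType) (S : comNzRingType)
    (g : {rmorphism {poly K} -> S}) (A : {poly K}) :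
  (map_poly (g \o polyC) A).[g 'X] = g A.
Proof.
elim/poly_ind: A => [|A c IH]; first by rewrite !rmorph0 horner0.
by rewrite !rmorphD !rmorphM /= map_polyX map_polyC hornerD hornerMX hornerC IH.
Qed.

(* F is the function field of the curve y^2 = h(x), with coordinates x, y. *)
Definition is_function_field (K F : fieldType) (f : {rmorphism K -> F})
    (h : {poly K}) (x y : F) :=
  [/\ y ^+ 2 = (map_poly f h).[x],
      forall A B, (map_poly f A).[x] + (map_poly f B).[x] * y = 0 ->
        A = 0 /\ B = 0
    & forall z, exists A B C, (map_poly f C).[x] != 0 /\
        z = ((map_poly f A).[x] + (map_poly f B).[x] * y) / (map_poly f C).[x]].

Lemma function_field_exists (K : fieldType) (h : {poly K}) :
  separable_poly h -> (1 < size h)%N ->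
  exists (F : fieldType) (f : {rmorphism K -> F}) x y, is_function_field f h x y.
Proof.
move=> hsep sh; pose E := {fraction {poly K}}; pose ht : E := tofrac h.
have irr : irreducible_poly ('X^2 - ht%:P).
  apply: cubic_irreducible => [|z]; rewrite ?size_XnsubC //.
  apply/negP; rewrite /root !hornerE subr_eq0 => /eqP hz.
  have [A [B [B0 ez]]] := fraction_numden z.
  have B0' : tofrac B != 0 :> E by rewrite tofrac_eq0.
  have : A ^+ 2 = B ^+ 2 * h.
    have ea : tofrac A = z * tofrac B by rewrite ez divfK.
    apply/eqP; rewrite -tofrac_eq tofracM !tofracXn -/ht -hz ea exprMn.
    by rewrite mulrC.
  by move=> /(squarefree_norm hsep sh) [_ B00]; rewrite B00 eqxx in B0.
have [L _ [y hy hgen]] := irredp_FAdjoin irr.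
pose g : {rmorphism {poly K} -> L} := in_alg L \o @tofrac {poly K}.
have ginj : injective g.
  by apply: inj_comp (fmorph_inj _) _ => p q /eqP; rewrite tofrac_eq => /eqP.
have ey : y ^+ 2 = g h.
  move: hy; rewrite /root rmorphB /= map_polyXn map_polyC !hornerE subr_eq0.
  by move/eqP.
exists L, (g \o polyC), (g 'X), y; split.
- by rewrite horner_map_polyX.
- move=> A B; rewrite !horner_map_polyX => /eqP; rewrite addr_eq0 => /eqP e.
  apply: (squarefree_norm hsep sh); apply: ginj.
  by rewrite rmorphXn e sqrrN exprMn ey -rmorphXn -rmorphM.
- have span (i : nat) (c : E) : exists a b : E, c%:A * y ^+ i = a%:A + b%:A * y.
    elim: i c => [|i IH] c; first by exists c, 0; rewrite scale0r mul0r addr0 mulr1.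
    have [a [b e]] := IH c; exists (b * ht), a.
    rewrite exprSr mulrA e mulrDl -mulrA -expr2 ey /g /= -in_algE.
    by rewrite addrC -!in_algE rmorphM.
  have span2 (z : L) : exists a b : E, z = a%:A + b%:A * y.
    have : z \in <<1; y>>%VS by rewrite hgen memvf.
    case/Fadjoin_polyP => p /polyOverP hp ->; rewrite horner_coef.
    elim/big_rec: _ => [|i w _ [a [b ->]]]; first by exists 0, 0; rewrite !scale0r mul0r addr0.
    have /vlineP [c ->] := hp i; have [a' [b' ->]] := span i c.
    by exists (a' + a), (b' + b); rewrite -!in_algE !rmorphD /=; ring.
  move=> z; have [a [b ->]] := span2 z.
  have [A [C [C0 ->]]] := fraction_numden a.
  have [B [D [D0 ->]]] := fraction_numden b.
  exists (A * D), (B * C), (C * D); rewrite !horner_map_polyX.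
  have gC : g C != 0 by rewrite -(rmorph0 g) (inj_eq ginj).
  have gD : g D != 0 by rewrite -(rmorph0 g) (inj_eq ginj).
  split; first by rewrite rmorphM mulf_neq0.
  rewrite !rmorphM -!in_algE !fmorph_div.
  rewrite [LHS](_ : _ = g A / g C + g B / g D * y) //.
  move: (g A) (g B) (g C) (g D) gC gD => a' b' c' d' c0 d0.
  by field; rewrite c0 d0.
Qed.

Section FunctionField.
Variables (K F : fieldType) (f : {rmorphism K -> F}) (h : {poly K}) (x y : F).
Hypothesis FF : is_function_field f h x y.

Lemma ff_transcendental A : (map_poly f A).[x] = 0 -> A = 0.
Proof.
move=> hA; have [_ H _] := FF; have [] // := H A 0.
by rewrite rmorph0 horner0 mul0r addr0.
Qed.

Lemma ff_horner_neq0 A : A != 0 -> (map_poly f A).[x] != 0.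
Proof. by apply: contraNneq => /ff_transcendental ->. Qed.

End FunctionField.

(** * Smoothness, genus and the double cover *)

Section Directional.
Variables (K F : fieldType) (f : {rmorphism K -> F}) (n : nat).
Variables (v u : 'rV[F]_n).

Definition dpeval (p : {mpoly K[n]}) : F :=
  \sum_j u 0 j * peval f v (mderiv j p).

Lemma dpevalB p q : dpeval (p - q) = dpeval p - dpeval q.
Proof.
rewrite /dpeval -sumrB; apply: eq_bigr => j _.
by rewrite mderivB pevalB mulrBr.
Qed.

Lemma dpevalZ c p : dpeval (c *: p) = f c * dpeval p.
Proof.
rewrite /dpeval mulr_sumr; apply: eq_bigr => j _.
by rewrite mderivZ pevalZ mulrCA.
Qed.

Lemma dpeval_sum I (r : seq I) G :
  dpeval (\sum_(i <- r) G i) = \sum_(i <- r) dpeval (G i).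
Proof.
rewrite /dpeval exchange_big; apply: eq_bigr => j _.
by rewrite raddf_sum peval_sum mulr_sumr.
Qed.

Lemma dpevalM p q :
  dpeval (p * q) = dpeval p * peval f v q + peval f v p * dpeval q.
Proof.
rewrite /dpeval mulr_sumr mulr_suml -big_split; apply: eq_bigr => j _ /=.
by rewrite mderivM pevalD !pevalM; ring.
Qed.

Lemma dpevalX i : dpeval 'X_i = u 0 i.
Proof.
rewrite /dpeval (bigD1 i) //= big1 ?addr0 => [|j ji].
  have -> : 'X_i^`M(i) = 1 :> {mpoly K[n]}.
    rewrite mderivX mnm1E eqxx scale1r -[RHS]mpolyX0; congr 'X_[_].
    by apply/mnmP => j; rewrite mnmBE subnn mnm0E.
  by rewrite /peval rmorph1 mulr1.
by rewrite mderivX mnm1E eq_sym (negbTE ji) scale0r peval0 mulr0.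
Qed.

End Directional.

Lemma emb_lin_inord (F : fieldType) n (a b : F) (x x' : nat -> F) y y' i :
  (i <= n)%N ->
  (a *: emb n x y + b *: emb n x' y') 0 (inord i) = a * x i + b * x' i.
Proof. by move=> hi; rewrite mxE ![(_ *: _ : matrix _ _ _) _ _]mxE !emb_inord. Qed.

Lemma emb_lin_max (F : fieldType) n (a b : F) (x x' : nat -> F) y y' :
  (a *: emb n x y + b *: emb n x' y') 0 ord_max = a * y + b * y'.
Proof. by rewrite mxE ![(_ *: _ : matrix _ _ _) _ _]mxE !emb_max. Qed.

Section Smooth.
Variables (K : fieldType) (k : closedFieldType) (iota : {rmorphism K -> k}).
Variables (n' : nat) (h : {poly K}).
Local Notation n := n'.+1.
Hypothesis size_h : (size h <= n.*2.+1)%N.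

Lemma dpeval_model (v u : 'rV[k]_n.+2) :
  (forall p, p \in model_eqs n h -> dpeval iota v u p = 0) <->
  (v 0 ord_max * u 0 ord_max *+ 2 = \sum_(i < n.*2.+1) iota h`_i *
     (u 0 (inord i./2) * v 0 (inord (uphalf i))
      + v 0 (inord i./2) * u 0 (inord (uphalf i)))) /\
  (forall i j, (i < n)%N -> (j < n)%N ->
     u 0 (inord i) * v 0 (inord j.+1) + v 0 (inord i) * u 0 (inord j.+1) =
     u 0 (inord i.+1) * v 0 (inord j) + v 0 (inord i.+1) * u 0 (inord j)).
Proof.
have hq : dpeval iota v u ('X_ord_max ^+ 2 - quad_form n h) =
    v 0 ord_max * u 0 ord_max *+ 2 - \sum_(i < n.*2.+1) iota h`_i *
     (u 0 (inord i./2) * v 0 (inord (uphalf i))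
      + v 0 (inord i./2) * u 0 (inord (uphalf i))).
  rewrite dpevalB expr2 dpevalM !pevalX !dpevalX dpeval_sum; congr (_ - _).
    by ring.
  by apply: eq_bigr => i _; rewrite dpevalZ dpevalM !pevalX !dpevalX.
have hm i j : dpeval iota v u (minor_eq K n i j) =
  u 0 (inord i) * v 0 (inord j.+1) + v 0 (inord i) * u 0 (inord j.+1) -
  (u 0 (inord i.+1) * v 0 (inord j) + v 0 (inord i.+1) * u 0 (inord j)).
  by rewrite dpevalB !dpevalM !pevalX !dpevalX.
split=> [H|[H1 H2]].
  split.
    by apply/eqP; rewrite -subr_eq0 -hq H // mem_head.
  move=> i j hi hj; apply/eqP; rewrite -subr_eq0 -hm H // inE; apply/orP; right.
  by apply/imageP; exists (Ordinal hi, Ordinal hj).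
move=> p; rewrite inE => /orP [/eqP ->|/imageP [[i j] _ ->]].
  by rewrite hq H1 subrr.
by rewrite hm /= H2 ?ltn_ord // subrr.
Qed.

Lemma monomial_leibniz (F : comNzRingType) (t : F) i j :
  i%:R * t ^+ i.-1 * t ^+ j + t ^+ i * (j%:R * t ^+ j.-1)
  = (i + j)%:R * t ^+ (i + j).-1.
Proof.
case: i j => [|i] [|j]; rewrite ?add0n ?addn0 ?mul0r ?mulr0 ?expr0 ?mul1r ?mulr1 ?add0r ?addr0 //=.
by rewrite natrD addnS !exprS exprD; ring.
Qed.

Lemma tangent_aff c t y (u : 'rV[k]_n.+2) : c != 0 ->
  (forall p, p \in model_eqs n h -> dpeval iota (c *: aff n t y) u p = 0) <->
  exists a b, (forall j, (j <= n)%N ->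
                 u 0 (inord j) = a * t ^+ j + b * (j%:R * t ^+ j.-1)) /\
    y * u 0 ord_max *+ 2 =
      a * (map_poly iota h).[t] *+ 2 + b * (map_poly iota h)^`().[t].
Proof.
move=> c0; rewrite dpeval_model.
have vi i : (i <= n)%N -> (c *: aff n t y) 0 (inord i) = c * t ^+ i.
  by move=> hi; rewrite mxE emb_inord.
have vm : (c *: aff n t y) 0 ord_max = c * y by rewrite mxE emb_max.
have key a b : (forall j, (j <= n)%N ->
    u 0 (inord j) = a * t ^+ j + b * (j%:R * t ^+ j.-1)) ->
  \sum_(i < n.*2.+1) iota h`_i *
     (u 0 (inord i./2) * (c *: aff n t y) 0 (inord (uphalf i))
      + (c *: aff n t y) 0 (inord i./2) * u 0 (inord (uphalf i))) =
  c * (a * (map_poly iota h).[t] *+ 2 + b * (map_poly iota h)^`().[t]).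
  move=> hu; rewrite (@horner_coef_wide _ n.*2.+1) ?size_map_poly //.
  have -> : (map_poly iota h)^`().[t] =
      \sum_(i < n.*2.+1) iota h`_i * (i%:R * t ^+ i.-1).
    rewrite big_ord_recl mul0r mulr0 add0r (@horner_coef_wide _ n.*2).
      apply: eq_bigr => i _.
      by rewrite coef_deriv coef_map /= mulrA mulr_natr.
    rewrite (leq_trans (size_poly _ _)) // size_map_poly.
    by move: size_h; case: (size h).
  rewrite [a * _]mulr_sumr -mulr_natr mulr_suml mulr_sumr -big_split mulr_sumr /=.
  apply: eq_bigr => i _; have [h1 h2] := half_bounds (ltn_ord i).
  rewrite coef_map /= !vi // !hu //.
  have ei : (i = i./2 + uphalf i :> nat)%N by lia.
  have -> : t ^+ i = t ^+ i./2 * t ^+ uphalf i by rewrite -exprD -ei.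
  have -> : i%:R * t ^+ i.-1 = (i./2)%:R * t ^+ (i./2).-1 * t ^+ uphalf i
      + t ^+ i./2 * ((uphalf i)%:R * t ^+ (uphalf i).-1).
    by rewrite monomial_leibniz -ei.
  set A := t ^+ i./2; set B := t ^+ _; set A' := t ^+ _; set B' := t ^+ _.
  move: (iota _) (i./2)%:R (uphalf i)%:R => x1 x2 x3; ring.
split=> [[H1 H2]|[a [b [hu hy]]]].
  have hu j : (j <= n)%N -> u 0 (inord j) = u 0 (inord 0) * t ^+ j +
      (u 0 (inord 1) - t * u 0 (inord 0)) * (j%:R * t ^+ j.-1).
    elim: j => [|j IH] hj; first by rewrite expr0 !mul0r mulr0 addr0 mulr1.
    have := H2 0%N j isT hj; rewrite !vi // 1?ltnW // expr0 expr1 mulr1 => e.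
    apply: (mulfI c0).
    have -> : c * u 0 (inord j.+1) = u 0 (inord 1) * (c * t ^+ j) +
       c * t * u 0 (inord j) - u 0 (inord 0) * (c * t ^+ j.+1) by rewrite -e; ring.
    rewrite IH 1?ltnW // -natr1 /=; case: j {IH hj e} => [|j] /=.
      by rewrite expr0 expr1; ring.
    by rewrite !exprS; ring.
  exists (u 0 (inord 0)), (u 0 (inord 1) - t * u 0 (inord 0)); split=> //.
  by apply: (mulfI c0); rewrite -key // -H1 vm; ring.
split; first by rewrite (key _ _ hu) -hy vm; ring.
move=> i j hi hj; rewrite !vi // 1?ltnW // !hu // 1?ltnW //.
have e1 := monomial_leibniz t i j.+1; have e2 := monomial_leibniz t i.+1 j.
rewrite addSnnS -e1 {e1} in e2.
have e3 : t ^+ i.+1 * t ^+ j = t ^+ i * t ^+ j.+1 by rewrite !exprS; ring.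
move: e2 e3; move: (i.+1%:R * _) (j.+1%:R * _) (i%:R * _) (j%:R * _).
move: (t ^+ i.+1) (t ^+ j) (t ^+ i) (t ^+ j.+1) => P1 Q P Q1 Di1 Dj1 Di Dj e2 e3.
have -> : (a * P + b * Di) * (c * Q1) + c * P * (a * Q1 + b * Dj1) =
  a * c * (P * Q1) *+ 2 + b * c * (Di * Q1 + P * Dj1) by ring.
by rewrite -e2 -e3; ring.
Qed.

Lemma tangent_inf c y (u : 'rV[k]_n.+2) : c != 0 ->
  (forall p, p \in model_eqs n h -> dpeval iota (c *: infp n y) u p = 0) <->
  (forall i, (i < n')%N -> u 0 (inord i) = 0) /\
    y * u 0 ord_max *+ 2 =
      u 0 (inord n) * iota h`_(n.*2) *+ 2 + u 0 (inord n') * iota h`_(n.*2.-1).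
Proof.
move=> c0; rewrite dpeval_model.
have vi i : (i <= n)%N -> (c *: infp n y) 0 (inord i) = c * (i == n)%:R.
  by move=> hi; rewrite mxE emb_inord.
have vm : (c *: infp n y) 0 ord_max = c * y by rewrite mxE emb_max.
have -> : \sum_(i < n.*2.+1) iota h`_i *
     (u 0 (inord i./2) * (c *: infp n y) 0 (inord (uphalf i))
      + (c *: infp n y) 0 (inord i./2) * u 0 (inord (uphalf i))) =
  c * (u 0 (inord n) * iota h`_(n.*2) *+ 2 + u 0 (inord n') * iota h`_(n.*2.-1)).
  rewrite doubleS big_ord_recr big_ord_recr /= big1 ?add0r => [|i _].
    rewrite uphalf_double doubleK !vi // eqxx.
    have -> : (n' == n) = false by lia.
    by rewrite !(mulr0, mulr1, mul0r, addr0); ring.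
  have h1 : (i./2 < n)%N by have := ltn_ord i; lia.
  have h2 : (uphalf i < n)%N by have := ltn_ord i; lia.
  by rewrite !vi 1?ltnW // !ltn_eqF // !(mulr0, mul0r) addr0 mulr0.
rewrite vm -mulrA -mulrnAr; split=> [[H1 H2]|[H1 H2]].
  split; last exact: (mulfI c0).
  move=> i hi; have := H2 i n' (ltnW hi) (ltnSn _).
  rewrite !vi //; try lia; rewrite eqxx.
  have -> : (i == n) = false by lia.
  have -> : (n' == n) = false by lia.
  have -> : (i.+1 == n) = false by lia.
  rewrite !(mulr0, mulr1, mul0r, addr0) => /eqP.
  by rewrite mulf_eq0 (negbTE c0) orbF => /eqP.
split; first by rewrite H2.
move=> i j hi hj; rewrite !vi //; try lia.
have -> : (i == n) = false by lia.
have -> : (j == n) = false by lia.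
rewrite !(mulr0, mul0r, addr0, add0r) !eqSS.
have [->|ni] := eqVneq i n'; have [->|nj] := eqVneq j n'.
- by rewrite mulrC.
- have {}nj : (j < n')%N by rewrite ltn_neqAle nj.
  by rewrite (H1 j) //= !(mulr0, mul0r).
- have {}ni : (i < n')%N by rewrite ltn_neqAle ni.
  by rewrite (H1 i) //= !(mulr0, mul0r).
- by rewrite /= !(mulr0, mul0r).
Qed.

Lemma rank_of_kernel m N (J : 'M[k]_(m, N)) (u1 u2 : 'rV[k]_N) i j :
  u1 0 i = 1 -> u2 0 i = 0 -> u2 0 j = 1 ->
  (forall u : 'rV_N, u *m J^T = 0 <-> exists a b, u = a *: u1 + b *: u2) ->
  (\rank J).+2 = N.
Proof.
move=> h1 h2 h3 hu; pose B := col_mx u1 u2.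
have rB : \rank B = 2%N.
  apply/eqP; rewrite -[_ == _]/(row_free B); apply: inj_row_free => v.
  rewrite -[v]hsubmxK mul_row_col.
  have [-> ->] : lsubmx v = (lsubmx v 0 0)%:M /\ rsubmx v = (rsubmx v 0 0)%:M.
    by rewrite -!mx11_scalar.
  move: (lsubmx v 0 0) (rsubmx v 0 0) => a b; rewrite !mul_scalar_mx => e.
  have a0 : a = 0.
    by have /rowP /(_ i) := e; rewrite !mxE h1 h2 mulr1 mulr0 addr0.
  have b0 : b = 0.
    by have /rowP /(_ j) := e; rewrite !mxE a0 h3 mulr1 mul0r add0r.
  by rewrite a0 b0 !raddf0 row_mx0.
have e : (kermx J^T == B)%MS.
  apply/andP; split.
    apply/rV_subP => u /sub_kermxP /hu [a [b ->]]; apply/submxP.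
    by exists (row_mx a%:M b%:M); rewrite mul_row_col !mul_scalar_mx.
  apply/sub_kermxP; rewrite mul_col_mx.
  have -> : u1 *m J^T = 0 by apply/hu; exists 1, 0; rewrite scale1r scale0r addr0.
  have -> : u2 *m J^T = 0 by apply/hu; exists 0, 1; rewrite scale1r scale0r add0r.
  by rewrite col_mx0.
have := eqmx_rank e; rewrite rB mxrank_ker mxrank_tr.
by have := rank_leq_col J; lia.
Qed.

Hypothesis h_sep : separable_poly h.
Hypothesis h_size : size h = n.*2.+1.
Hypothesis two0 : 2%:R != 0 :> k.

Lemma jacobian_kernel v (u : 'rV[k]_n.+2) : u *m (jacobian iota (model n h) v)^T = 0
  <-> (forall p, p \in model_eqs n h -> dpeval iota v u p = 0).
Proof.
split=> [/rowP H p hp|H].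
  have hi : (index p (model_eqs n h) < size (model_eqs n h))%N by rewrite index_mem.
  have := H (Ordinal hi); rewrite !mxE => e; rewrite -[RHS]e.
  by apply: eq_bigr => j _; rewrite !mxE /= nth_index.
apply/rowP => i; rewrite !mxE -[RHS](H (model_eqs n h)`_i) ?mem_nth ?ltn_ord //.
by apply: eq_bigr => j _; rewrite !mxE.
Qed.

Lemma model_smooth v : is_point iota (model n h) v ->
  (\rank (jacobian iota (model n h) v)).+1 = n.+1.
Proof.
move=> /(is_pointE iota (ltn0Sn _) size_h) [c c0 [[t [y [hy ->]]]|[y [hy ->]]]];
  apply/eqP; rewrite -eqSS; apply/eqP.
- have [y0|y0] := eqVneq y 0.
    have d0 : (map_poly iota h)^`().[t] != 0.
      have : separable_poly (map_poly iota h) by rewrite separable_map.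
      rewrite unlock => hs; have := coprimep_root hs; apply.
      by rewrite /root -hy y0 expr0n.
    apply: (@rank_of_kernel _ _ _ (aff n t 0) (emb n (fun=> 0) 1) (inord 0) ord_max).
    + by rewrite emb_inord.
    + by rewrite emb_inord.
    + by rewrite emb_max.
    move=> u; rewrite jacobian_kernel tangent_aff // -hy y0.
    split=> [[a [b [hu e]]]|[a [b ->]]].
      have b0 : b = 0.
        move: e; rewrite expr0n /= mul0r mulr0 !mul0rn add0r => /esym/eqP.
        by rewrite mulf_eq0 (negbTE d0) orbF => /eqP.
      exists a, (u 0 ord_max); apply: row_split => [|i hi].
        by rewrite emb_lin_max mulr0 add0r mulr1.
      by rewrite emb_lin_inord // hu // b0 mul0r mulr0.
    exists a, 0; split; last by rewrite expr0n /= !(mul0r, mulr0, mul0rn) ?addr0.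
    by move=> j hj; rewrite emb_lin_inord // mulr0 mul0r.
  set d := (map_poly iota h)^`().[t].
  have y2 : y *+ 2 != 0 by rewrite -mulr_natr mulf_neq0.
  apply: (@rank_of_kernel _ _ _ (aff n t y)
     (emb n (fun j => j%:R * t ^+ j.-1) (d / (y *+ 2))) (inord 0) (inord 1)).
  + by rewrite emb_inord.
  + by rewrite emb_inord // mul0r.
  + by rewrite emb_inord // expr0 mulr1.
  move=> u; rewrite jacobian_kernel tangent_aff // -/d -hy.
  split=> [[a [b [hu e]]]|[a [b ->]]].
    exists a, b; apply: row_split => [|i hi].
      rewrite emb_lin_max; apply: (mulfI y2); rewrite mulrnAl e.
      by field; rewrite two0; apply: contraNneq y2 => ->; rewrite mul0rn.
    by rewrite emb_lin_inord // hu.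
  exists a, b; split.
    by move=> j hj; rewrite emb_lin_inord.
  rewrite emb_lin_max -mulrnAl mulrDr.
  have -> : y *+ 2 * (b * (d / (y *+ 2))) = b * d by rewrite mulrCA [_ * (d / _)]mulrC divfK.
  by congr (_ + _); ring.
have hl : h`_(n.*2) != 0.
  have : lead_coef h != 0 by rewrite lead_coef_eq0 -size_poly_eq0 h_size.
  by rewrite lead_coefE h_size.
have y0 : y != 0.
  by rewrite -sqrf_eq0 hy fmorph_eq0.
have y2 : y *+ 2 != 0 by rewrite -mulr_natr mulf_neq0.
set d := iota h`_(n.*2.-1).
apply: (@rank_of_kernel _ _ _ (infp n y)
   (emb n (fun j => (j == n')%:R) (d / (y *+ 2))) (inord n) (inord n')).
- by rewrite emb_inord // eqxx.
- by rewrite emb_inord // gtn_eqF.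
- by rewrite emb_inord // eqxx.
move=> u; rewrite jacobian_kernel tangent_inf // -/d -hy.
split=> [[hu e]|[a [b ->]]].
  exists (u 0 (inord n)), (u 0 (inord n')); apply: row_split => [|i hi].
    rewrite emb_lin_max; apply: (mulfI y2); rewrite mulrnAl e.
    by field; rewrite two0.
  rewrite emb_lin_inord //.
  have [->|ni] := eqVneq i n.
    by rewrite gtn_eqF // mulr1 mulr0 addr0.
  have [->|ni'] := eqVneq i n'; first by rewrite mulr0 mulr1 add0r.
  have {}ni : (i < n)%N by rewrite ltn_neqAle ni.
  by rewrite hu ?mulr0 ?addr0 // ltn_neqAle ni'.
split=> [i hi|].
  rewrite emb_lin_inord; last lia.
  have -> : (i == n) = false by lia.
  have -> : (i == n') = false by lia.
  by rewrite !mulr0 addr0.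
rewrite emb_lin_max !emb_lin_inord // ?leqnSn // !eqxx.
rewrite gtn_eqF // ltn_eqF // -mulrnAl mulrDr.
have -> : y *+ 2 * (b * (d / (y *+ 2))) = b * d by rewrite mulrCA [_ * (d / _)]mulrC divfK.
by rewrite !(mulr0, mulr1, addr0, add0r); congr (_ + _); ring.
Qed.

End Smooth.

Section Geometry.
Variables (K : fieldType) (k : closedFieldType) (iota : {rmorphism K -> k}).
Variables (n : nat) (h : {poly K}).
Hypothesis n_gt0 : (0 < n)%N.
Hypothesis h_size : size h = n.*2.+1.
Hypothesis h_sep : separable_poly h.
Hypothesis two0 : 2%:R != 0 :> k.

Let size_h : (size h <= n.*2.+1)%N. Proof. by rewrite h_size. Qed.
Let hk := map_poly iota h.
Let hk0 : hk != 0.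
Proof. by rewrite map_poly_eq0 -size_poly_eq0 h_size. Qed.
Let hk_sep : separable_poly hk. Proof. by rewrite separable_map. Qed.
Let hk_size : size hk = n.*2.+1. Proof. by rewrite size_map_poly. Qed.

Lemma vanishes_normal_form m p A B : p \is m.-homog -> normal_form h m p A B ->
  vanishes_on iota (model n h) p <-> A = 0 /\ B = 0.
Proof.
move=> hp [_ _ hAB]; have [h1 h2] := hAB k iota; split=> [hv|[A0 B0]].
  suff [] : map_poly iota A = 0 /\ map_poly iota B = 0.
    by move=> /eqP; rewrite map_poly_eq0 => /eqP -> /eqP; rewrite map_poly_eq0 => /eqP ->.
  apply: (closed_curve0 two0 hk0) => t y hy; rewrite -h1 //; apply: hv.
  by rewrite -[aff _ _ _]scale1r; apply: affP => //; exact: oner_neq0.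
move=> v /(is_pointE iota n_gt0 size_h) [c c0 [[t [y [hy ->]]]|[y [hy ->]]]].
  by rewrite (peval_homog _ _ _ hp) h1 // A0 B0 !rmorph0 horner0 mul0r addr0 mulr0.
by rewrite (peval_homog _ _ _ hp) h2 // A0 B0 !coef0 !rmorph0 mul0r addr0 mulr0.
Qed.

Lemma model_infinite : geom_infinite iota (model n h).
Proof.
move=> s; pose P := \prod_(w <- s | w 0 (inord 0) != 0)
  ((w 0 (inord 1))%:P - w 0 (inord 0) *: 'X).
have P0 : P != 0.
  rewrite /P; elim/big_rec: _ => [|w q hw q0]; first exact: oner_neq0.
  rewrite mulf_neq0 //; apply/eqP => /(congr1 (fun p : {poly k} => p`_1)).
  by rewrite coefB coefC coefZ coefX /= mulr1 sub0r coef0 => /eqP; rewrite oppr_eq0 (negbTE hw).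
have [t ht] := closed_neq0 P0; have [y hy] := closed_sqrt hk.[t].
exists (aff n t y); split.
  by rewrite -[aff _ _ _]scale1r; apply: affP => //; exact: oner_neq0.
move=> w ws [c c0 e].
have e0 : 1 = c * w 0 (inord 0).
  by have := congr1 (fun u : 'rV_n.+2 => u 0 (inord 0)) e; rewrite emb_inord // mxE.
have e1 : t = c * w 0 (inord 1).
  by have := congr1 (fun u : 'rV_n.+2 => u 0 (inord 1)) e; rewrite emb_inord // mxE.
have w0 : w 0 (inord 0) != 0.
  by apply: contra_eqN e0 => /eqP ->; rewrite mulr0 oner_neq0.
move: ht; rewrite /P (big_rem _ ws) /= w0 hornerM mulf_eq0 negb_or => /andP [+ _].
rewrite hornerD hornerN hornerC hornerZ hornerX e1.
have -> : w 0 (inord 0) * (c * w 0 (inord 1)) = c * w 0 (inord 0) * w 0 (inord 1) by ring.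
by rewrite -e0 mul1r subrr eqxx.
Qed.

Lemma zero_or_witness (S : seq {mpoly k[n.+2]}) :
  (forall p, p \in S -> homogeneous p) ->
  (forall v, is_point iota (model n h) v -> zero_of S v) \/
  exists p A B, [/\ p \in S, A ^+ 2 - B ^+ 2 * hk != 0 &
    forall t y, y ^+ 2 = hk.[t] -> p.@[aff n t y 0] = A.[t] + B.[t] * y].
Proof.
have sk : (size hk <= n.*2.+1)%N by rewrite hk_size.
elim: S => [_|p S IH hS]; first by left.
have [|hv|[q [A [B [qS N0 hq]]]]] := IH.
- by move=> q qS; apply: hS; rewrite inE qS orbT.
- have [|m hp] := hS p; first exact: mem_head.
  have [A [B [sA sB hAB]]] := normal_form_exists n_gt0 sk hp.
  have [e|N0] := eqVneq (A ^+ 2 - B ^+ 2 * hk) 0.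
    have [] := @squarefree_norm _ hk A B hk_sep.
    - by rewrite hk_size ltnS double_gt0.
    - by apply/eqP; rewrite -subr_eq0 e.
    move=> A0 B0; left=> v hpv q; rewrite inE => /orP [/eqP ->|]; last exact: hv.
    have [h1 h2] := hAB k idfun.
    move: hpv => /(is_pointE iota n_gt0 size_h) [c c0 [[t [y [hy ->]]]|[y [hy ->]]]].
      rewrite -[_.@[_]]/(peval idfun _ _) (peval_homog _ _ _ hp) h1 !map_poly_id //.
      by rewrite A0 B0 !horner0 mul0r addr0 mulr0.
    rewrite -[_.@[_]]/(peval idfun _ _) (peval_homog _ _ _ hp) h2 ?coef_map //.
    by rewrite A0 B0 !coef0 /= mul0r addr0 mulr0.
  right; exists p, A, B; split=> //; first exact: mem_head.
  move=> t y hy; have [h1 _] := hAB k idfun.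
  by rewrite -[_.@[_]]/(peval idfun _ _) h1 !map_poly_id.
- by right; exists q, A, B; split=> //; rewrite inE qS orbT.
Qed.

Lemma model_connected : geom_connected iota (model n h).
Proof.
move=> S T hST cover [v [pv Sv]] [w [pw Tw]].
have [|hS|[p [A [B [pS N0 hp]]]]] := @zero_or_witness S.
- by move=> p pS; apply: hST; rewrite mem_cat pS.
- by exists w; split=> //; exact: hS.
have [|hT|[q [A' [B' [qT N0' hq]]]]] := @zero_or_witness T.
- by move=> q qT; apply: hST; rewrite mem_cat qT orbT.
- by exists v; split=> //; exact: hT.
have [t ht] := closed_neq0 (mulf_neq0 N0 N0').
have [y hy] := closed_sqrt hk.[t].
move: ht; rewrite hornerM mulf_eq0 negb_or => /andP [n1 n2].
have pt : is_point iota (model n h) (aff n t y).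
  by rewrite -[aff _ _ _]scale1r; apply: affP => //; exact: oner_neq0.
case: (cover _ pt) => [/(_ _ pS)|/(_ _ qT)].
  rewrite hp // => /eqP; rewrite addr_eq0 => /eqP e; move: n1.
  by rewrite hornerD hornerN !(horner_exp, hornerM) -hy e sqrrN exprMn subrr eqxx.
rewrite hq // => /eqP; rewrite addr_eq0 => /eqP e; move: n2.
by rewrite hornerD hornerN !(horner_exp, hornerM) -hy e sqrrN exprMn subrr eqxx.
Qed.

Lemma model_curve : smooth_geom_connected_curve iota (model n h).
Proof.
split; [exact: model_infinite| |exact: model_connected] => v.
by case: n n_gt0 h_size v => // n' _ hsz v hv; apply: model_smooth => //; rewrite hsz.
Qed.

Definition monomial_of (m i : nat) : {mpoly K[n.+2]} :=
  \prod_(j < m) 'X_(inord (minn n (i - j * n))).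

Lemma monomial_homog m i : monomial_of m i \is m.-homog.
Proof.
rewrite /monomial_of; elim: m => [|m IH]; first by rewrite big_ord0 dhomog1.
rewrite big_ord_recr /=.
by have := dhomogM IH (homogX K (inord (minn n (i - m * n)))); rewrite (addn1 m).
Qed.

Lemma sum_minn m i : (i <= m * n)%N -> (\sum_(j < m) minn n (i - j * n) = i)%N.
Proof.
have -> : (\sum_(j < m) minn n (i - j * n) = minn i (m * n))%N.
  elim: m => [|m IH]; first by rewrite big_ord0 mul0n minn0.
  by rewrite big_ord_recr /= IH mulSn; lia.
by move/minn_idPl.
Qed.

Lemma monomial_aff (F : fieldType) (f : {rmorphism K -> F}) m i t y :
  (i <= m * n)%N -> peval f (aff n t y) (monomial_of m i) = t ^+ i.
Proof.
move=> hi; rewrite /monomial_of peval_prod.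
under eq_bigr => j _ do rewrite pevalX emb_inord ?geq_minl //.
by rewrite prodrXr sum_minn.
Qed.

Definition hilbert_basis m (i : 'I_((m.+1 * n).+1 + (m * n).+1)) :
    {mpoly K[n.+2]} :=
  match split i with
  | inl j => monomial_of m.+1 j
  | inr j => 'X_ord_max * monomial_of m j
  end.

Lemma hilbert_basis_homog m i : @hilbert_basis m i \is m.+1.-homog.
Proof.
rewrite /hilbert_basis; case: (split i) => j; first exact: monomial_homog.
by have := dhomogM (homogX K ord_max) (monomial_homog m j); rewrite (add1n m).
Qed.

Lemma hilbert_basis_aff (F : fieldType) (f : {rmorphism K -> F}) m t y
    (c : 'rV[K]_((m.+1 * n).+1 + (m * n).+1)) :
  peval f (aff n t y) (\sum_i c 0 i *: hilbert_basis i) =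
  (map_poly f (rVpoly (lsubmx c))).[t] + (map_poly f (rVpoly (rsubmx c))).[t] * y.
Proof.
rewrite peval_sum big_split_ord /=; congr (_ + _).
  rewrite (@horner_coef_wide _ (m.+1 * n).+1); last first.
    by rewrite (leq_trans (size_poly _ _)) // size_poly.
  apply: eq_bigr => i _; rewrite coef_map /= coef_rVpoly_ord mxE pevalZ.
  by rewrite /hilbert_basis (unsplitK (inl i)) monomial_aff // -ltnS.
rewrite (@horner_coef_wide _ (m * n).+1) ?mulr_suml; last first.
  by rewrite (leq_trans (size_poly _ _)) // size_poly.
apply: eq_bigr => i _; rewrite coef_map /= coef_rVpoly_ord mxE pevalZ.
rewrite /hilbert_basis (unsplitK (inr i)) pevalM pevalX emb_max monomial_aff.
  by rewrite mulrA mulrAC.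
by rewrite -ltnS.
Qed.

Lemma model_hilbert m :
  hilbert_function iota (model n h) m.+1 ((m.+1 * n).+1 + (m * n).+1).
Proof.
exists (@hilbert_basis m); split; first exact: hilbert_basis_homog.
move=> p hp.
have vanE (q : {mpoly K[n.+2]}) : q \is m.+1.-homog ->
    vanishes_on iota (model n h) q <->
    (forall t y, y ^+ 2 = hk.[t] -> peval iota (aff n t y) q = 0).
  move=> hq; split=> [hv t y hy|H].
    apply: hv; rewrite -[aff _ _ _]scale1r; apply: affP => //; exact: oner_neq0.
  have [A [B nf]] := normal_form_exists n_gt0 size_h hq.
  apply/(vanishes_normal_form hq nf).
  have [_ _ /(_ k iota) [h1 _]] := nf.
  suff [] : map_poly iota A = 0 /\ map_poly iota B = 0.
    by move=> /eqP; rewrite map_poly_eq0 => /eqP -> /eqP; rewrite map_poly_eq0 => /eqP ->.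
  by apply: (closed_curve0 two0 hk0) => t y hy; rewrite -h1 // H.
have hom (c : 'rV[K]_((m.+1 * n).+1 + (m * n).+1)) : p - \sum_i c 0 i *: @hilbert_basis m i \is m.+1.-homog.
  apply: rpredB => //; apply: rpred_sum => i _; apply: rpredZ.
  exact: hilbert_basis_homog.
have [A [B [sA sB hAB]]] := normal_form_exists n_gt0 size_h hp.
have [h1 _] := hAB k iota.
have sB' : (size B <= (m * n).+1)%N by move: sB; rewrite mulSn; lia.
exists (row_mx (poly_rV A) (poly_rV B)); split.
  apply/(vanE _ (hom _)) => t y hy; rewrite pevalB h1 // hilbert_basis_aff.
  by rewrite row_mxKl row_mxKr !poly_rV_K // subrr.
move=> c /(vanE _ (hom c)) H; rewrite -[c]hsubmxK.
suff [eA eB] : A = rVpoly (lsubmx c) /\ B = rVpoly (rsubmx c).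
  by rewrite {1}eA {1}eB !rVpolyK.
have [] := @closed_curve0 k hk (map_poly iota (A - rVpoly (lsubmx c)))
  (map_poly iota (B - rVpoly (rsubmx c))) two0 hk0.
  move=> t y hy; have := H t y hy; rewrite pevalB h1 // hilbert_basis_aff => <-.
  by rewrite !rmorphB /= !hornerD !hornerN; ring.
move=> /eqP; rewrite map_poly_eq0 subr_eq0 => /eqP eA.
by move=> /eqP; rewrite map_poly_eq0 subr_eq0 => /eqP eB.
Qed.

Lemma model_genus : genus iota (model n h) n.-1.
Proof.
exists n.*2, 1%N => [[|m]] // _; eexists; first exact: model_hilbert.
by rewrite -muln2; nia.
Qed.

End Geometry.

Lemma rmorph_mmap (n : nat) (R : nzRingType) (S T : comNzRingType)
    (f : {rmorphism R -> S}) (g : {rmorphism S -> T}) (x : 'I_n -> S)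
    (p : {mpoly R[n]}) :
  g (mmap f x p) = mmap (g \o f) (g \o x) p.
Proof.
rewrite /mmap rmorph_sum; apply: eq_bigr => m _; rewrite rmorphM; congr (_ * _).
by rewrite /mmap1 rmorph_prod; apply: eq_bigr => i _; rewrite rmorphXn.
Qed.

Lemma eq_mmap (n : nat) (R S : nzRingType) (f f' : R -> S) (x x' : 'I_n -> S)
  (p : {mpoly R[n]}) : f =1 f' -> x =1 x' -> mmap f x p = mmap f' x' p.
Proof.
move=> ef ex; rewrite /mmap; apply: eq_bigr => m _; rewrite ef; congr (_ * _).
exact: mmap1_eq.
Qed.

Section Residue.
Variables (K F : fieldType) (f : {rmorphism K -> F}).

Lemma residue_ratio n (v : 'rV[F]_n.+1) (i0 i1 : 'I_n.+1) (A C : {poly K}) :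
  v 0 i0 = 1 -> (map_poly f C).[v 0 i1] != 0 ->
  residue f v ((map_poly f A).[v 0 i1] / (map_poly f C).[v 0 i1]).
Proof.
move=> v0 hC; pose d := (size A + size C)%N.
pose hmg (B : {poly K}) : {mpoly K[n.+1]} :=
  \sum_(i < d.+1) B`_i *: ('X_i0 ^+ (d - i) * 'X_i1 ^+ i).
have hX (i : 'I_n.+1) e : ('X_i ^+ e : {mpoly K[n.+1]}) \is e.-homog.
  have h1 : ('X_i : {mpoly K[n.+1]}) \is 1.-homog.
    by rewrite dhomogX; apply/eqP; exact: mdeg1.
  by have := dhomogMn e h1; rewrite mul1n.
have hom B : hmg B \is d.-homog.
  apply: rpred_sum => i _; apply: rpredZ.
  have := dhomogM (hX i0 (d - i)%N) (hX i1 i).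
  by rewrite (subnK (n := d)) // -ltnS.
have ev (B : {poly K}) : (size B <= d.+1)%N -> peval f v (hmg B) = (map_poly f B).[v 0 i1].
  move=> sB; rewrite peval_sum (@horner_coef_wide _ d.+1) ?size_map_poly //.
  apply: eq_bigr => i _.
  by rewrite pevalZ pevalM !pevalXn !pevalX v0 expr1n mul1r coef_map.
exists d, (hmg A), (hmg C); split; rewrite ?ev //.
- by rewrite leqW // leq_addl.
- by rewrite leqW // leq_addl.
- by rewrite leqW // leq_addr.
Qed.

Lemma residue_line (x a : F) :
  residue f (\row_(j < 2) x ^+ j) a <->
  exists A C, (map_poly f C).[x] != 0 /\ a = (map_poly f A).[x] / (map_poly f C).[x].
Proof.
split=> [[d [p [q [hp hq q0 ->]]]]|[A [C [hC ->]]]]; last first.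
  have := @residue_ratio 1 (\row_(j < 2) x ^+ j) ord0 ord_max A C.
  by rewrite !mxE expr0 expr1; apply.
have ev (r : {mpoly K[2]}) : peval f (\row_(j < 2) x ^+ j) r =
    (map_poly f (mmap (@polyC K) (fun j : 'I_2 => 'X^j) r)).[x].
  pose g : {rmorphism {poly K} -> F} := horner_eval x \o map_poly f.
  rewrite -[RHS]/(g _) rmorph_mmap; apply: eq_mmap => [c|j] /=.
    by rewrite map_polyC /= /horner_eval hornerC.
  by rewrite map_polyXn /horner_eval hornerXn mxE.
by exists (mmap (@polyC K) (fun j : 'I_2 => 'X^j) p),
          (mmap (@polyC K) (fun j : 'I_2 => 'X^j) q); rewrite -!ev.
Qed.

End Residue.

Section DoubleCover.
Variables (K : fieldType) (n : nat) (h : {poly K}).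
Hypothesis n_gt0 : (0 < n)%N.
Hypothesis h_size : size h = n.*2.+1.
Hypothesis h_sep : separable_poly h.

Let size_h : (size h <= n.*2.+1)%N. Proof. by rewrite h_size. Qed.

Definition cover : rep (model n h) (proj_space K 1) :=
  [seq (\row_(j < 2) 'X_(inord (i + j)) : 'rV[{mpoly K[n.+2]}]_2) | i <- iota 0 n].

Lemma cover_maps (F : fieldType) (f : {rmorphism K -> F}) (v : 'rV[F]_n.+2) i :
  (i < n)%N ->
  (\row_(j < 2) v 0 (inord (i + j))) != 0 ->
  maps_to f cover v (\row_(j < 2) v 0 (inord (i + j))).
Proof.
move=> hi w0; split=> //; exists (\row_(j < 2) 'X_(inord (i + j))).
  by apply/mapP; exists i; rewrite ?mem_iota.
by apply/rowP => j; rewrite !mxE pevalX.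
Qed.

Lemma cover_aff (F : fieldType) (f : {rmorphism K -> F}) (x y : F) :
  maps_to f cover (aff n x y) (\row_(j < 2) x ^+ j).
Proof.
have e : \row_(j < 2) x ^+ j = \row_(j < 2) aff n x y 0 (inord (0 + j)).
  apply/rowP => j; rewrite !mxE add0n inordK; first by rewrite ifT //; have := ltn_ord j; lia.
  by have := ltn_ord j; lia.
rewrite e; apply: cover_maps => //; rewrite -e.
by apply/eqP => /rowP /(_ ord0); rewrite !mxE expr0 => /eqP; rewrite oner_eq0.
Qed.

Section Geometric.
Variables (k : closedFieldType) (iota : {rmorphism K -> k}).
Hypothesis two0 : 2%:R != 0 :> k.

Lemma cover_morphism : is_morphism iota cover.
Proof.
split.
- move=> s /mapP [i _ ->]; exists 1%N => j; rewrite mxE; exact: homogX.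
- move=> v /(is_pointE iota n_gt0 size_h) [c c0 [[t [y [hy ->]]]|[y [hy ->]]]].
    eexists; apply: (cover_maps _ n_gt0).
    apply/eqP => /rowP /(_ ord0); rewrite mxE add0n mxE emb_inord // !mxE expr0 mulr1.
    by move/eqP; rewrite (negbTE c0).
  have hn : (n.-1 < n)%N by rewrite prednK.
  eexists; apply: (cover_maps _ hn).
  apply/eqP => /rowP /(_ ord_max); rewrite mxE /= addn1 prednK // mxE emb_inord //.
  by rewrite eqxx !mxE mulr1 => /eqP; rewrite (negbTE c0).
- move=> s t /mapP [i + ->] /mapP [i' + ->]; rewrite !mem_iota !add0n /= => hi hi' j j'.
  have hj : (j < 2)%N := ltn_ord j; have hj' : (j' < 2)%N := ltn_ord j'.
  rewrite !mxE => v /(is_pointE iota n_gt0 size_h) [c c0 [[x [y [hy ->]]]|[y [hy ->]]]].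
    rewrite pevalB !pevalM !pevalX ![(_ *: _ : matrix _ _ _) _ _]mxE !emb_inord //; try lia.
    apply/eqP; rewrite subr_eq0; apply/eqP.
    have E a b : c * x ^+ a * (c * x ^+ b) = c ^+ 2 * x ^+ (a + b) by rewrite exprD; ring.
    by rewrite !E; congr (_ * x ^+ _); lia.
  rewrite pevalB !pevalM !pevalX ![(_ *: _ : matrix _ _ _) _ _]mxE !emb_inord //; try lia.
  apply/eqP; rewrite subr_eq0; apply/eqP.
  have E (a b : bool) : c * a%:R * (c * b%:R) = c ^+ 2 * (a && b)%:R.
    by case: a b => [] [] /=; ring.
  rewrite !E; congr (_ * _%:R); congr nat_of_bool; lia.
- by move=> v w _ [w0 _]; split.
Qed.

Lemma cover_degree : morphism_degree iota cover 2.
Proof.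
have hs : (1 < size h)%N by rewrite h_size ltnS double_gt0.
have [F [f [x [y FF]]]] := function_field_exists h_sep hs.
have [hy hlin hspan] := FF.
exists F, f, (aff n x y), (\row_(j < 2) x ^+ j); split.
- split; first by rewrite -[aff _ _ _]scale1r; apply: affP => //; exact: oner_neq0.
  move=> p [m hp] e; have [A [B nf]] := normal_form_exists n_gt0 size_h hp.
  apply/(vanishes_normal_form iota n_gt0 h_size two0 hp nf).
  by have [_ _ /(_ F f) [h1 _]] := nf; apply: hlin; rewrite -h1.
- exact: cover_aff.
have res1 : residue f (aff n x y) 1.
  have := @residue_ratio K F f n.+1 (aff n x y) (inord 0) (inord 0) 1 1.
  rewrite emb_inord // rmorph1 !hornerC divr1; apply=> //; exact: oner_neq0.
have resy : residue f (aff n x y) y.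
  have h0 : aff n x y 0 (inord 0) = 1 :> F by rewrite emb_inord.
  exists 1%N, 'X_ord_max, 'X_(inord 0); split; try exact: homogX.
    by rewrite pevalX h0 oner_neq0.
  by rewrite !pevalX h0 divr1 emb_max.
exists (\row_(i < 2) if i == 0 then 1 else y); split.
  by move=> i; rewrite mxE; case: ifP.
move=> a _; have [A [B [C [C0 ea]]]] := hspan a.
pose c0 := (map_poly f A).[x] / (map_poly f C).[x].
pose c1 := (map_poly f B).[x] / (map_poly f C).[x].
exists (\row_(i < 2) if i == 0 then c0 else c1); split.
  split.
    by move=> i; rewrite mxE; apply/residue_line; case: ifP => _; [exists A, C|exists B, C].
  by rewrite big_ord_recl big_ord1 !mxE /= mulr1 ea mulrDl mulrAC.
move=> c [hc eac].
have [A0 [C0' [n0 e0]]] := (residue_line f x _).1 (hc 0).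
have [A1 [C1' [n1 e1]]] := (residue_line f x _).1 (hc 1).
move: eac; rewrite big_ord_recl big_ord1 !mxE /= mulr1 => eac.
have e01 : lift ord0 ord0 = 1 :> 'I_2 by apply/val_inj.
rewrite e01 in eac.
have e2 : c0 + c1 * y = c 0 0 + c 0 1 * y by rewrite -eac ea mulrDl mulrAC.
have key : (map_poly f (A * C0' * C1' - A0 * C * C1')).[x] +
           (map_poly f (B * C0' * C1' - A1 * C * C0')).[x] * y = 0.
  rewrite !rmorphB !rmorphM /= !hornerD !hornerN !hornerM.
  move: e2; rewrite e0 e1 /c0 /c1.
  move: n0 n1 C0; move: (map_poly f C0').[x] (map_poly f C1').[x] (map_poly f C).[x].
  move: (map_poly f A).[x] (map_poly f B).[x] (map_poly f A0).[x] (map_poly f A1).[x].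
  move=> a' b' a0 a1 d0 d1 d n0 n1 n2 e2.
  have -> : a' * d0 * d1 - a0 * d * d1 + (b' * d0 * d1 - a1 * d * d0) * y =
    d * d0 * d1 * (a' / d + b' / d * y - (a0 / d0 + a1 / d1 * y)).
    by field; rewrite n2 n0 n1.
  by rewrite e2 subrr mulr0.
have [k1 k2] := hlin _ _ key.
apply/rowP => i; rewrite mxE.
have [->|i1] := eqVneq i 0.
  rewrite e0 /c0; apply/eqP; rewrite eqr_div // -!hornerM -!rmorphM /=; apply/eqP.
  congr (map_poly f _).[x]; apply/eqP; rewrite -subr_eq0.
  have C1n : C1' != 0 by apply: contraNneq n1 => ->; rewrite rmorph0 horner0.
  by rewrite -(mulIr_eq0 _ (mulIf C1n)) -k1 mulrBl.
have -> : i = 1 by apply/val_inj; have := ltn_ord i; move: i1; rewrite -val_eqE /=; lia.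
rewrite e1 /c1; apply/eqP; rewrite eqr_div // -!hornerM -!rmorphM /=; apply/eqP.
congr (map_poly f _).[x]; apply/eqP; rewrite -subr_eq0.
have C0n : C0' != 0 by apply: contraNneq n0 => ->; rewrite rmorph0 horner0.
rewrite -(mulIr_eq0 _ (mulIf C0n)) -k2; apply/eqP; ring.
Qed.

Lemma cover_double : double_cover iota cover.
Proof. by split; [exact: cover_morphism|exact: cover_degree]. Qed.

Lemma model_hyperelliptic : (1 < n)%N -> hyperelliptic iota (model n h) n.-1.
Proof.
move=> n1; split; [exact: model_curve|exact: model_genus|by case: n n1 => [|[]]|].
by exists cover; exact: cover_double.
Qed.

Lemma model_rational_point (x y : K) : y ^+ 2 = h.[x] -> has_rational_point (model n h).
Proof.
move=> hy; exists (aff n x y); rewrite -[aff _ _ _]scale1r.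
by apply: affP; rewrite ?oner_neq0 ?map_poly_id.
Qed.

Section NewPoint.
Variables (L : fieldExtType K) (x y : L).
Hypothesis x_gen : forall M : {subfield L}, x \in M -> M = fullv :> {vspace L}.
Hypothesis xy : y ^+ 2 = (map_poly (in_alg L) h).[x].

Lemma model_new_point : new_point L (model n h) (aff n x y).
Proof.
split; first by rewrite -[aff _ _ _]scale1r; apply: affP => //; exact: oner_neq0.
move=> M /eqP hM [w [[c c0 ew] hw]]; apply: hM; apply: x_gen.
have e0 : w 0 (inord 0) = c by rewrite ew mxE emb_inord // mulr1.
have e1 : w 0 (inord 1) = c * x by rewrite ew mxE emb_inord // expr1.
have -> : x = w 0 (inord 1) / w 0 (inord 0) by rewrite e0 e1 mulrC mulKf.
by apply: rpred_div; exact: hw.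
Qed.

Lemma generator_horner a : exists A : {poly K}, a = (map_poly (in_alg L) A).[x].
Proof.
have : a \in <<1; x>>%VS.
  by rewrite (x_gen (M := <<1; x>>%AS)) ?memvf // memv_adjoin.
by case/Fadjoin_polyP => p /polyOver1P [A ->] ->; exists A.
Qed.

Lemma model_new_special_point : has_new_special_point iota L (model n h).
Proof.
exists cover, (aff n x y); split; [exact: cover_double|exact: model_new_point|].
exists (\row_(j < 2) x ^+ j); first exact: cover_aff.
move=> a; have [A ->] := generator_horner a; split=> _.
  have := @residue_ratio K L (in_alg L) n.+1 (aff n x y) (inord 0) (inord 1) A 1.
  rewrite !emb_inord // expr1 rmorph1 !hornerC divr1; apply=> //; exact: oner_neq0.
by apply/residue_line; exists A, 1; rewrite rmorph1 hornerC divr1 oner_neq0.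
Qed.

End NewPoint.
End Geometric.
End DoubleCover.

(** * Isomorphisms *)

Section Span.
Variables (k F : fieldType) (f : {rmorphism k -> F}) (h : {poly k}) (x y : F).
Hypothesis hy : y ^+ 2 = (map_poly f h).[x].
Hypothesis hlin : forall A B, (map_poly f A).[x] + (map_poly f B).[x] * y = 0 ->
  A = 0 /\ B = 0.

Local Notation "A @x" := ((map_poly f A).[x]) (at level 9).

Definition in_span (z : F) := exists A B C, C@x != 0 /\ z = (A@x + B@x * y) / C@x.

Lemma lin_inj A : A@x = 0 -> A = 0.
Proof. by move=> hA; have [] // := hlin (A := A) (B := 0); rewrite rmorph0 horner0 mul0r addr0. Qed.

Lemma in_span_poly A B : in_span (A@x + B@x * y).
Proof. by exists A, B, 1; rewrite rmorph1 hornerC oner_neq0 divr1. Qed.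

Lemma in_spanD z w : in_span z -> in_span w -> in_span (z + w).
Proof.
move=> [A [B [C [C0 ->]]]] [A' [B' [C' [C0' ->]]]].
exists (A * C' + A' * C), (B * C' + B' * C), (C * C').
rewrite !rmorphD !rmorphM /= !hornerD !hornerM; split; first exact: mulf_neq0.
by field; rewrite C0 C0'.
Qed.

Lemma in_spanM z w : in_span z -> in_span w -> in_span (z * w).
Proof.
move=> [A [B [C [C0 ->]]]] [A' [B' [C' [C0' ->]]]].
exists (A * A' + B * B' * h), (A * B' + A' * B), (C * C').
rewrite !rmorphD !rmorphM /= !hornerD !hornerM -hy; split; first exact: mulf_neq0.
by field; rewrite C0 C0'.
Qed.

Lemma in_spanV z : separable_poly h -> (1 < size h)%N -> in_span z -> in_span z^-1.
Proof.
move=> hsep hs [A [B [C [C0 ->]]]].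
have [N0|N0] := eqVneq (A ^+ 2 - B ^+ 2 * h) 0.
  have [|A0 B0] := squarefree_norm hsep hs (A := A) (B := B).
    by apply/eqP; rewrite -subr_eq0 N0.
  rewrite A0 B0 rmorph0 horner0 mul0r addr0 mul0r invr0.
  by exists 0, 0, 1; rewrite rmorph1 hornerC oner_neq0 rmorph0 horner0 !mul0r addr0 mul0r.
have N1 : (A ^+ 2 - B ^+ 2 * h)@x != 0 by apply: contraNneq N0 => /lin_inj ->.
exists (A * C), (- B * C), (A ^+ 2 - B ^+ 2 * h); split=> //.
move: N1; rewrite !(rmorphB, rmorphM, rmorphXn, rmorphN) /= !(hornerD, hornerN, hornerM, horner_exp) -hy => N1.
have N1' : (A@x - B@x * y) * (A@x + B@x * y) != 0.
  by apply: contraNneq N1 => e; apply/eqP; rewrite -[RHS]e; ring.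
move: N1'; rewrite mulf_eq0 negb_or => /andP [n1 n2].
move: N1 C0 n1 n2; move: (A@x) (B@x) (C@x) => a b c N1 C0 n1 n2.
by field; rewrite n2 C0 N1.
Qed.

End Span.

Lemma function_fieldI (k F : fieldType) (f : {rmorphism k -> F}) (h h' : {poly k})
    (x y u v : F) :
  separable_poly h' -> (1 < size h')%N ->
  is_function_field f h x y ->
  (forall A, (map_poly f A).[u] = 0 -> A = 0) ->
  v ^+ 2 = (map_poly f h').[u] ->
  in_span f u v x -> in_span f u v y -> is_function_field f h' u v.
Proof.
move=> hsep hs [hy hlin hspan] tr hv hx hyy.
have hlin' A B : (map_poly f A).[u] + (map_poly f B).[u] * v = 0 -> A = 0 /\ B = 0.
  move=> /eqP; rewrite addr_eq0 => /eqP e; apply: (squarefree_norm hsep hs).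
  apply/eqP; rewrite -subr_eq0; apply/eqP/tr.
  rewrite !(rmorphB, rmorphM, rmorphXn) /= !(hornerD, hornerN, hornerM, horner_exp) e.
  by rewrite -hv; ring.
split=> // z; have [A [B [C [C0 ->]]]] := hspan z; rewrite -/(in_span f u v _).
have spanP (P : {poly k}) : in_span f u v (map_poly f P).[x].
  elim/poly_ind: P => [|P c IH].
    by have := in_span_poly f u v 0 0; rewrite !rmorph0 !horner0 mul0r addr0.
  rewrite rmorphD rmorphM /= map_polyX map_polyC hornerD hornerMX hornerC.
  apply: in_spanD; first exact: (in_spanM hv).
  by have := in_span_poly f u v c%:P 0; rewrite rmorph0 horner0 mul0r addr0 map_polyC hornerC.
apply: (in_spanM hv); last exact: (in_spanV hv hlin').
by apply: in_spanD; last apply: (in_spanM hv).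
Qed.

Section Isomorphism.
Variables (K : fieldType) (k : closedFieldType) (iota : {rmorphism K -> k}).
Variables (n : nat) (h h' : {poly K}).
Hypothesis n_gt0 : (0 < n)%N.
Hypothesis h_size : size h = n.*2.+1.
Hypothesis h_sep : separable_poly h.
Hypothesis h'_size : size h' = n.*2.+1.
Hypothesis h'_sep : separable_poly h'.
Hypothesis two0 : 2%:R != 0 :> k.

Local Notation X := (base_change iota (model n h)).
Local Notation Y := (base_change iota (model n h')).
Local Notation hk := (map_poly iota h).
Local Notation hk' := (map_poly iota h').

Lemma base_change_point (g : {poly K}) (v : 'rV[k]_n.+2) : (size g <= n.*2.+1)%N ->
  is_point idfun (base_change iota (model n g)) v <->
  is_point idfun (model n (map_poly iota g)) v.
Proof.
move=> sg.
have -> : is_point idfun (model n (map_poly iota g)) v <-> is_point iota (model n g) v.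
  rewrite !is_pointE ?size_map_poly //; split=> [] [c c0 H]; exists c => //.
    by move: H; rewrite map_poly_id ?coef_map.
  by rewrite map_poly_id ?coef_map.
have ev (p : {mpoly K[n.+2]}) : peval idfun v (map_mpoly iota p) = peval iota v p.
  rewrite -[LHS]/(mmap idfun (v 0) _) rmorph_mmap; apply: eq_mmap => [c|i] /=.
    by rewrite mmapC.
  by rewrite mmapX mmap1U.
split=> [] [v0 H]; split=> // p.
  by move=> hp; rewrite -ev; apply: H; exact: map_f.
by move=> /mapP [q hq ->]; rewrite ev; exact: H.
Qed.

Definition comp_row (N N' : nat) (s : 'rV[{mpoly k[N']}]_N) (P : {mpoly k[N]}) :
  {mpoly k[N']} := mmap (@mpolyC _ k) (s 0) P.

Lemma peval_comp (F : fieldType) (f : {rmorphism k -> F}) N N'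
    (s : 'rV[{mpoly k[N']}]_N) P v :
  peval f v (comp_row s P) = peval f (map_mx (peval f v) s) P.
Proof.
rewrite -[LHS]/(mmap f (v 0) _) rmorph_mmap; apply: eq_mmap => [c|i] /=.
  by rewrite mmapC.
by rewrite mxE.
Qed.

Lemma row_neq0 (F : fieldType) N (w : 'rV[F]_N) : w != 0 -> exists j, w 0 j != 0.
Proof.
move=> w0; apply/existsP; apply: contraR w0 => /existsPn H; apply/eqP/rowP => j.
by have := H j; rewrite negbK mxE => /eqP.
Qed.

Lemma iso_function_field (F : fieldType) (f : {rmorphism k -> F}) (x y : F) :
  is_function_field f hk x y -> isomorphic X Y ->
  exists u v, is_function_field f hk' u v.
Proof.
move=> FF [phi [psi [[phi1 phi2 _ phi4] [psi1 psi2 _ psi4] comp _]]].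
have [hy hlin _] := FF.
have shk : (size hk <= n.*2.+1)%N by rewrite size_map_poly h_size.
have shk' : (size hk' <= n.*2.+1)%N by rewrite size_map_poly h'_size.
have hk0 : hk != 0 by rewrite map_poly_eq0 -size_poly_eq0 h_size.
have affX t y0 : y0 ^+ 2 = hk.[t] -> is_point idfun X (aff n t y0).
  move=> e; apply/base_change_point; first by rewrite h_size.
  by rewrite -[aff _ _ _]scale1r; apply: affP; rewrite ?map_poly_id ?oner_neq0.
have tr0 (P : {mpoly k[n.+2]}) : (forall t y0, y0 ^+ 2 = hk.[t] ->
    peval idfun (aff n t y0) P = 0) -> peval f (aff n x y) P = 0.
  move=> H; have [A [B hAB]] := affine_normal_form n_gt0 shk P.
  have [] := @closed_curve0 k hk A B two0 hk0.
    by move=> t y0 e; rewrite -(H t y0 e) hAB !map_poly_id.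
  by move=> A0 B0; rewrite hAB // A0 B0 !rmorph0 horner0 mul0r addr0.
have tr1 (P : {mpoly k[n.+2]}) t y0 : y0 ^+ 2 = hk.[t] ->
    peval idfun (aff n t y0) P != 0 -> peval f (aff n x y) P != 0.
  move=> e; have [A [B hAB]] := affine_normal_form n_gt0 shk P.
  rewrite !hAB ?map_poly_id //; apply: contraNneq => /hlin [-> ->].
  by rewrite horner0 mul0r addr0.
have [y0 hy0] := closed_sqrt hk.[0]; pose v0 : 'rV[k]_n.+2 := aff n 0 y0.
have pv0 := affX _ _ hy0; have [w0 mw0] := phi2 _ pv0.
have [w00 [s sphi ew0]] := mw0.
have [j w0j] := row_neq0 w00.
pose w : 'rV[F]_n.+2 := map_mx (peval f (aff n x y)) s.
have wj : w 0 j != 0.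
  by rewrite mxE; apply: (tr1 _ _ _ hy0); move: w0j; rewrite ew0 mxE.
have sv t z : z ^+ 2 = hk.[t] -> peval idfun (aff n t z) (s 0 j) != 0 ->
    maps_to idfun phi (aff n t z) (map_mx (peval idfun (aff n t z)) s).
  move=> e s0; split; last by exists s.
  by apply/eqP => /rowP /(_ j); rewrite !mxE => /eqP; rewrite (negbTE s0).
have pw : is_point f (model n hk') w.
  split; first by apply: contraNneq wj => ->; rewrite mxE.
  move=> P hP; apply: (mulIf wj); rewrite mul0r -peval_comp mxE -pevalM.
  apply: tr0 => t z e; rewrite pevalM peval_comp.
  have [->|s0] := eqVneq (peval idfun (aff n t z) (s 0 j)) 0; first by rewrite mulr0.
  have /base_change_point [|_ H] := phi4 _ _ (affX _ _ e) (sv _ _ e s0).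
    by rewrite h'_size.
  by rewrite H ?mul0r.
have pw0 : is_point idfun Y w0 by exact: phi4 pv0 mw0.
have [v1 [v10 [r rpsi ev1]]] := psi2 _ pw0.
have [l v1l] := row_neq0 v10.
have rl : peval f w (r 0 l) != 0.
  rewrite -peval_comp; apply: (tr1 _ _ _ hy0); rewrite peval_comp -ew0.
  by move: v1l; rewrite ev1 mxE.
have minor i i' : peval f w (r 0 i) * aff n x y 0 i' = peval f w (r 0 i') * aff n x y 0 i.
  apply/eqP; rewrite -subr_eq0; apply/eqP; apply: (mulIf wj); rewrite mul0r.
  have -> : w 0 j = peval f (aff n x y) (s 0 j) by rewrite mxE.
  rewrite -!peval_comp -[aff n x y 0 i'](pevalX f) -[aff n x y 0 i](pevalX f).
  rewrite -!pevalM -pevalB -pevalM; apply: tr0 => t z e.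
  rewrite pevalM pevalB !pevalM !peval_comp !pevalX.
  have [->|s0] := eqVneq (peval idfun (aff n t z) (s 0 j)) 0; first by rewrite mulr0.
  have m1 := sv _ _ e s0; move: m1; set w' := map_mx _ s => m1.
  have [/eqP r0|r0] := eqVneq (map_mx (peval idfun w') r) 0.
    have rz i0 : peval idfun w' (r 0 i0) = 0.
      by have /eqP/rowP/(_ i0) := r0; rewrite !mxE.
    by rewrite !rz !mul0r subrr mul0r.
  have m2 : maps_to idfun psi w' (map_mx (peval idfun w') r) by split=> //; exists r.
  have [c c0 ec] := comp _ _ _ (affX _ _ e) m1 m2.
  have rc i0 : peval idfun w' (r 0 i0) = c * aff n t z 0 i0.
    by have /rowP/(_ i0) := ec; rewrite !mxE.
  by rewrite !rc [X in X - _]mulrAC subrr mul0r.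
have [e0 hom] := psi1 r rpsi.
have r0n : peval f w (r 0 (inord 0)) != 0.
  apply: contraNneq rl => r0; apply/eqP; have := minor l (inord 0).
  by rewrite r0 mul0r emb_inord // expr0 mulr1.
have rx : peval f w (r 0 (inord 1)) = peval f w (r 0 (inord 0)) * x.
  by have := minor (inord 1) (inord 0); rewrite !emb_inord // expr0 mulr1 expr1.
have ry : peval f w (r 0 ord_max) = peval f w (r 0 (inord 0)) * y.
  by have := minor ord_max (inord 0); rewrite emb_inord // emb_max expr0 mulr1.
have notconst : ~ exists a, x = f a.
  case=> a ea; have [] := hlin ('X - a%:P) 0.
    by rewrite rmorph0 horner0 mul0r addr0 rmorphB /= map_polyX map_polyC !hornerE /= ea subrr.
  by move/eqP; rewrite polyXsubC_eq0.
(* A k-point of Y cannot be the image of the generic point, since psi would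
   then express x by constants. *)
have nok (a : 'rV[k]_n.+2) c : c != 0 -> w = c *: map_mx f a -> False.
  move=> c0 ew; apply: notconst.
  have ev i : peval f w (r 0 i) = c ^+ e0 * f (peval idfun a (r 0 i)).
    rewrite ew (peval_homog _ _ _ (hom i)); congr (_ * _).
    rewrite /peval rmorph_mmap; apply: eq_mmap => [b|i0] //=.
    by rewrite mxE.
  move: r0n rx; rewrite !ev => r0n rx.
  have fa0 : f (peval idfun a (r 0 (inord 0))) != 0.
    by move: r0n; rewrite mulf_eq0 negb_or => /andP [].
  exists (peval idfun a (r 0 (inord 1)) / peval idfun a (r 0 (inord 0))).
  rewrite fmorph_div; apply: (mulfI r0n); rewrite -rx.
  by rewrite -mulrA; congr (_ * _); rewrite mulrC divfK.
move: (pw) => /(is_pointE f n_gt0 shk') [c c0 [[u [v [hv ew]]]|[v [hv ew]]]]; last first.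
  exfalso; have [b hb] := closed_sqrt hk'`_(n.*2).
  have [b' eb] : exists b', v = f b'.
    have /eqP : v ^+ 2 = f b ^+ 2 by rewrite hv -hb rmorphXn.
    by rewrite eqf_sqr => /orP [/eqP ->|/eqP ->]; [exists b|exists (- b); rewrite rmorphN].
  apply: (nok (infp n b') c c0); rewrite ew; congr (_ *: _).
  by apply/rowP => i; rewrite !mxE; case: ifP => _; rewrite ?rmorph_nat.
have tru A : (map_poly f A).[u] = 0 -> A = 0.
  move=> hA; apply/eqP; apply: contraT => A0; exfalso.
  have [a ea] : exists a, u = f a.
    move: hA; have [rs ->] := closed_field_poly_normal A.
    rewrite map_polyZ hornerZ rmorph_prod horner_prod => /eqP.
    rewrite mulf_eq0 fmorph_eq0 lead_coef_eq0 (negbTE A0) prodf_seq_eq0 /=.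
    case/hasP => a _ /=; rewrite rmorphB /= map_polyX map_polyC !hornerE subr_eq0.
    by move=> /eqP ->; exists a.
  have [b hb] := closed_sqrt hk'.[a].
  have [b' eb] : exists b', v = f b'.
    have /eqP : v ^+ 2 = f b ^+ 2 by rewrite hv ea horner_map -hb rmorphXn.
    by rewrite eqf_sqr => /orP [/eqP ->|/eqP ->]; [exists b|exists (- b); rewrite rmorphN].
  apply: (nok (aff n a b') c c0); rewrite ew ea eb; congr (_ *: _).
  by apply/rowP => i; rewrite !mxE; case: ifP => _; rewrite ?rmorphXn.
exists u, v.
have sep' : separable_poly hk' by rewrite separable_map.
have s1 : (1 < size hk')%N by rewrite size_map_poly h'_size ltnS double_gt0.
have lin' A B : (map_poly f A).[u] + (map_poly f B).[u] * v = 0 -> A = 0 /\ B = 0.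
  move=> /eqP; rewrite addr_eq0 => /eqP e; apply: (squarefree_norm sep' s1).
  apply/eqP; rewrite -subr_eq0; apply/eqP/tru.
  rewrite !(rmorphB, rmorphM, rmorphXn) /= !(hornerD, hornerN, hornerM, horner_exp) e.
  by rewrite -hv; ring.
have spanr i : in_span f u v (peval f (aff n u v) (r 0 i)).
  have [A [B hAB]] := affine_normal_form n_gt0 shk' (r 0 i).
  by rewrite hAB //; exact: in_span_poly.
have ev i : peval f w (r 0 i) = c ^+ e0 * peval f (aff n u v) (r 0 i).
  by rewrite ew (peval_homog _ _ _ (hom i)).
move: r0n rx ry; rewrite !ev mulf_eq0 negb_or => /andP [ce0 r0n].
rewrite -!mulrA => /(mulfI ce0) rx /(mulfI ce0) ry.
apply: (function_fieldI sep' s1 FF tru hv).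
  have -> : x = peval f (aff n u v) (r 0 (inord 1)) * (peval f (aff n u v) (r 0 (inord 0)))^-1.
    by rewrite rx mulrC mulKf.
  by apply: (in_spanM hv) => //; apply: (in_spanV hv lin').
have -> : y = peval f (aff n u v) (r 0 ord_max) * (peval f (aff n u v) (r 0 (inord 0)))^-1.
  by rewrite ry mulrC mulKf.
by apply: (in_spanM hv) => //; apply: (in_spanV hv lin').
Qed.

End Isomorphism.

Section QuarticInvariants.
Variable R : comNzRingType.

Definition quartic_I (a b c d e : R) : R := 12 * a * e - 3 * b * d + c ^+ 2.
Definition quartic_D (a b c d e : R) : R :=
  256 * a ^+ 3 * e ^+ 3 - 192 * a ^+ 2 * b * d * e ^+ 2
  - 128 * a ^+ 2 * c ^+ 2 * e ^+ 2 + 144 * a ^+ 2 * c * d ^+ 2 * e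
  - 27 * a ^+ 2 * d ^+ 4 + 144 * a * b ^+ 2 * c * e ^+ 2
  - 6 * a * b ^+ 2 * d ^+ 2 * e - 80 * a * b * c ^+ 2 * d * e
  + 18 * a * b * c * d ^+ 3 + 16 * a * c ^+ 4 * e - 4 * a * c ^+ 3 * d ^+ 2
  - 27 * b ^+ 4 * e ^+ 2 + 18 * b ^+ 3 * c * d * e - 4 * b ^+ 3 * d ^+ 3
  - 4 * b ^+ 2 * c ^+ 3 * e + b ^+ 2 * c ^+ 2 * d ^+ 2.

Variables a0 a1 a2 b0 b1 b2 c0 c1 c2 : R.
(* g at the coefficients of the quartic b(s)^2 - 4 a(s) c(s), the discriminant
   of a(s) t^2 + b(s) t + c(s), where a, b, c are quadratic.  The discriminant
   with respect to s, a quartic in t, has the same invariants. *)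
Definition disc_coef (a0 a1 a2 b0 b1 b2 c0 c1 c2 : R) (g : R -> R -> R -> R -> R -> R) : R :=
  g (b2 ^+ 2 - 4 * (a2 * c2)) (2 * b1 * b2 - 4 * (a1 * c2 + a2 * c1))
    (b1 ^+ 2 + 2 * b0 * b2 - 4 * (a0 * c2 + a1 * c1 + a2 * c0))
    (2 * b0 * b1 - 4 * (a0 * c1 + a1 * c0)) (b0 ^+ 2 - 4 * (a0 * c0)).

Lemma disc_I :
  disc_coef a0 a1 a2 b0 b1 b2 c0 c1 c2 quartic_I =
  disc_coef c2 b2 a2 c1 b1 a1 c0 b0 a0 quartic_I.
Proof. rewrite /disc_coef /quartic_I; ring. Qed.
Lemma quartic_D_roots (l w1 w2 w3 w4 : R) :
  quartic_D l (- l * (w1 + w2 + w3 + w4))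
    (l * (w1 * w2 + w1 * w3 + w1 * w4 + w2 * w3 + w2 * w4 + w3 * w4))
    (- l * (w1 * w2 * w3 + w1 * w2 * w4 + w1 * w3 * w4 + w2 * w3 * w4))
    (l * (w1 * w2 * w3 * w4)) =
  l ^+ 6 * ((w1 - w2) * (w3 - w4) * ((w1 - w3) * (w4 - w2)) * ((w1 - w4) * (w2 - w3))) ^+ 2.
Proof. rewrite /quartic_D; ring. Qed.
Lemma disc_D :
  disc_coef a0 a1 a2 b0 b1 b2 c0 c1 c2 quartic_D =
  disc_coef c2 b2 a2 c1 b1 a1 c0 b0 a0 quartic_D.
Proof. rewrite /disc_coef /quartic_D; ring. Qed.
End QuarticInvariants.

Lemma primitive_dvd (k : closedFieldType) (c : {poly k}) (P M Q : {poly {poly k}}) :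
  c != 0 -> (forall a, map_poly (horner_eval a) M != 0) ->
  c *: P = M * Q -> exists G, P = M * G.
Proof.
have [m] := ubnP (size c); elim: m c Q => // m IH c Q; rewrite ltnS => sc c0 prim e.
have [/size_poly1P [b b0 ec]|s1] := boolP (size c == 1).
  exists (b^-1%:P *: Q); rewrite -scalerAr -e scalerA ec -polyCM mulVf //.
  by rewrite polyC1 scale1r.
have /closed_rootP [a] := s1; rewrite -dvdp_XsubCl => /dvdpP [c1 ec].
have X0 : 'X - a%:P != 0 :> {poly k} by rewrite polyXsubC_eq0.
have c10 : c1 != 0 by apply: contraNneq c0 => c10; rewrite ec c10 mul0r.
have Qa : map_poly (horner_eval a) Q = 0.
  have /(congr1 (map_poly (horner_eval a))) := e.
  rewrite map_polyZ rmorphM ec /= /horner_eval hornerM !hornerE subrr mulr0 scale0r.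
  by move=> /esym/eqP; rewrite mulf_eq0 (negbTE (prim a)) => /eqP.
pose Q1 := map_poly (fun q : {poly k} => q %/ ('X - a%:P)) Q.
have eQ : Q = ('X - a%:P) *: Q1.
  apply/polyP => i; rewrite coefZ coef_map_id0 ?div0p // mulrC divpK //.
  rewrite dvdp_XsubCl; apply/eqP.
  by have /polyP /(_ i) := Qa; rewrite coef_map coef0.
apply: (IH c1 Q1) => //.
  by apply: leq_trans sc; rewrite ec size_Mmonic ?monicXsubC // size_XsubC addn2.
apply: (@mulfI _ ('X - a%:P)%:P); first by rewrite polyC_eq0.
by rewrite !mul_polyC scalerA mulrC -ec e eQ -scalerAr.
Qed.

Lemma dvd_coef_size (k : fieldType) (P M G : {poly {poly k}}) (s : nat) :
  P = M * G -> P != 0 -> (forall j : nat, (size (P`_j)%R <= s)%N) ->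
  forall j : nat, (size (M`_j)%R <= s)%N.
Proof.
move=> e P0 hP j; apply/leq_sizeP => i hi.
have sP : (size (swapXY P) <= s)%N.
  apply/leq_sizeP => i' hi'; apply/polyP => j'; rewrite coef_swapXY coef0.
  by apply: nth_default; apply: leq_trans (hP j') hi'.
have M0 : swapXY M != 0.
  apply: contraNneq P0 => M0; have M00 : M = 0 by rewrite -[M]swapXYK M0 raddf0.
  by rewrite e M00 mul0r.
have G0 : swapXY G != 0.
  apply: contraNneq P0 => G0; have G00 : G = 0 by rewrite -[G]swapXYK G0 raddf0.
  by rewrite e G00 mulr0.
have : (size (swapXY M) <= i)%N.
  apply: leq_trans hi; apply: leq_trans sP; rewrite e rmorphM /= size_mul //.
  by rewrite -subn1 -addnBA ?size_poly_gt0 // leq_addr.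
by move=> hs; rewrite -coef_swapXY [(swapXY M)`_i]nth_default // coef0.
Qed.

Section Evaluation.
Variables (k : closedFieldType) (F : fieldType) (f : {rmorphism k -> F}).
Variables (x u : F).

Definition eval2 (P : {poly {poly k}}) : F :=
  (map_poly (horner_eval x \o map_poly f) P).[u].

Lemma eval2D P Q : eval2 (P + Q) = eval2 P + eval2 Q.
Proof. by rewrite /eval2 rmorphD hornerD. Qed.
Lemma eval2B P Q : eval2 (P - Q) = eval2 P - eval2 Q.
Proof. by rewrite /eval2 rmorphB hornerD hornerN. Qed.
Lemma eval2M P Q : eval2 (P * Q) = eval2 P * eval2 Q.
Proof. by rewrite /eval2 rmorphM hornerM. Qed.
Lemma eval2Z c P : eval2 (c *: P) = (map_poly f c).[x] * eval2 P.
Proof. by rewrite /eval2 map_polyZ hornerZ. Qed.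
Lemma eval2C c : eval2 c%:P = (map_poly f c).[x].
Proof. by rewrite /eval2 map_polyC hornerC. Qed.
Lemma eval2X m : eval2 'X^m = u ^+ m.
Proof. by rewrite /eval2 map_polyXn hornerXn. Qed.
Lemma eval2_map P : eval2 (map_poly polyC P) = (map_poly f P).[u].
Proof.
rewrite /eval2 -map_poly_comp; congr (_.[u]); apply: eq_map_poly => c.
by rewrite /= map_polyC /horner_eval hornerC.
Qed.

Lemma minpoly_dvd (M P : {poly {poly k}}) :
  (forall R : {poly {poly k}}, (size R < size M)%N -> eval2 R = 0 -> R = 0) ->
  (forall a, map_poly (horner_eval a) M != 0) ->
  eval2 M = 0 -> eval2 P = 0 -> exists G, P = M * G.
Proof.
move=> hmin prim hM hP.
have M0 : M != 0 by apply: contraNneq (prim 0) => ->; rewrite rmorph0.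
have e := Pdiv.Idomain.divp_eq P M.
have R0 : P %% M = 0.
  apply: hmin; first by rewrite Pdiv.Idomain.ltn_modp.
  have /(congr1 eval2) := e.
  by rewrite eval2Z hP mulr0 eval2D eval2M hM mulr0 add0r.
apply: (@primitive_dvd _ (lead_coef M ^+ scalp P M) _ _ (P %/ M)) => //.
  by rewrite expf_neq0 // lead_coef_eq0.
by rewrite e R0 addr0 mulrC.
Qed.

End Evaluation.

Definition quad (R : nzRingType) (a b c : R) : {poly R} :=
  a *: 'X^2 + b *: 'X^1 + c%:P.

Lemma coef_quad (R : nzRingType) (a b c : R) i :
  (quad a b c)`_i = if i is 0 then c else if i is 1 then b else if i is 2 then a else 0.
Proof.
rewrite !coefD !coefZ !coefXn coefC.
by case: i => [|[|[|i]]] /=; rewrite !(mulr0, mulr1, add0r, addr0).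
Qed.

Lemma size_quad (R : nzRingType) (a b c : R) : a != 0 -> size (quad a b c) = 3%N.
Proof.
move=> a0; apply/eqP; rewrite eqn_leq; apply/andP; split.
  by apply/leq_sizeP => j; rewrite coef_quad; case: j => [|[|[|]]].
apply: contraLR a0; rewrite -ltnNge ltnS negbK => /leq_sizeP /(_ 2%N isT).
by rewrite coef_quad => ->.
Qed.

Lemma quadE (R : nzRingType) (p : {poly R}) : (size p <= 3)%N ->
  p = quad p`_2 p`_1 p`_0.
Proof.
move=> sp; apply/polyP => i; rewrite coef_quad.
by case: i => [|[|[|i]]] //; rewrite nth_default //; apply: leq_trans sp _.
Qed.

Lemma remove_common_roots (k : closedFieldType) (a b c : {poly k}) : a != 0 ->
  exists G a' b' c', [/\ G != 0, a = G * a', b = G * b', c = G * c' &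
    forall t, [|| a'.[t] != 0, b'.[t] != 0 | c'.[t] != 0]].
Proof.
have [m] := ubnP (size a); elim: m a b c => // m IH a b c; rewrite ltnS => sa a0.
have [|] := boolP (size (gcdp a (gcdp b c)) == 1).
  move=> /eqP s1; exists 1, a, b, c; rewrite !mul1r oner_neq0; split=> // t.
  rewrite -!negb_and; apply/negP => /and3P [ra rb rc].
  have : root (gcdp a (gcdp b c)) t by rewrite !root_gcd; apply/and3P.
  by move: s1 => /eqP/size_poly1P [d d0 ->]; rewrite rootC (negbTE d0).
move=> /closed_rootP [t]; rewrite !root_gcd -!dvdp_XsubCl => /and3P [].
move=> /dvdpP [a1 ea] /dvdpP [b1 eb] /dvdpP [c1 ec].
have a10 : a1 != 0 by apply: contraNneq a0 => e; rewrite ea e mul0r.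
have [|//|G [a' [b' [c' [G0 e1 e2 e3 H]]]]] := IH a1 b1 c1.
  by apply: leq_trans sa; rewrite ea size_Mmonic ?monicXsubC // size_XsubC addn2.
exists (G * ('X - t%:P)), a', b', c'; split=> //.
- by rewrite mulf_neq0 // polyXsubC_eq0.
- by rewrite ea e1 mulrAC.
- by rewrite eb e2 mulrAC.
- by rewrite ec e3 mulrAC.
Qed.

Section Discriminant.
Variables (k : closedFieldType) (F : fieldType) (f : {rmorphism k -> F}).
Variables (h : {poly k}) (x y : F).
Hypothesis FF : is_function_field f h x y.
Hypothesis h_sep : separable_poly h.
Hypothesis two0 : 2%:R != 0 :> k.

Local Notation "A @x" := ((map_poly f A).[x]) (at level 9).

Lemma discriminant_dvd (z : F) (A B C a b c : {poly k}) :
  C != 0 -> B != 0 -> z = (A@x + B@x * y) / C@x ->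
  a@x * z ^+ 2 + b@x * z + c@x = 0 -> [|| a != 0, b != 0 | c != 0] ->
  h %| b ^+ 2 - 4%:R * (a * c) /\ b ^+ 2 - 4%:R * (a * c) != 0.
Proof.
move=> C0 B0 ez e nz; have [hy hlin _] := FF.
have two : 2%:R != 0 :> {poly k} by rewrite -polyC_natr polyC_eq0.
have Cx := ff_horner_neq0 FF C0.
have [e1 e2] : a * (A ^+ 2 + B ^+ 2 * h) + b * A * C + c * C ^+ 2 = 0 /\
       2%:R * a * A * B + b * B * C = 0.
  apply: hlin.
  rewrite !(rmorphD, rmorphM, rmorphXn) /= !(hornerD, hornerM, horner_exp) -hy.
  rewrite -(mulr0 (C@x ^+ 2)) -e ez rmorph1 hornerC.
  move: Cx; move: (A@x) (B@x) (C@x) (a@x) (b@x) (c@x) => A' B' C' a' b' c' Cx.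
  by field.
have e3 : b * C = - 2%:R * a * A.
  by apply: (mulIf B0); rewrite mulrAC -(subr0 (b * B * C)) -e2; ring.
have key : (2%:R * a * B) ^+ 2 * h = C ^+ 2 * (b ^+ 2 - 4%:R * (a * c)).
  have -> : C ^+ 2 * (b ^+ 2 - 4%:R * (a * c)) = (b * C) ^+ 2 - 4%:R * a * (c * C ^+ 2) by ring.
  have -> : c * C ^+ 2 = - (a * (A ^+ 2 + B ^+ 2 * h)) - b * C * A.
    by rewrite -[LHS](subr0) -e1; ring.
  by rewrite e3; ring.
split; first exact: squarefree_dvdp h_sep C0 key.
apply/eqP => d0; move: key; rewrite d0 mulr0 => /eqP.
have h0 : h != 0 by exact: separable_poly_neq0.
rewrite mulf_eq0 (negbTE h0) orbF sqrf_eq0 !mulf_eq0 (negbTE two) (negbTE B0) orbF /=.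
move=> /eqP a0; move: e3 e1 nz; rewrite a0 mulr0 !mul0r => /eqP.
rewrite mulf_eq0 (negbTE C0) orbF => /eqP -> /eqP.
by rewrite !mul0r !add0r mulf_eq0 sqrf_eq0 (negbTE C0) orbF => /eqP ->; rewrite !eqxx.
Qed.

End Discriminant.

Definition poly_I (R : comNzRingType) (h : {poly R}) :=
  quartic_I h`_4 h`_3 h`_2 h`_1 h`_0.
Definition poly_D (R : comNzRingType) (h : {poly R}) :=
  quartic_D h`_4 h`_3 h`_2 h`_1 h`_0.

Lemma poly_IZ (R : comNzRingType) c (h : {poly R}) : poly_I (c *: h) = c ^+ 2 * poly_I h.
Proof. by rewrite /poly_I /quartic_I !coefZ; ring. Qed.
Lemma poly_DZ (R : comNzRingType) c (h : {poly R}) : poly_D (c *: h) = c ^+ 6 * poly_D h.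
Proof. by rewrite /poly_D /quartic_D !coefZ; ring. Qed.

Lemma disc_quad_coef (R : comNzRingType) (a0 a1 a2 b0 b1 b2 c0 c1 c2 : R) g :
  let d := quad b2 b1 b0 ^+ 2 - 4%:R * (quad a2 a1 a0 * quad c2 c1 c0) in
  (size d <= 5)%N /\ g d`_4 d`_3 d`_2 d`_1 d`_0 = disc_coef a0 a1 a2 b0 b1 b2 c0 c1 c2 g.
Proof.
move=> d; rewrite /disc_coef.
have -> : d = (b2 ^+ 2 - 4 * (a2 * c2)) *: 'X^4
    + (2 * b1 * b2 - 4 * (a1 * c2 + a2 * c1)) *: 'X^3
    + (b1 ^+ 2 + 2 * b0 * b2 - 4 * (a0 * c2 + a1 * c1 + a2 * c0)) *: 'X^2
    + (2 * b0 * b1 - 4 * (a0 * c1 + a1 * c0)) *: 'X^1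
    + (b0 ^+ 2 - 4 * (a0 * c0))%:P.
  rewrite /d /quad -!mul_polyC !(polyCB, polyCD, polyCM) !polyC1 expr1; ring.
split.
  apply/leq_sizeP => j hj; rewrite !coefD !coefZ !coefXn coefC.
  by case: j hj => [|[|[|[|[|j]]]]] //= _; rewrite !mulr0 !addr0.
by congr (g _ _ _ _ _); rewrite !coefD !coefZ !coefXn coefC /=;
  rewrite !(mulr0, mulr1, add0r, addr0).
Qed.

Lemma size_disc (R : comNzRingType) (a b c : {poly R}) (s : nat) :
  (size a <= s.+1)%N -> (size b <= s.+1)%N -> (size c <= s.+1)%N ->
  (size (b ^+ 2 - 4%:R * (a * c))%R <= s.*2.+1)%N.
Proof.
have sM (p q : {poly R}) : (size p <= s.+1)%N -> (size q <= s.+1)%N ->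
    (size (p * q)%R <= s.*2.+1)%N.
  move=> sp sq; apply: leq_trans (size_polyMleq p q) _.
  have := leq_add sp sq; rewrite addSn addnS addnn.
  by case: (size p + size q)%N.
move=> sa sb sc; apply: leq_trans (size_polyD _ _) _.
rewrite geq_max size_polyN expr2 sM //= -polyC_natr mul_polyC.
by apply: leq_trans (size_scale_leq _ _) _; exact: sM.
Qed.

Section Line.
Variables (k F : fieldType) (f : {rmorphism k -> F}) (x : F).
Hypothesis tr : forall A, (map_poly f A).[x] = 0 -> A = 0.
Local Notation "A @x" := ((map_poly f A).[x]) (at level 9).

Definition in_line z := exists A C, C@x != 0 /\ z = A@x / C@x.

Lemma in_lineD z w : in_line z -> in_line w -> in_line (z + w).
Proof.
move=> [A [C [C0 ->]]] [A' [C' [C0' ->]]].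
exists (A * C' + A' * C), (C * C').
rewrite !rmorphD !rmorphM /= !hornerD !hornerM; split; first exact: mulf_neq0.
by field; rewrite C0 C0'.
Qed.

Lemma in_lineM z w : in_line z -> in_line w -> in_line (z * w).
Proof.
move=> [A [C [C0 ->]]] [A' [C' [C0' ->]]].
exists (A * A'), (C * C').
rewrite !rmorphM /= !hornerM; split; first exact: mulf_neq0.
by field; rewrite C0 C0'.
Qed.

Lemma in_lineV z : in_line z -> in_line z^-1.
Proof.
move=> [A [C [C0 ->]]]; have [A0|A0] := eqVneq (A@x) 0.
  by rewrite A0 mul0r invr0; exists 0, 1; rewrite rmorph1 hornerC oner_neq0 rmorph0 horner0 mul0r.
by exists C, A; split=> //; rewrite invf_div.
Qed.

Lemma in_lineC c : in_line (f c).
Proof. by exists c%:P, 1; rewrite rmorph1 map_polyC !hornerC oner_neq0 divr1. Qed.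

Lemma in_line_horner (P : {poly k}) z : in_line z -> in_line (map_poly f P).[z].
Proof.
move=> hz; elim/poly_ind: P => [|P c IH].
  by rewrite rmorph0 horner0 -(rmorph0 f); exact: in_lineC.
rewrite rmorphD rmorphM /= map_polyX map_polyC hornerD hornerMX hornerC.
by apply: in_lineD (in_lineC _); apply: in_lineM.
Qed.

Lemma in_lineN z : in_line z -> in_line (- z).
Proof. by move=> hz; rewrite -mulN1r -(rmorphN1 f); apply: in_lineM hz; exact: in_lineC. Qed.

End Line.

Section TwoGenerators.
Variables (k : closedFieldType) (F : fieldType) (f : {rmorphism k -> F}).
Variables (n : nat) (h h' : {poly k}) (x y u v : F).
Hypothesis n_gt1 : (1 < n)%N.
Hypothesis h_size : size h = n.*2.+1.
Hypothesis h'_size : size h' = n.*2.+1.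
Hypothesis h_sep : separable_poly h.
Hypothesis h'_sep : separable_poly h'.
Hypothesis two0 : 2%:R != 0 :> k.
Hypothesis FF : is_function_field f h x y.
Hypothesis FF' : is_function_field f h' u v.

Local Notation "A @x" := ((map_poly f A).[x]) (at level 9).
Local Notation "A @u" := ((map_poly f A).[u]) (at level 9).

Let h0 : h != 0. Proof. exact: separable_poly_neq0. Qed.
Let h'0 : h' != 0. Proof. exact: separable_poly_neq0. Qed.

Lemma y_notin_line : ~ in_line f x y.
Proof.
have [hy hlin _] := FF; case=> A [C [C0 ey]]; have [] := hlin (- A) C.
  by rewrite rmorphN hornerN ey mulrC divfK // addNr.
by move=> _ C00; rewrite C00 rmorph0 horner0 eqxx in C0.
Qed.

Lemma u_not_const c : u != f c.
Proof.
apply/eqP => e; have := @ff_transcendental _ _ _ _ _ _ FF' ('X - c%:P).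
rewrite rmorphB /= map_polyX map_polyC !hornerE e subrr => /(_ erefl) /eqP.
by rewrite polyXsubC_eq0.
Qed.

Lemma moebius_case : in_line f x u -> exists p q r s, p * s - q * r != 0 /\
  forall w, root h w -> r * w + s != 0 /\ root h' ((p * w + q) / (r * w + s)).
Proof.
move=> hu; have [hy hlin hspan] := FF; have [hv hlin' hspan'] := FF'.
have [A [C [C0 eu cop]]] : exists A C, [/\ C@x != 0, u = A@x / C@x & coprimep A C].
  have [A [C [C0 ->]]] := hu; have Cn : C != 0.
    by apply: contraNneq C0 => ->; rewrite rmorph0 horner0.
  have g0 : gcdp A C != 0 by rewrite gcdp_eq0 negb_and Cn orbT.
  have g0' := ff_horner_neq0 FF g0.
  have eA : A@x = (A %/ gcdp A C)@x * (gcdp A C)@x.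
    by rewrite -hornerM -rmorphM /= divpK // dvdp_gcdl.
  have eC : C@x = (C %/ gcdp A C)@x * (gcdp A C)@x.
    by rewrite -hornerM -rmorphM /= divpK // dvdp_gcdr.
  exists (A %/ gcdp A C), (C %/ gcdp A C); split.
  - by apply: contraNneq C0 => e; rewrite eC e mul0r.
  - by rewrite eA eC -mulf_div divff // mulr1.
  - by apply: coprimep_div_gcd; rewrite Cn orbT.
have vline : ~ in_line f x v.
  move=> hvl; apply: y_notin_line; have [P [Q [R [R0 ->]]]] := hspan' y.
  apply: in_lineM; last by apply: in_lineV; exact: in_line_horner.
  by apply: in_lineD; last apply: in_lineM => //; exact: in_line_horner.
have Cn : C != 0 by apply: contraNneq C0 => ->; rewrite rmorph0 horner0.
(* x is a rational function of u: the coefficient of v must vanish *)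
have [P [R [R0 ex]]] : exists P R, R@u != 0 /\ x * R@u = P@u.
  have [P [Q [R [R0 ex]]]] := hspan' x; exists P, R; split=> //.
  have exR : x * R@u = P@u + Q@u * v by rewrite ex divfK.
  have [Q0|Q0] := eqVneq (Q@u) 0; first by rewrite exR Q0 mul0r addr0.
  exfalso; apply: vline.
  have -> : v = (x * R@u - P@u) * (Q@u)^-1 by rewrite exR addrAC subrr add0r mulrAC divff // mul1r.
  have hx : in_line f x x by exists 'X, 1; rewrite rmorph1 hornerC oner_neq0 map_polyX hornerX divr1.
  apply: in_lineM; last by apply: in_lineV; exact: in_line_horner.
  apply: in_lineD; last by apply: in_lineN; exact: in_line_horner.
  by apply: in_lineM => //; exact: in_line_horner.
have Rn : R != 0 by apply: contraNneq R0 => ->; rewrite rmorph0 horner0.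
pose M : {poly {poly k}} := C *: 'X^1 - A%:P.
pose Pol : {poly {poly k}} := map_poly polyC P - 'X *: map_poly polyC R.
have coefM i : M`_i = if i is 0 then - A else if i is 1 then C else 0.
  rewrite coefB coefZ coefXn coefC; case: i => [|[|i]] /=.
  - by rewrite mulr0 sub0r.
  - by rewrite mulr1 subr0.
  - by rewrite mulr0 subr0.
have [G eG] : exists G, Pol = M * G.
  apply: (@minpoly_dvd _ _ f x u).
  - move=> R' sR'; have : (size R' <= 1)%N.
      rewrite -ltnS; apply: leq_trans sR' _; apply/leq_sizeP => j hj.
      by rewrite coefM; case: j hj => [|[|j]].
    move=> /size1_polyC ->; rewrite eval2C => /(ff_transcendental FF) ->.
    by rewrite polyC0.
  - move=> a; apply/eqP => /polyP H; have := H 1%N; have := H 0%N.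
    rewrite !coef_map !coefM !coef0 /= /horner_eval hornerN => /eqP.
    rewrite oppr_eq0 => Aa; have := coprimep_root cop Aa.
    by move=> /eqP Ca e; apply: Ca.
  - by rewrite eval2B eval2Z eval2X eval2C eu expr1 mulrC divfK // subrr.
  - by rewrite eval2B eval2Z !eval2_map map_polyX hornerX ex subrr.
have sM : forall j : nat, (size (M`_j)%R <= 2)%N.
  apply: (dvd_coef_size eG).
    apply: contraNneq Rn => e; apply/eqP/polyP => j; rewrite coef0.
    have /polyP/(_ j)/polyP/(_ 1%N) := e.
    rewrite coefB coefZ !coef_map /= coefB coefC coefXM coefC !coef0 /= sub0r.
    by move/eqP; rewrite oppr_eq0 => /eqP.
  move=> j; apply/leq_sizeP => i hi; rewrite coefB coefZ !coef_map /= coefB coefC coefXM coefC.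
  by case: i hi => [|[|i]] //= _; rewrite subrr.
have sA : (size A <= 2)%N by have := sM 0%N; rewrite coefM size_polyN.
have sC : (size C <= 2)%N by have := sM 1%N; rewrite coefM.
have hor (B : {poly k}) w : (size B <= 2)%N -> B.[w] = B`_1 * w + B`_0.
  move=> sB; rewrite (horner_coef_wide _ sB) big_ord_recl big_ord1 /=.
  by rewrite expr0 expr1 mulr1 addrC.
have horx (B : {poly k}) : (size B <= 2)%N -> B@x = f B`_1 * x + f B`_0.
  move=> sB; rewrite (@horner_coef_wide _ 2) ?size_map_poly // big_ord_recl big_ord1 /=.
  by rewrite expr0 expr1 mulr1 addrC !coef_map.
exists A`_1, A`_0, C`_1, C`_0; split.
  apply/eqP => det.
  have e1 : f C`_1 * A@x = f A`_1 * C@x.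
    rewrite !horx //; apply/eqP; rewrite -subr_eq0; apply/eqP.
    have -> : f C`_1 * (f A`_1 * x + f A`_0) - f A`_1 * (f C`_1 * x + f C`_0) =
       - (f A`_1 * f C`_0 - f A`_0 * f C`_1) by ring.
    by rewrite -!rmorphM -rmorphB det rmorph0 oppr0.
  have e0 : f C`_0 * A@x = f A`_0 * C@x.
    rewrite !horx //; apply/eqP; rewrite -subr_eq0; apply/eqP.
    have -> : f C`_0 * (f A`_1 * x + f A`_0) - f A`_0 * (f C`_1 * x + f C`_0) =
       (f A`_1 * f C`_0 - f A`_0 * f C`_1) * x by ring.
    by rewrite -!rmorphM -rmorphB det rmorph0 mul0r.
  have [C10|C10] := eqVneq C`_1 0; last first.
    have := u_not_const (A`_1 / C`_1); rewrite eu fmorph_div eqr_div ?fmorph_eq0 //.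
    by rewrite mulrC e1 eqxx.
  have [C00|C00] := eqVneq C`_0 0; last first.
    have := u_not_const (A`_0 / C`_0); rewrite eu fmorph_div eqr_div ?fmorph_eq0 //.
    by rewrite mulrC e0 eqxx.
  by move: C0; rewrite horx // C10 C00 rmorph0 mul0r addr0 eqxx.
have [A1 [B1 [C1 [C10 ev]]]] := hspan v.
pose S : {poly k} := \sum_(i < n.*2.+1) h'`_i *: (A ^+ i * C ^+ (n.*2 - i)).
have hS : h'@u * C@x ^+ n.*2 = S@x.
  rewrite (@horner_coef_wide _ n.*2.+1) ?size_map_poly ?h'_size // mulr_suml.
  rewrite rmorph_sum horner_sum; apply: eq_bigr => i _.
  rewrite coef_map /= map_polyZ hornerZ rmorphM !rmorphXn /= hornerM !horner_exp eu.
  have -> : C@x ^+ n.*2 = C@x ^+ i * C@x ^+ (n.*2 - i).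
    by rewrite -exprD subnKC // -ltnS.
  rewrite expr_div_n -mulrA; congr (_ * _); rewrite mulrA divfK //.
  exact: expf_neq0.
have B10 : B1 != 0.
  apply/eqP => B10; apply: vline; exists A1, C1; split=> //.
  by rewrite ev B10 rmorph0 horner0 mul0r addr0.
have C1n : C1 != 0 by apply: contraNneq C10 => ->; rewrite rmorph0 horner0.
have Cm0 : C ^+ n.*2 != 0 by exact: expf_neq0.
have [q1 q2] : (A1 ^+ 2 + B1 ^+ 2 * h) * C ^+ n.*2 - C1 ^+ 2 * S = 0 /\
     2%:R * A1 * B1 * C ^+ n.*2 = 0.
  apply: hlin.
  rewrite !(rmorphD, rmorphN, rmorphM, rmorphXn) /=.
  rewrite !(hornerD, hornerN, hornerM, horner_exp) -hy -hS -hv ev rmorph1 hornerC.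
  move: C10; move: (A1@x) (B1@x) (C1@x) (C@x ^+ _) => a b c d c0.
  by field.
have A10 : A1 = 0.
  move/eqP: q2; rewrite !mulf_eq0 (negbTE Cm0) (negbTE B10) !orbF.
  by rewrite -polyC_natr polyC_eq0 (negbTE two0) => /eqP.
have hdvd : h %| S.
  apply: (squarefree_dvdp (E := B1 * C ^+ n) h_sep C1n).
  apply/eqP; rewrite -subr_eq0 -q1 A10 -muln2 exprM; apply/eqP; ring.
move=> w hw; have Sw : S.[w] = 0.
  by apply/eqP; move: hw; rewrite -/(root S w) -!dvdp_XsubCl => hw; exact: dvdp_trans hw hdvd.
rewrite -!hor //.
have Cw : C.[w] != 0.
  apply/eqP => Cw.
  have Aw : A.[w] != 0.
    apply: contraTneq cop => Aw; rewrite coprimep_sym; apply/negP => cp.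
    by have := coprimep_root cp (_ : root C w); rewrite /root Cw eqxx Aw eqxx => /(_ isT).
  move: Sw; rewrite horner_sum big_ord_recr /= big1 ?add0r => [|i _].
    rewrite subnn expr0 mulr1 hornerZ horner_exp => /eqP.
    rewrite mulf_eq0 expf_eq0 (negbTE Aw) andbF orbF => /eqP e.
    by have := lead_coef_eq0 h'; rewrite lead_coefE h'_size /= e eqxx (negbTE h'0).
  rewrite hornerZ hornerM !horner_exp Cw expr0n.
  by rewrite subn_eq0 leqNgt ltn_ord !mulr0.
split=> //; rewrite /root; apply/eqP.
apply: (mulIf (expf_neq0 n.*2 Cw)); rewrite mul0r -Sw horner_sum.
rewrite (@horner_coef_wide _ n.*2.+1) ?h'_size // mulr_suml; apply: eq_bigr => i _.
rewrite hornerZ hornerM !horner_exp.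
have -> : C.[w] ^+ n.*2 = C.[w] ^+ i * C.[w] ^+ (n.*2 - i).
  by rewrite -exprD subnKC // -ltnS.
by rewrite expr_div_n -mulrA; congr (_ * _); rewrite mulrA divfK // expf_neq0.
Qed.

Lemma biquadratic_case A B C : B != 0 -> C@x != 0 ->
  u = (A@x + B@x * y) / C@x ->
  n = 2%N /\ poly_I h ^+ 3 * poly_D h' = poly_I h' ^+ 3 * poly_D h.
Proof.
move=> Bn C0 eu; have [hy hlin hspan] := FF; have [hv hlin' hspan'] := FF'.
have Cn : C != 0 by apply: contraNneq C0 => ->; rewrite rmorph0 horner0.
have [G [a [b [c [G0 ea eb ec prim]]]]] :=
  @remove_common_roots k (C ^+ 2) (- (2%:R * A * C)) (A ^+ 2 - B ^+ 2 * h) (expf_neq0 2 Cn).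
have an : a != 0.
  by apply: contraTneq (expf_neq0 2 Cn) => e; rewrite ea e mulr0 eqxx.
have rel : a@x * u ^+ 2 + b@x * u + c@x = 0.
  apply: (mulfI (ff_horner_neq0 FF G0)); rewrite mulr0 !mulrDr !mulrA -!hornerM -!rmorphM /=.
  rewrite -ea -eb -ec !(rmorphB, rmorphN, rmorphM, rmorphXn) rmorph_nat /=.
  rewrite !(hornerD, hornerN, hornerM, horner_exp) -hy eu -polyC1 !hornerC.
  by move: C0; move: (A@x) (B@x) (C@x) => a' b' c' c0; field.
have [hdvd dn] := discriminant_dvd FF h_sep two0 Cn Bn eu rel (introT or3P (Or31 _ _ an)).
pose M := quad a b c.
have hM : eval2 f x u M = 0.
  by rewrite !eval2D !eval2Z !eval2X eval2C expr1.
have primM t : map_poly (horner_eval t) M != 0.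
  apply/eqP => /polyP H; have := prim t.
  have := H 0%N; have := H 1%N; have := H 2%N.
  by rewrite !coef_map !coef_quad !coef0 /= /horner_eval => -> -> ->; rewrite eqxx.
have minM (R : {poly {poly k}}) : (size R < size M)%N -> eval2 f x u R = 0 -> R = 0.
  rewrite size_quad // ltnS => sR.
  have eR : R = R`_1 *: 'X^1 + (R`_0)%:P.
    apply/polyP => i; rewrite coefD coefZ coefXn coefC; case: i => [|[|i]] /=.
    - by rewrite mulr0 add0r.
    - by rewrite mulr1 addr0.
    - by rewrite mulr0 addr0 nth_default //; apply: leq_trans sR _.
  rewrite eR eval2D eval2Z eval2X eval2C expr1 eu => e.
  have [q0 q1] : R`_1 * A + R`_0 * C = 0 /\ R`_1 * B = 0.
    apply: hlin; rewrite !rmorphD !rmorphM /= !hornerD !hornerM.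
    rewrite -(mulr0 (C@x)) -e; move: C0; move: (A@x) (B@x) (C@x) => a' b' c' c0.
    by field.
  have R1 : R`_1 = 0 by move/eqP: q1; rewrite mulf_eq0 (negbTE Bn) orbF => /eqP.
  move/eqP: q0; rewrite R1 mul0r add0r mulf_eq0 (negbTE Cn) orbF => /eqP R0.
  by rewrite R0 scale0r add0r polyC0.
have [P [Q [R [R0 ex]]]] := hspan' x.
have Rn : R != 0 by apply: contraNneq R0 => ->; rewrite rmorph0 horner0.
have exR : R@u * x = P@u + Q@u * v by rewrite mulrC ex divfK.
have size_of (Pol : {poly {poly k}}) (s : nat) : Pol != 0 -> eval2 f x u Pol = 0 ->
    (forall j : nat, (size (Pol`_j)%R <= s)%N) ->
    [/\ size a <= s, size b <= s & size c <= s]%N.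
  move=> Pn eP sP; have [G' eG] := minpoly_dvd minM primM hM eP.
  have sM := dvd_coef_size eG Pn sP.
  by have := sM 2%N; have := sM 1%N; have := sM 0%N; rewrite !coef_quad.
have Qn : Q != 0.
  apply/eqP => Q0.
  have [||j|sa sb sc] := @size_of (map_poly polyC P - 'X *: map_poly polyC R) 2%N.
  - apply: contraNneq Rn => e; apply/eqP/polyP => j; rewrite coef0.
    have /polyP/(_ j)/polyP/(_ 1%N) := e.
    rewrite coefB coefZ !coef_map /= coefB coefC coefXM coefC !coef0 /= sub0r.
    by move/eqP; rewrite oppr_eq0 => /eqP.
  - rewrite eval2B eval2Z !eval2_map map_polyX hornerX mulrC exR Q0.
    by rewrite rmorph0 horner0 mul0r addr0 subrr.
  - apply/leq_sizeP => i hi; rewrite coefB coefZ !coef_map /= coefB coefC coefXM coefC.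
    by case: i hi => [|[|i]] //= _; rewrite subrr.
  have := leq_trans (dvdp_leq dn hdvd) (size_disc (s := 1) sa sb sc).
  by rewrite h_size ltnS leq_double leqNgt n_gt1.
have [||j|sa sb sc] := @size_of ('X^2 *: map_poly polyC (R ^+ 2)
    - 'X *: map_poly polyC (2%:R * P * R) + map_poly polyC (P ^+ 2 - Q ^+ 2 * h')) 3%N.
- apply: contraNneq (expf_neq0 2 Rn) => e; apply/eqP/polyP => j; rewrite [RHS]coef0.
  move/(congr1 (fun p : {poly {poly k}} => p`_j`_2)): e; rewrite /= !coef0.
  rewrite coefD coefB !coefZ !coef_map /= coefD coefB !coefC coefXM coefXnM !coefC /=.
  by rewrite subr0 addr0.
- rewrite eval2D eval2B !eval2Z !eval2_map map_polyX map_polyXn hornerX hornerXn.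
  rewrite !(rmorphB, rmorphM, rmorphXn) rmorph_nat /=.
  rewrite !(hornerD, hornerN, hornerM, horner_exp) -hv -polyC1 !hornerC.
  transitivity ((R@u * x - P@u) ^+ 2 - (Q@u * v) ^+ 2); first ring.
  by rewrite exR addrAC subrr add0r subrr.
- apply/leq_sizeP => i hi.
  rewrite coefD coefB !coefZ !coef_map /= coefD coefB !coefC coefXM coefXnM !coefC.
  by case: i hi => [|[|[|i]]] //= _; rewrite subrr addr0.
pose a' := quad a`_2 b`_2 c`_2; pose b' := quad a`_1 b`_1 c`_1; pose c' := quad a`_0 b`_0 c`_0.
have rel' : a'@u * x ^+ 2 + b'@u * x + c'@u = 0.
  have hq (p : {poly k}) : (size p <= 3)%N -> p@x = f p`_2 * x ^+ 2 + f p`_1 * x + f p`_0.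
    move=> sp; rewrite (@horner_coef_wide _ 3) ?size_map_poly // !big_ord_recl big_ord0 !coef_map /=.
    by rewrite /bump /= expr0 expr1; ring.
  have hq' p2 p1 p0 : (quad p2 p1 p0)@u = f p2 * u ^+ 2 + f p1 * u + f p0.
    by rewrite /quad !rmorphD /= !map_polyZ !map_polyXn map_polyC !hornerE.
  by rewrite !hq' -[RHS]rel !hq //; ring.
have nz' : [|| a' != 0, b' != 0 | c' != 0].
  apply: contraR an; rewrite !negb_or !negbK => /and3P [/eqP a0 /eqP b0 /eqP c0].
  apply/eqP; rewrite (quadE sa).
  have /polyP/(_ 2%N) := a0; have /polyP/(_ 2%N) := b0; have /polyP/(_ 2%N) := c0.
  rewrite !coef_quad !coef0 => -> -> ->.
  by rewrite /quad !scale0r !add0r polyC0.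
have [hdvd' dn'] := discriminant_dvd FF' h'_sep two0 Rn Qn ex rel' nz'.
have [sd eI] := disc_quad_coef a`_0 a`_1 a`_2 b`_0 b`_1 b`_2 c`_0 c`_1 c`_2 (@quartic_I k).
have [_ eD] := disc_quad_coef a`_0 a`_1 a`_2 b`_0 b`_1 b`_2 c`_0 c`_1 c`_2 (@quartic_D k).
have [sd' eI'] := disc_quad_coef c`_2 b`_2 a`_2 c`_1 b`_1 a`_1 c`_0 b`_0 a`_0 (@quartic_I k).
have [_ eD'] := disc_quad_coef c`_2 b`_2 a`_2 c`_1 b`_1 a`_1 c`_0 b`_0 a`_0 (@quartic_D k).
rewrite -!quadE // in sd eI eD.
have n2 : n = 2%N.
  have := leq_trans (dvdp_leq dn hdvd) sd; rewrite h_size ltnS (leq_double n 2) => n2.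
  by apply/eqP; rewrite eqn_leq n2.
split=> //.
have scal (p d : {poly k}) : p %| d -> d != 0 -> size p = n.*2.+1 -> (size d <= 5)%N ->
    exists2 e, e != 0 & d = e *: p.
  move=> pd d0 sp sd0; have : p %= d.
    by rewrite -(dvdp_size_eqp pd) eqn_leq dvdp_leq //= sp n2.
  by rewrite eqp_sym => /eqpf_eq [e e0 ->]; exists e.
have [e e0 ed] := scal _ _ hdvd dn h_size sd.
have [e' e0' ed'] := scal _ _ hdvd' dn' h'_size sd'.
have rI := disc_I a`_0 a`_1 a`_2 b`_0 b`_1 b`_2 c`_0 c`_1 c`_2.
have rD := disc_D a`_0 a`_1 a`_2 b`_0 b`_1 b`_2 c`_0 c`_1 c`_2.
rewrite -eI -eI' -!/(poly_I _) ed ed' !poly_IZ in rI.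
rewrite -eD -eD' -!/(poly_D _) ed ed' !poly_DZ in rD.
apply: (mulfI (mulf_neq0 (expf_neq0 6 e0) (expf_neq0 6 e0'))).
have -> : e ^+ 6 * e' ^+ 6 * (poly_I h ^+ 3 * poly_D h') =
  (e ^+ 2 * poly_I h) ^+ 3 * (e' ^+ 6 * poly_D h') by ring.
by rewrite rI -rD; ring.
Qed.

Lemma two_generators :
  (exists p q r s, p * s - q * r != 0 /\
    forall w, root h w -> r * w + s != 0 /\ root h' ((p * w + q) / (r * w + s))) \/
  n = 2%N /\ poly_I h ^+ 3 * poly_D h' = poly_I h' ^+ 3 * poly_D h.
Proof.
have [_ _ hspan] := FF; have [A [B [C [C0 eu]]]] := hspan u.
have [B0|B0] := eqVneq B 0; last by right; exact: biquadratic_case B0 C0 eu.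
left; apply: moebius_case; exists A, C; split=> //.
by rewrite eu B0 rmorph0 horner0 mul0r addr0.
Qed.

End TwoGenerators.

Section CrossRatio.
Variable R : comNzRingType.

(* With A + B + C = 0 the three bracket products of four points, the
   j-invariant of the points is S2 ^+ 3 / S3 ^+ 2 up to a constant. *)
Definition cross_S2 (w1 w2 w3 w4 : R) : R :=
  let A := (w1 - w2) * (w3 - w4) in let B := (w1 - w3) * (w4 - w2) in
  let C := (w1 - w4) * (w2 - w3) in A * B + B * C + C * A.
Definition cross_S3 (w1 w2 w3 w4 : R) : R :=
  (w1 - w2) * (w3 - w4) * ((w1 - w3) * (w4 - w2)) * ((w1 - w4) * (w2 - w3)).

Definition j_relation (w w' : R * R * R * R) : Prop :=
  let: (w1, w2, w3, w4) := w in let: (w1', w2', w3', w4') := w' in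
  cross_S2 w1 w2 w3 w4 ^+ 3 * cross_S3 w1' w2' w3' w4' ^+ 2 =
  cross_S2 w1' w2' w3' w4' ^+ 3 * cross_S3 w1 w2 w3 w4 ^+ 2.

Lemma quartic_expand (l w1 w2 w3 w4 : R) g :
  let h := l *: \prod_(z <- [:: w1; w2; w3; w4]) ('X - z%:P) in
  g h`_4 h`_3 h`_2 h`_1 h`_0 = g l (- l * (w1 + w2 + w3 + w4))
    (l * (w1 * w2 + w1 * w3 + w1 * w4 + w2 * w3 + w2 * w4 + w3 * w4))
    (- l * (w1 * w2 * w3 + w1 * w2 * w4 + w1 * w3 * w4 + w2 * w3 * w4))
    (l * (w1 * w2 * w3 * w4)) :> R.
Proof.
move=> h.
have -> : h = l *: 'X^4 + (- l * (w1 + w2 + w3 + w4)) *: 'X^3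
  + (l * (w1 * w2 + w1 * w3 + w1 * w4 + w2 * w3 + w2 * w4 + w3 * w4)) *: 'X^2
  + (- l * (w1 * w2 * w3 + w1 * w2 * w4 + w1 * w3 * w4 + w2 * w3 * w4)) *: 'X^1
  + (l * (w1 * w2 * w3 * w4))%:P.
  rewrite /h !big_cons big_nil -!mul_polyC !(polyCN, polyCD, polyCM) expr1; ring.
by congr (g _ _ _ _ _); rewrite !coefD !coefZ !coefXn coefC /=;
  rewrite !(mulr0, mulr1, add0r, addr0).
Qed.

Lemma poly_I_roots (l w1 w2 w3 w4 : R) :
  poly_I (l *: \prod_(z <- [:: w1; w2; w3; w4]) ('X - z%:P)) =
  - l ^+ 2 * cross_S2 w1 w2 w3 w4.
Proof. by rewrite /poly_I quartic_expand /quartic_I /cross_S2; ring. Qed.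

Lemma poly_D_roots (l w1 w2 w3 w4 : R) :
  poly_D (l *: \prod_(z <- [:: w1; w2; w3; w4]) ('X - z%:P)) =
  l ^+ 6 * cross_S3 w1 w2 w3 w4 ^+ 2.
Proof. by rewrite /poly_D quartic_expand quartic_D_roots. Qed.

End CrossRatio.

Lemma cross_S3_neq0 (F : fieldType) (w1 w2 w3 w4 : F) :
  uniq [:: w1; w2; w3; w4] -> cross_S3 w1 w2 w3 w4 != 0.
Proof.
rewrite /= !inE !negb_or => /and4P [/and3P [h12 h13 h14] /andP [h23 h24] h34 _].
by rewrite !mulf_neq0 // subr_eq0 // eq_sym.
Qed.

Lemma moebius_j_relation (F : fieldType) (p q r s w1 w2 w3 w4 : F) :
  let m w := (p * w + q) / (r * w + s) in
  r * w1 + s != 0 -> r * w2 + s != 0 -> r * w3 + s != 0 -> r * w4 + s != 0 ->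
  j_relation (w1, w2, w3, w4) (m w1, m w2, m w3, m w4).
Proof.
move=> m n1 n2 n3 n4.
pose d := p * s - q * r.
have mB a b : r * a + s != 0 -> r * b + s != 0 ->
    m a - m b = d * (a - b) / ((r * a + s) * (r * b + s)).
  by move=> na nb; rewrite /m /d; field; rewrite na nb.
pose t := d ^+ 2 / ((r * w1 + s) * (r * w2 + s) * (r * w3 + s) * (r * w4 + s)).
have e2 : cross_S2 (m w1) (m w2) (m w3) (m w4) = t ^+ 2 * cross_S2 w1 w2 w3 w4.
  rewrite /cross_S2 !mB // /t; move: n1 n2 n3 n4.
  move: (r * w1 + s) (r * w2 + s) (r * w3 + s) (r * w4 + s) => x1 x2 x3 x4 n1 n2 n3 n4.
  by field; rewrite n1 n2 n3 n4.
have e3 : cross_S3 (m w1) (m w2) (m w3) (m w4) = t ^+ 3 * cross_S3 w1 w2 w3 w4.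
  rewrite /cross_S3 !mB // /t; move: n1 n2 n3 n4.
  move: (r * w1 + s) (r * w2 + s) (r * w3 + s) (r * w4 + s) => x1 x2 x3 x4 n1 n2 n3 n4.
  by field; rewrite n1 n2 n3 n4.
by rewrite /j_relation e2 e3; ring.
Qed.

Lemma closed_separable_roots (k : closedFieldType) (h : {poly k}) :
  separable_poly h -> exists2 rs, uniq rs & h = lead_coef h *: \prod_(z <- rs) ('X - z%:P).
Proof.
move=> hsep; have [rs e] := closed_field_poly_normal h; exists rs => //.
have l0 : lead_coef h != 0 by rewrite lead_coef_eq0 separable_poly_neq0.
by move: hsep; rewrite e (eqp_separable (eqp_scale _ l0)) separable_prod_XsubC.
Qed.

Section IsoRelation.
Variables (K : fieldType) (k : closedFieldType) (iota : {rmorphism K -> k}).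
Variables (n : nat) (h h' : {poly K}).
Hypothesis n_gt1 : (1 < n)%N.
Hypothesis h_size : size h = n.*2.+1.
Hypothesis h_sep : separable_poly h.
Hypothesis h'_size : size h' = n.*2.+1.
Hypothesis h'_sep : separable_poly h'.
Hypothesis two0 : 2%:R != 0 :> k.
Local Notation hk := (map_poly iota h).
Local Notation hk' := (map_poly iota h').

Lemma iso_j_relation :
  isomorphic (base_change iota (model n h)) (base_change iota (model n h')) ->
  exists w1 w2 w3 w4 w1' w2' w3' w4', [/\ uniq [:: w1; w2; w3; w4],
    uniq [:: w1'; w2'; w3'; w4'], all (root hk) [:: w1; w2; w3; w4],
    all (root hk') [:: w1'; w2'; w3'; w4'] &
    j_relation (w1, w2, w3, w4) (w1', w2', w3', w4')].
Proof.
move=> iso.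
have n_gt0 : (0 < n)%N by exact: ltnW.
have sep : separable_poly hk by rewrite separable_map.
have sep' : separable_poly hk' by rewrite separable_map.
have sk : size hk = n.*2.+1 by rewrite size_map_poly.
have sk' : size hk' = n.*2.+1 by rewrite size_map_poly.
have s1 : (1 < size hk)%N by rewrite sk ltnS double_gt0.
have [F [f [x [y FF]]]] := function_field_exists sep s1.
have [u [v FF']] := iso_function_field n_gt0 h_size h'_size h'_sep two0 FF iso.
have [rs urs ers] := closed_separable_roots sep.
have l0 : lead_coef hk != 0 by rewrite lead_coef_eq0 separable_poly_neq0.
have srs : size rs = n.*2.
  by have := sk; rewrite ers size_scale // size_prod_XsubC => [[]].
have rootE z : z \in rs -> root hk z.
  by move=> hz; rewrite ers rootZ // root_prod_XsubC.
have : (4 <= size rs)%N by rewrite srs (leq_double 2).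
case: rs urs ers srs rootE => [|w1 [|w2 [|w3 [|w4 rs]]]] // urs ers srs rootE _.
have u4 : uniq [:: w1; w2; w3; w4].
  by move: urs; rewrite -[_ :: _]/([:: w1; w2; w3; w4] ++ rs) cat_uniq => /andP [].
have r4 : all (root hk) [:: w1; w2; w3; w4].
  by apply/allP => z hz; apply: rootE; move: hz; rewrite !inE => /or4P [] ->; rewrite ?orbT.
have [[p [q [r [s [det hm]]]]]|[n2 eID]] :=
  two_generators n_gt1 sk sk' sep sep' two0 FF FF'.
  pose m w := (p * w + q) / (r * w + s).
  move: (r4) => /and5P [r1 r2 r3 r'4 _].
  have [[n1 m1] [n2 m2]] := (hm _ r1, hm _ r2).
  have [[n3 m3] [n4 m4]] := (hm _ r3, hm _ r'4).
  have minj a b : r * a + s != 0 -> r * b + s != 0 -> m a = m b -> a = b.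
    move=> na nb /eqP; rewrite eqr_div // -subr_eq0 => /eqP e; apply/eqP.
    rewrite -subr_eq0; apply/eqP/(mulfI det); rewrite mulr0 -e; ring.
  exists w1, w2, w3, w4, (m w1), (m w2), (m w3), (m w4); split=> //.
  - move: u4; rewrite /= !inE !negb_or.
    move=> /and4P [/and3P [h12 h13 h14] /andP [h23 h24] h34 _].
    have mne a b : r * a + s != 0 -> r * b + s != 0 -> a != b -> m a != m b.
      by move=> na nb; apply: contraNneq => /minj ->.
    by rewrite !mne.
  - by rewrite /= m1 m2 m3 m4.
  - exact: moebius_j_relation.
have [rs' urs' ers'] := closed_separable_roots sep'.
have l0' : lead_coef hk' != 0 by rewrite lead_coef_eq0 separable_poly_neq0.
have srs' : size rs' = n.*2.
  by have := sk'; rewrite ers' size_scale // size_prod_XsubC => [[]].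
rewrite n2 in srs srs'.
case: rs urs ers srs rootE => // urs ers srs rootE.
case: rs' urs' ers' srs' => [|w1' [|w2' [|w3' [|w4' [|]]]]] // urs' ers' _.
exists w1, w2, w3, w4, w1', w2', w3', w4'; split=> //.
  apply/allP => z hz; by rewrite ers' rootZ // root_prod_XsubC.
move: eID; rewrite {1 2}ers {1 2}ers' !poly_I_roots !poly_D_roots /j_relation.
set l := lead_coef hk; set l' := lead_coef hk' => e.
apply: (mulfI (mulf_neq0 (expf_neq0 6 l0) (expf_neq0 6 l0'))); rewrite -/l -/l'.
move: e; move: (cross_S2 w1 w2 w3 w4) (cross_S2 w1' w2' w3' w4').
move: (cross_S3 w1 w2 w3 w4) (cross_S3 w1' w2' w3' w4') => s3 s3' s2 s2' e.
have -> : l ^+ 6 * l' ^+ 6 * (s2 ^+ 3 * s3' ^+ 2) =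
  - ((- l ^+ 2 * s2) ^+ 3 * (l' ^+ 6 * s3' ^+ 2)) by ring.
by rewrite e; ring.
Qed.

End IsoRelation.

(** * Generic parameters *)

Section Generic.
Variables (k : closedFieldType) (D : nat).
Implicit Types Phi Psi : 'rV[k]_D -> k.

(* Polynomial along every line: all that is needed to find points outside the
   zero locus, and stable under the constructions below without computing any
   multivariate polynomial. *)
Definition line_poly Phi :=
  forall z w, exists p : {poly k}, forall t, Phi (z + t *: w) = p.[t].

Definition generic Phi := line_poly Phi /\ exists z, Phi z != 0.

Lemma line_polyC c : line_poly (fun=> c).
Proof. by move=> z w; exists c%:P => t; rewrite hornerC. Qed.

Lemma line_poly_coord i : line_poly (fun z => z 0 i).
Proof.
by move=> z w; exists ((w 0 i) *: 'X + (z 0 i)%:P) => t; rewrite !mxE !hornerE addrC mulrC.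
Qed.

Lemma line_polyD Phi Psi : line_poly Phi -> line_poly Psi ->
  line_poly (fun z => Phi z + Psi z).
Proof.
move=> h1 h2 z w; have [p hp] := h1 z w; have [q hq] := h2 z w.
by exists (p + q) => t; rewrite hp hq hornerD.
Qed.

Lemma line_polyM Phi Psi : line_poly Phi -> line_poly Psi ->
  line_poly (fun z => Phi z * Psi z).
Proof.
move=> h1 h2 z w; have [p hp] := h1 z w; have [q hq] := h2 z w.
by exists (p * q) => t; rewrite hp hq hornerM.
Qed.

Lemma line_polyB Phi Psi : line_poly Phi -> line_poly Psi ->
  line_poly (fun z => Phi z - Psi z).
Proof.
move=> h1 h2 z w; have [p hp] := h1 z w; have [q hq] := h2 z w.
by exists (p - q) => t; rewrite hp hq hornerD hornerN.
Qed.

Lemma line_polyX Phi m : line_poly Phi -> line_poly (fun z => Phi z ^+ m).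
Proof.
move=> h1 z w; have [p hp] := h1 z w.
by exists (p ^+ m) => t; rewrite hp horner_exp.
Qed.

Lemma line_poly_meval N (P : {mpoly k[N]}) (G : 'I_N -> 'rV[k]_D -> k) :
  (forall i, line_poly (G i)) -> line_poly (fun z => P.@[fun i => G i z]).
Proof.
move=> hG z w; have [p hp] := fin_all_exists (fun i => hG i z w).
exists (mmap polyC p P) => t; rewrite -[RHS]/(horner_eval t _) rmorph_mmap.
by apply: eq_mmap => [c|i] /=; rewrite /horner_eval ?hornerC ?hp.
Qed.

Lemma genericM Phi Psi : generic Phi -> generic Psi -> generic (fun z => Phi z * Psi z).
Proof.
move=> [l1 [z1 n1]] [l2 [z2 n2]]; split; first exact: line_polyM.
have [p hp] := l1 z1 (z2 - z1); have [q hq] := l2 z1 (z2 - z1).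
have p0 : p != 0.
  by apply: contraNneq n1 => e; have := hp 0; rewrite scale0r addr0 e horner0 => ->.
have q0 : q != 0.
  apply: contraNneq n2 => e; have := hq 1.
  by rewrite scale1r addrC subrK e horner0 => ->.
have [t ht] := closed_neq0 (mulf_neq0 p0 q0).
by exists (z1 + t *: (z2 - z1)); rewrite hp hq -hornerM.
Qed.

Lemma generic_prod I (r : seq I) (P : pred I) (G : I -> 'rV[k]_D -> k) :
  (forall i, P i -> generic (G i)) -> generic (fun z => \prod_(i <- r | P i) G i z).
Proof.
move=> hG; elim: r => [|i r IH].
  split; last by exists 0; rewrite big_nil oner_neq0.
  by move=> z w; exists 1 => t; rewrite big_nil hornerC.
case: IH => l1 [z1 n1]; have [Pi|Pi] := boolP (P i); last first.
  split; last by exists z1; rewrite big_cons (negbTE Pi).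
  by move=> z w; have [p hp] := l1 z w; exists p => t; rewrite big_cons (negbTE Pi) hp.
have [l2 [z2 n2]] : generic (fun z => G i z * \prod_(j <- r | P j) G j z).
  by apply: genericM; [exact: hG|split; last exists z1].
split; last by exists z2; rewrite big_cons Pi.
by move=> z w; have [p hp] := l2 z w; exists p => t; rewrite big_cons Pi hp.
Qed.

End Generic.

Section RationalPoint.
Variables (K : fieldType) (k : closedFieldType) (iota : {rmorphism K -> k}).
Hypothesis K_infinite : forall s : seq K, exists x : K, x \notin s.

Lemma infinite_nonroot (p : {poly k}) : p != 0 -> exists c : K, p.[iota c] != 0.
Proof.
move=> p0.
have [s us ss] : exists2 s : seq K, uniq s & size s = size p.
  elim: (size p) => [|m [s us ss]]; first by exists [::].
  by have [x xs] := K_infinite s; exists (x :: s); rewrite /= ?xs ?ss.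
have [/allP H|/allPn [x _ hx]] := boolP (all (fun c => root p (iota c)) s); last first.
  by exists x.
have : (size (map iota s) < size p)%N.
  apply: max_poly_roots => //; last by rewrite map_inj_uniq //; exact: fmorph_inj.
  by apply/allP => _ /mapP [c cs ->]; exact: H.
by rewrite size_map ss ltnn.
Qed.

Lemma generic_rational D (Phi : 'rV[k]_D -> k) (B : 'M[k]_D) :
  B \in unitmx -> generic Phi ->
  exists c : 'rV[K]_D, Phi (map_mx iota c *m B) != 0.
Proof.
move=> uB [lin [z0 n0]].
have key j : (j <= D)%N -> exists a : 'rV[k]_D, Phi (a *m B) != 0 /\
    forall i : 'I_D, (i < j)%N -> exists c : K, a 0 i = iota c.
  elim: j => [|j IH] hj.
    by exists (z0 *m invmx B); split=> //; rewrite mulmxKV.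
  have [a [na hc]] := IH (ltnW hj); pose oj := Ordinal hj.
  have [p hp] := lin (a *m B) (delta_mx 0 oj *m B).
  have p0 : p != 0.
    by apply: contraNneq na => e; have := hp 0; rewrite scale0r addr0 e horner0 => ->.
  have q0 : p \Po ('X - (a 0 oj)%:P) != 0.
    by rewrite -size_poly_eq0 size_comp_poly2 ?size_XsubC // size_poly_eq0.
  have [c] := infinite_nonroot q0; rewrite horner_comp !hornerE => nc.
  exists (a + (iota c - a 0 oj) *: delta_mx 0 oj); split.
    by rewrite mulmxDl -scalemxAl hp.
  move=> i; rewrite ltnS leq_eqVlt => /orP [/eqP ei|li].
    have -> : i = oj by apply/val_inj.
    by exists c; rewrite !mxE !eqxx mulr1 addrC subrK.
  have [c' ec] := hc i li; exists c'; rewrite !mxE ec eqxx /=.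
  have -> : (i == oj) = false by apply/eqP => e; move: li; rewrite e ltnn.
  by rewrite mulr0 addr0.
have [a [na hc]] := key D (leqnn D).
have [c ec] := fin_all_exists (fun i => hc i (ltn_ord i)).
exists (\row_i c i); rewrite (_ : map_mx _ _ = a) //.
by apply/rowP => i; rewrite !mxE ec.
Qed.

End RationalPoint.

(* hf stands for 1/2, which has to be a parameter since R need not be a field. *)
Section SquareRoot.

Fixpoint poly_sqrt (R : comNzRingType) (hf : R) (m : nat) (P : {poly R}) (j : nat) :
    {poly R} :=
  if j is j'.+1 then
    let Q := poly_sqrt hf m P j' in
    Q + (hf * (P - Q ^+ 2)`_(m.*2 - j)) *: 'X^(m - j)
  else 'X^m.

Definition sqrt_rem (R : comNzRingType) (hf : R) m (P : {poly R}) :=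
  poly_sqrt hf m P m ^+ 2 - P.

Lemma poly_sqrt_map (R S : comNzRingType) (f : {rmorphism R -> S}) hf m P j :
  map_poly f (poly_sqrt hf m P j) = poly_sqrt (f hf) m (map_poly f P) j.
Proof.
elim: j => [|j IH] /=; first by rewrite map_polyXn.
by rewrite rmorphD /= IH map_polyZ map_polyXn rmorphM /= -coef_map rmorphB /= rmorphXn /= IH.
Qed.

Lemma sqrt_rem_map (R S : comNzRingType) (f : {rmorphism R -> S}) hf m P :
  map_poly f (sqrt_rem hf m P) = sqrt_rem (f hf) m (map_poly f P).
Proof. by rewrite /sqrt_rem rmorphB rmorphXn /= poly_sqrt_map. Qed.

Lemma poly_sqrtP (R : comNzRingType) (hf : R) m (P : {poly R}) j :
  2%:R * hf = 1 -> P \is monic -> size P = m.*2.+1 -> (j <= m)%N ->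
  [/\ poly_sqrt hf m P j \is monic, size (poly_sqrt hf m P j) = m.+1 &
      (size (P - poly_sqrt hf m P j ^+ 2)%R <= m.*2 - j)%N].
Proof.
move=> hhf mP sP; elim: j => [|j IH] hj.
  rewrite /= monicXn size_polyXn subn0; split=> //.
  apply/leq_sizeP => i hi; rewrite -exprM muln2 coefB coefXn.
  have [->|ni] := eqVneq i m.*2.
    by move/monicP: mP; rewrite lead_coefE sP /= => ->; rewrite subrr.
  by rewrite nth_default ?subr0 // sP ltn_neqAle eq_sym ni.
have [mQ sQ sR] := IH (ltnW hj); rewrite /=.
set Q := poly_sqrt hf m P j in mQ sQ sR *.
set c := (P - Q ^+ 2)`_(m.*2 - j.+1).
have slow : (size ((hf * c) *: 'X^(m - j.+1))%R < size Q)%N.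
  apply: leq_ltn_trans (size_scale_leq _ _) _; rewrite size_polyXn sQ ltnS; lia.
have sQ' : size (Q + (hf * c) *: 'X^(m - j.+1)) = m.+1 by rewrite size_polyDl.
split=> //; first by rewrite monicE lead_coefDl // -monicE.
have -> : P - (Q + (hf * c) *: 'X^(m - j.+1)) ^+ 2 =
  P - Q ^+ 2 - c *: ('X^(m - j.+1) * Q) - (hf * c) ^+ 2 *: 'X^(m - j.+1) ^+ 2.
  rewrite -!mul_polyC.
  have -> : c%:P = (2%:R * hf * c)%:P by rewrite hhf mul1r.
  by rewrite ?polyC_exp !polyCM !polyC_natr; ring.
apply/leq_sizeP => i hi; rewrite coefB coefB coefZ coefXnM coefZ -exprM coefXn.
have -> : (i == (m - j.+1) * 2)%N = false by lia.
rewrite mulr0 subr0; have -> : (i < m - j.+1)%N = false by lia.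
have [->|ni] := eqVneq i (m.*2 - j.+1)%N.
  have -> : (m.*2 - j.+1 - (m - j.+1) = m)%N by lia.
  by move/monicP: mQ; rewrite lead_coefE sQ /= => ->; rewrite mulr1 subrr.
rewrite nth_default; last by apply: leq_trans sR _; lia.
by rewrite [Q`__]nth_default ?mulr0 ?subr0 // sQ; lia.
Qed.

Lemma sqrt_remP (R : comNzRingType) (hf : R) m (P : {poly R}) :
  2%:R * hf = 1 -> P \is monic -> size P = m.*2.+1 ->
  [/\ poly_sqrt hf m P m \is monic, size (poly_sqrt hf m P m) = m.+1,
     (size (sqrt_rem hf m P) <= m)%N & P = poly_sqrt hf m P m ^+ 2 - sqrt_rem hf m P].
Proof.
move=> hhf mP sP; have [mQ sQ sR] := poly_sqrtP hhf mP sP (leqnn m).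
split=> //; last by rewrite /sqrt_rem subKr.
by rewrite /sqrt_rem -opprB size_polyN; apply: leq_trans sR _; lia.
Qed.

Lemma sqrt_rem_unique (F : fieldType) m (P q h : {poly F}) :
  2%:R != 0 :> F -> q \is monic -> size q = m.+1 -> (size h <= m)%N ->
  P = q ^+ 2 - h -> sqrt_rem 2%:R^-1 m P = h.
Proof.
move=> two0 mq sq sh eP.
have hhf : 2%:R * 2%:R^-1 = 1 :> F by rewrite divff.
have lt : (size (- h) < size (q ^+ 2))%N.
  rewrite size_polyN expr2 size_Mmonic ?monic_neq0 // sq.
  by apply: leq_ltn_trans sh _; rewrite addSn /= addnS ltnS leq_addr.
have mP : P \is monic by rewrite eP monicE lead_coefDl // -monicE monic_exp.
have sP : size P = m.*2.+1.
  by rewrite eP size_polyDl // expr2 size_Mmonic ?monic_neq0 // sq addSn /= addnS addnn.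
have [mQ sQ sR e] := sqrt_remP hhf mP sP.
move: mQ sQ sR e; set Q := poly_sqrt _ _ _ _; set r := sqrt_rem _ _ _ => mQ sQ sR e.
have e2 : (Q - q) * (Q + q) = r - h.
  have -> : r = Q ^+ 2 - P by rewrite e subKr.
  by rewrite eP; ring.
have sQq : size (Q + q) = m.+1.
  apply/eqP; rewrite eqn_leq; apply/andP; split.
    by rewrite (leq_trans (size_polyD _ _)) // sQ sq maxnn.
  rewrite ltnNge; apply/negP => /leq_sizeP /(_ m (leqnn m)); rewrite coefD.
  move/monicP: mQ; rewrite lead_coefE sQ /= => ->.
  move/monicP: mq; rewrite lead_coefE sq /= => -> /eqP.
  by rewrite (negbTE two0).
have [Qq|Qq] := eqVneq (Q - q) 0.
  by move: e2; rewrite Qq mul0r => /esym/eqP; rewrite subr_eq0 => /eqP.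
have n0 : Q + q != 0 by rewrite -size_poly_eq0 sQq.
have : (size ((Q - q) * (Q + q))%R <= m)%N.
  by rewrite e2 (leq_trans (size_polyD _ _)) // geq_max size_polyN sR.
rewrite size_mul // sQq addnS /= => hle; exfalso.
by move: hle; rewrite -{2}(add0n m) leq_add2r leqn0 size_poly_eq0 (negbTE Qq).
Qed.

End SquareRoot.

Definition j_avoid (R : comNzRingType) (c w1 w2 w3 w4 : R) : R :=
  cross_S2 w1 w2 w3 w4 ^+ 3 - c * cross_S3 w1 w2 w3 w4 ^+ 2.

Lemma rmorph_j_avoid (R S : comNzRingType) (f : {rmorphism R -> S}) c w1 w2 w3 w4 :
  f (j_avoid c w1 w2 w3 w4) = j_avoid (f c) (f w1) (f w2) (f w3) (f w4).
Proof.
by rewrite /j_avoid /cross_S2 /cross_S3 !(rmorphB, rmorphD, rmorphM, rmorphXn).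
Qed.

Lemma j_avoid_scale (R : comNzRingType) (l c w1 w2 w3 w4 : R) :
  j_avoid c (l * w1) (l * w2) (l * w3) (l * w4) = l ^+ 12 * j_avoid c w1 w2 w3 w4.
Proof. by rewrite /j_avoid /cross_S2 /cross_S3; ring. Qed.

Section AvoidPoly.
Variables (k : closedFieldType) (N : nat) (cs : seq k).

Let quadruple : finType := ('I_N * 'I_N * 'I_N * 'I_N)%type.
Definition distinct4 (q : quadruple) :=
  let: (i1, i2, i3, i4) := q in uniq [:: i1; i2; i3; i4].

Definition avoid_poly : {mpoly k[N]} :=
  (\prod_(p : 'I_N * 'I_N | p.1 != p.2) ('X_p.1 - 'X_p.2)) *
  \prod_(q : quadruple | distinct4 q) \prod_(c <- cs)
     let: (i1, i2, i3, i4) := q in j_avoid c%:MP 'X_i1 'X_i2 'X_i3 'X_i4.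

Lemma avoid_poly_eval (w : 'I_N -> k) : avoid_poly.@[w] =
  (\prod_(p : 'I_N * 'I_N | p.1 != p.2) (w p.1 - w p.2)) *
  \prod_(q : quadruple | distinct4 q) \prod_(c <- cs)
     let: (i1, i2, i3, i4) := q in j_avoid c (w i1) (w i2) (w i3) (w i4).
Proof.
rewrite mevalM !rmorph_prod; congr (_ * _).
  by apply: eq_bigr => p _; rewrite rmorphB /= !mevalXU.
apply: eq_bigr => [[[[i1 i2] i3] i4]] _; rewrite rmorph_prod.
by apply: eq_bigr => c _; rewrite rmorph_j_avoid /= mevalC !mevalXU.
Qed.

Lemma avoid_poly_sym : avoid_poly \is symmetric.
Proof.
apply/issymP => s; rewrite /avoid_poly.
have sX i : msym s 'X_i = 'X_(s i) :> {mpoly k[N]} by rewrite /msym mmapX mmap1U.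
have sC c : msym s c%:MP = c%:MP :> {mpoly k[N]} by rewrite /msym mmapC.
rewrite rmorphM !rmorph_prod; congr (_ * _).
  rewrite [RHS](reindex_inj (h := fun p : 'I_N * 'I_N => (s p.1, s p.2))) /=; last first.
    by move=> [a b] [a' b'] [/perm_inj -> /perm_inj ->].
  apply: eq_big => [p|p _]; first by rewrite (inj_eq perm_inj).
  by rewrite rmorphB /= !sX.
rewrite [RHS](reindex_inj (h := fun q : quadruple =>
  let: (i1, i2, i3, i4) := q in (s i1, s i2, s i3, s i4))) /=; last first.
  move=> [[[a b] c] d] [[[a' b'] c'] d'].
  by move=> [/perm_inj -> /perm_inj -> /perm_inj -> /perm_inj ->].
apply: eq_big => [[[[i1 i2] i3] i4]|[[[i1 i2] i3] i4] _].
  by apply/esym; exact: (map_inj_uniq (@perm_inj _ s) [:: i1; i2; i3; i4]).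
rewrite rmorph_prod; apply: eq_bigr => c _.
by rewrite rmorph_j_avoid /= !sX sC.
Qed.

Lemma avoid_poly_nonzero : exists w : 'rV[k]_N, avoid_poly.@[w 0] != 0.
Proof.
suff [_ [w hw]] : generic (fun w : 'rV[k]_N => avoid_poly.@[w 0]) by exists w.
suff [h1 h2] : generic (fun w : 'rV[k]_N =>
  (\prod_(p : 'I_N * 'I_N | p.1 != p.2) (w 0 p.1 - w 0 p.2)) *
  \prod_(q : quadruple | distinct4 q) \prod_(c <- cs)
     let: (i1, i2, i3, i4) := q in j_avoid c (w 0 i1) (w 0 i2) (w 0 i3) (w 0 i4)).
  split; last by have [w hw] := h2; exists w; rewrite avoid_poly_eval.
  by move=> z w; have [p hp] := h1 z w; exists p => t; rewrite avoid_poly_eval hp.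
have coord i := @line_poly_coord k N i.
apply: genericM.
  apply: generic_prod => -[i j] /= ij; split; first exact: line_polyB.
  exists (delta_mx 0 i); rewrite !mxE !eqxx /= [j == i]eq_sym (negbTE ij) subr0.
  exact: oner_neq0.
apply: generic_prod => -[[[i1 i2] i3] i4] uq; apply: generic_prod => c _; split.
  rewrite /j_avoid /cross_S2 /cross_S3.
  apply: line_polyB; last apply: line_polyM; first last.
  - by apply: line_polyX; do !apply: line_polyM; apply: line_polyB.
  - exact: line_polyC.
  - apply: line_polyX; do !apply: line_polyD.
    + by do !apply: line_polyM; apply: line_polyB.
    + by do !apply: line_polyM; apply: line_polyB.
    + by do !apply: line_polyM; apply: line_polyB.
exists (\row_x if (x == i3) || (x == i4) then 1 else 0).
move: uq; rewrite /= !inE !negb_or.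
move=> /and4P [/and3P [h12 h13 h14] /andP [h23 h24] h34 _].
rewrite !mxE (negbTE h13) (negbTE h14) (negbTE h23) (negbTE h24) !eqxx orbT /=.
rewrite /j_avoid /cross_S2 /cross_S3.
rewrite (_ : _ - _ = - 1); last by ring.
by rewrite oppr_eq0 oner_neq0.
Qed.

(* Up to the factor h`_N, avoid_poly at the roots of h scaled by h`_N: this
   scaling makes it polynomial in the coefficients of h. *)
Definition avoid (h : {poly k}) : k := h`_N *
  (symf avoid_poly).@[fun i : 'I_N => (-1) ^+ i.+1 * (h`_(N - i.+1) * h`_N ^+ i)].

Lemma coef_prod_scale (l : k) (rs : seq k) j :
  (\prod_(z <- [seq l * w | w <- rs]) ('X - z%:P))`_j * l ^+ j =
  l ^+ size rs * (\prod_(z <- rs) ('X - z%:P))`_j.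
Proof.
elim: rs j => [|w rs IH] j.
  by rewrite /= !big_nil coefC; case: j => [|j] /=; rewrite ?mulr1 ?mul0r ?mulr0.
rewrite /= !big_cons !mulrBl !coefB !coefXM !coefCM exprS.
case: j => [|j] /=.
  by rewrite -mulrA !sub0r mulr1 -[X in l * w * X]mulr1 -(expr0 l) IH; ring.
have e1 := IH j; have e2 := IH j.+1.
move: e1 e2; rewrite exprS; set p1 := _`_j; set p2 := _`_j.+1 => e1 e2.
have -> : (p1 - l * w * p2) * (l * l ^+ j) = l * (p1 * l ^+ j) - l * w * (p2 * (l * l ^+ j)) by ring.
by rewrite e1 e2; ring.
Qed.

Lemma avoidE (l : k) (ws : N.-tuple k) : l != 0 ->
  avoid (l *: \prod_(z <- ws) ('X - z%:P)) = l * avoid_poly.@[fun i => l * tnth ws i].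
Proof.
move=> l0; have lN : (l *: \prod_(z <- ws) ('X - z%:P))`_N = l.
  have := lead_coefE (\prod_(z <- ws) ('X - z%:P)).
  rewrite size_prod_XsubC size_tuple /= coefZ => <-.
  by rewrite (monicP (monic_prod_XsubC _ _ _)) mulr1.
rewrite /avoid lN; congr (_ * _).
pose cs' := [tuple of [seq l * w | w <- ws]].
have -> : avoid_poly.@[fun i => l * tnth ws i] = avoid_poly.@[tnth cs'].
  by apply: meval_eq => i; rewrite tnth_map.
rewrite {2}(symfP avoid_poly_sym) comp_mpoly_meval; apply: meval_eq => i.
rewrite tnth_mktuple.
have hi : (i.+1 < N.+1)%N by rewrite ltnS.
have := mroots_coeff cs' (Ordinal hi) => /= e.
have -> : (mesym N k i.+1).@[tnth cs'] = (-1) ^+ i.+1 *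
    (\prod_(c <- [seq l * w | w <- ws]) ('X - c%:P))`_(N - i.+1).
  by rewrite e mulrA -expr2 sqrr_sign mul1r.
rewrite coefZ; congr (_ * _).
apply: (mulIf (expf_neq0 (N - i.+1) l0)); rewrite coef_prod_scale size_tuple.
have -> : l ^+ N = l * l ^+ i * l ^+ (N - i.+1).
  by rewrite -exprS -exprD subnKC.
by ring.
Qed.

Lemma avoidP (h : {poly k}) : (size h <= N.+1)%N -> avoid h != 0 ->
  [/\ size h = N.+1, separable_poly h &
    forall w1 w2 w3 w4 c, uniq [:: w1; w2; w3; w4] ->
      all (root h) [:: w1; w2; w3; w4] -> c \in cs -> j_avoid c w1 w2 w3 w4 != 0].
Proof.
move=> sh hav; have l0 : h`_N != 0.
  by apply: contraNneq hav => e; rewrite /avoid e mul0r.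
have sN : size h = N.+1.
  by apply/eqP; rewrite eqn_leq sh ltnNge; apply/negP => /leq_sizeP /(_ N (leqnn N)) e; rewrite e eqxx in l0.
have el : lead_coef h = h`_N by rewrite lead_coefE sN.
have [rs ers] := closed_field_poly_normal h; rewrite el in ers.
have srs : size rs == N.
  by have := sN; rewrite ers size_scale // size_prod_XsubC => [[->]].
pose ws := Tuple srs.
have ers' : h = h`_N *: \prod_(z <- ws) ('X - z%:P) by exact: ers.
move: hav; rewrite ers' avoidE // avoid_poly_eval !mulf_eq0 !negb_or -ers'.
move=> /and3P [_ n1 n2].
have inj : injective (tnth ws).
  move=> i j e; apply/eqP; apply: contraNT n1 => ij.
  by rewrite (bigD1 (i, j)) //= e subrr mul0r.
split=> //.
  rewrite ers' (eqp_separable (eqp_scale _ l0)) separable_prod_XsubC.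
  exact/tuple_uniqP.
move=> w1 w2 w3 w4 c uw /and5P [r1 r2 r3 r4 _] cin.
have idx w : root h w -> exists i, w = tnth ws i.
  by rewrite {1}ers' rootZ // root_prod_XsubC => /tnthP.
have [[i1 e1] [i2 e2]] := (idx _ r1, idx _ r2).
have [[i3 e3] [i4 e4]] := (idx _ r3, idx _ r4).
have uq : distinct4 (i1, i2, i3, i4).
  by rewrite /distinct4 -(map_inj_uniq inj) /= -e1 -e2 -e3 -e4.
move: n2; rewrite (bigD1 _ uq) /= mulf_eq0 negb_or => /andP [+ _].
rewrite (big_rem _ cin) /= mulf_eq0 negb_or => /andP [+ _].
by rewrite j_avoid_scale -e1 -e2 -e3 -e4 mulf_eq0 negb_or => /andP [].
Qed.

End AvoidPoly.

Section Family.
Variables (k : closedFieldType) (m D : nat).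
Hypothesis D_eq : D = m.*2.
Hypothesis two0 : 2%:R != 0 :> k.

Definition root_poly (z : 'rV[k]_D) : {poly k} := \prod_i ('X - (z 0 i)%:P).
Definition rem_poly (z : 'rV[k]_D) : {poly k} := sqrt_rem 2%:R^-1 m (root_poly z).

Lemma rem_poly_coef i : line_poly (fun z => (rem_poly z)`_i).
Proof.
move=> z w.
pose P : {poly {poly k}} := \prod_i ('X - ((z 0 i)%:P + (w 0 i) *: 'X)%:P).
have eP t : map_poly (horner_eval t) P = root_poly (z + t *: w).
  rewrite rmorph_prod; apply: eq_bigr => j _.
  rewrite rmorphB /= map_polyX map_polyC /= !mxE /horner_eval !hornerE.
  by rewrite [t * _]mulrC.
exists (sqrt_rem (2%:R^-1)%:P m P)`_i => t.
rewrite -[RHS]/(horner_eval t _) -coef_map sqrt_rem_map eP.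
by rewrite /rem_poly /= /horner_eval hornerC.
Qed.

Lemma root_poly_monic z : root_poly z \is monic.
Proof. exact: monic_prod_XsubC. Qed.

Lemma root_poly_size z : size (root_poly z) = D.+1.
Proof. by rewrite size_prod_XsubC /index_enum -enumT size_enum_ord. Qed.

Lemma rem_poly_size z : (size (rem_poly z) <= m)%N.
Proof.
have hhf : 2%:R * 2%:R^-1 = 1 :> k by rewrite divff.
by have [] := sqrt_remP hhf (root_poly_monic z) (etrans (root_poly_size z) (congr1 S D_eq)).
Qed.

Lemma root_poly_surj (P : {poly k}) (i j : 'I_D) a b : i != j ->
  P \is monic -> size P = D.+1 -> ('X - a%:P) * ('X - b%:P) %| P ->
  exists z, [/\ root_poly z = P, z 0 i = a & z 0 j = b].
Proof.
move=> ij mP sP /dvdpP [G eP].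
have mab : ('X - a%:P) * ('X - b%:P) \is monic by rewrite monicMr monicXsubC.
have mG : G \is monic by rewrite -(monicMr G mab) -eP.
have [rs ers] := closed_field_poly_normal G.
rewrite (monicP mG) scale1r in ers.
have srs : size [:: a, b & rs] == D.
  have := sP; rewrite eP ers size_mul ?monic_neq0 ?monic_prod_XsubC //.
  rewrite size_mul ?polyXsubC_eq0 // !size_XsubC size_prod_XsubC /= => e.
  by move: e; rewrite addnS /= addn2 => [[<-]].
pose t := Tuple srs.
have D2 : (1 < D)%N by rewrite -(eqP srs).
pose o0 := Ordinal (ltnW D2); pose o1 := Ordinal D2.
pose s := (tperm i o0 * tperm (tperm i o0 j) o1)%g.
have si : s i = o0.
  rewrite permM tpermL tpermD //; apply/eqP.
    by move=> e; move: ij; rewrite -(inj_eq (@perm_inj _ (tperm i o0))) tpermL e eqxx.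
have sj : s j = o1 by rewrite permM tpermL.
exists (\row_x tnth t (s x)); split.
- rewrite /root_poly; under eq_bigr => x _ do rewrite mxE.
  transitivity (\prod_x ('X - (tnth t x)%:P)).
    by rewrite [RHS](reindex_inj (@perm_inj _ s)).
  rewrite -(big_tuple _ _ t xpredT (fun z => 'X - z%:P)) /= !big_cons eP ers.
  by rewrite mulrA mulrC.
- by rewrite mxE si.
- by rewrite mxE sj.
Qed.

Lemma rem_poly_surj (q h : {poly k}) (i j : 'I_D) a b : i != j ->
  q \is monic -> size q = m.+1 -> (size h <= m)%N ->
  ('X - a%:P) * ('X - b%:P) %| q ^+ 2 - h ->
  exists z, [/\ rem_poly z = h, z 0 i = a & z 0 j = b].
Proof.
move=> ij mq sq sh dv.
have lt : (size (- h) < size (q ^+ 2))%N.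
  rewrite size_polyN expr2 size_Mmonic ?monic_neq0 // sq.
  by apply: leq_ltn_trans sh _; rewrite addSn /= addnS ltnS leq_addr.
have mP : q ^+ 2 - h \is monic by rewrite monicE lead_coefDl // -monicE monic_exp.
have sP : size (q ^+ 2 - h) = D.+1.
  by rewrite size_polyDl // expr2 size_Mmonic ?monic_neq0 // sq addSn /= addnS addnn D_eq.
have [z [ez zi zj]] := root_poly_surj ij mP sP dv.
by exists z; split=> //; rewrite /rem_poly ez; exact: (sqrt_rem_unique (q := q)).
Qed.

Lemma rem_poly_onto (h : {poly k}) : (0 < m)%N -> (size h <= m)%N ->
  exists z, rem_poly z = h.
Proof.
move=> m0 sh.
have D2 : (1 < D)%N by rewrite D_eq (leq_double 1).
pose o0 := Ordinal (ltnW D2); pose o1 := Ordinal D2.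
have [rs ers] := closed_field_poly_normal ('X^m ^+ 2 - h).
have lt : (size (- h) < size ('X^m ^+ 2 : {poly k}))%N.
  rewrite size_polyN -exprM size_polyXn ltnS; apply: leq_trans sh _; lia.
have l0 : lead_coef ('X^m ^+ 2 - h) != 0.
  by rewrite lead_coefDl // -exprM lead_coefXn oner_neq0.
have : size rs = D.
  have : size ('X^m ^+ 2 - h) = D.+1 by rewrite size_polyDl // -exprM size_polyXn muln2 D_eq.
  by rewrite ers size_scale // size_prod_XsubC => [[]].
move=> srs; have : (1 < size rs)%N by rewrite srs.
case: rs ers srs => [|a [|b rs]] ers srs // _.
have [|||||z [ez _ _]] := @rem_poly_surj 'X^m h o0 o1 a b; last by exists z.
- by [].
- exact: monicXn.
- by rewrite size_polyXn.
- exact: sh.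
by rewrite ers dvdpZr // !big_cons mulrA dvdp_mulr.
Qed.

End Family.

Section Conjugates.
Variables (K : fieldType) (k : closedFieldType) (iota : {rmorphism K -> k}).
Variables (d : nat) (L : fieldExtType K).
Hypothesis L_sep : separable 1%VS {:L}.
Hypothesis L_dim : \dim {:L} = d.

Local Notation "A @L" := (map_poly (in_alg L) A) (at level 9).
Local Notation "A @k" := (map_poly iota A) (at level 9).

(* ts lists the conjugates in k of the primitive element theta. *)
Definition conjugate_family (theta : L) (ts : 'rV[k]_d) :=
  [/\ injective (ts 0), forall A, A@L.[theta] = 0 -> forall i, A@k.[ts 0 i] = 0
    & forall a : L, exists A, a = A@L.[theta]].

Lemma conjugates_exist : exists theta ts, conjugate_family theta ts.
Proof.
pose theta := separable_generator (1%AS : {subfield L}) {:L}%AS.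
have gen : {:L}%VS = <<1; theta>>%VS.
  by have := eq_adjoin_separable_generator (K := 1%AS) (E := {:L}%AS) L_sep (sub1v _).
have [mu emu] := polyOver1P (minPolyOver 1%AS theta).
have smu : size mu = d.+1.
  rewrite -(size_map_poly (in_alg L)) -emu size_minPoly.
  by have := dim_Fadjoin 1%AS theta; rewrite -gen L_dim dimv1 muln1 => ->.
have sep : separable_poly mu@k.
  rewrite separable_map -(separable_map (in_alg L)) -emu.
  exact: separable_generatorP.
have [rs urs ers] := closed_separable_roots sep.
have l0 : lead_coef mu@k != 0 by rewrite lead_coef_eq0 separable_poly_neq0.
have srs : size rs = d.
  have : size mu@k = d.+1 by rewrite size_map_poly.
  by rewrite ers size_scale // size_prod_XsubC => [[]].
exists theta, (\row_i rs`_i); split.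
- move=> i j; rewrite !mxE => /eqP; rewrite nth_uniq ?srs //.
  by move=> /eqP e; apply: val_inj.
- move=> A hA i.
  have : minPoly 1%AS theta %| A@L.
    by apply: minPoly_dvdp; [apply/polyOver1P; exists A|apply/rootP].
  rewrite emu dvdp_map -(dvdp_map iota) => dv.
  apply/rootP; rewrite -dvdp_XsubCl; apply: dvdp_trans dv.
  by rewrite dvdp_XsubCl ers rootZ // root_prod_XsubC mxE mem_nth ?srs.
- move=> a; have : a \in <<1; theta>>%VS by rewrite -gen memvf.
  by case/Fadjoin_polyP => p /polyOver1P [A ->] ->; exists A.
Qed.

Variables (theta : L) (ts : 'rV[k]_d).
Hypothesis conj : conjugate_family theta ts.

Lemma conj_values (A : {poly K}) (s : 'I_d -> k) :
  injective s -> (size A <= d)%N -> (forall i, A@k.[s i] = 0) -> A = 0.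
Proof.
move=> inj sA hA; apply/eqP; apply: contraT => A0.
have : (size (codom s) < size A@k)%N.
  apply: max_poly_roots; first by rewrite map_poly_eq0.
    by apply/allP => _ /codomP [i ->]; apply/rootP.
  by rewrite map_inj_uniq // enum_uniq.
by rewrite size_codom card_ord size_map_poly ltnNge sA.
Qed.

Lemma generator_of_conjugates (B : {poly K}) :
  injective (fun i => B@k.[ts 0 i]) ->
  (forall M : {subfield L}, B@L.[theta] \in M -> M = fullv :> {vspace L}) /\
  exists f : {poly K}, [/\ f \is monic, size f = d.+1, f@L.[B@L.[theta]] = 0 &
    f@k = \prod_i ('X - (B@k.[ts 0 i])%:P)].
Proof.
move=> inj; have [_ hconj _] := conj; set c := B@L.[theta].
have [f ef] := polyOver1P (minPolyOver 1%AS c).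
have mf : f \is monic by rewrite -(map_monic (in_alg L)) -ef monic_minPoly.
have fc : f@L.[c] = 0 by apply/rootP; rewrite -ef; exact: root_minPoly.
have fk i : f@k.[B@k.[ts 0 i]] = 0.
  have := hconj (f \Po B); rewrite !map_comp_poly !horner_comp => /(_ fc i).
  by rewrite horner_comp.
have sf : size f = (\dim <<1; c>>%VS).+1.
  rewrite -(size_map_poly (in_alg L)) -ef size_minPoly.
  by rewrite dim_Fadjoin dimv1 muln1.
have dc : \dim <<1; c>>%VS = d.
  apply/eqP; rewrite eqn_leq -{1}L_dim dimvS ?subvf //=.
  rewrite leqNgt; apply/negP => lt.
  have f0 : f = 0 by apply: conj_values inj _ fk; rewrite sf.
  by move: sf; rewrite f0 size_poly0.
split.
  move=> M cM; apply/eqP; rewrite eqEsubv subvf /=.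
  have -> : fullv = <<1; c>>%VS :> {vspace L}.
    by apply/esym/eqP; rewrite eqEdim subvf dc L_dim /=.
  by apply/(FadjoinP (K := 1%AS)); rewrite sub1v.
exists f; split; rewrite ?sf ?dc //.
have := @all_roots_prod_XsubC _ f@k (codom (fun i => B@k.[ts 0 i])).
rewrite size_map_poly sf dc size_codom card_ord => /(_ erefl) ->.
- rewrite lead_coef_map (monicP mf) rmorph1 scale1r codomE big_map.
  by rewrite /index_enum -enumT.
- by apply/allP => _ /codomP [i ->]; apply/rootP.
- by rewrite uniq_rootsE map_inj_uniq // enum_uniq.
Qed.

Hypothesis K_infinite : forall s : seq K, exists x : K, x \notin s.

Lemma generic_conjugates e (Phi : 'rV[k]_(d + e) -> k) : generic Phi ->
  exists (A : {poly K}) (c : 'rV[K]_e),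
    Phi (row_mx (\row_i A@k.[ts 0 i]) (map_mx iota c)) != 0.
Proof.
move=> gPhi; have [inj _ _] := conj.
pose V : 'M[k]_d := Vandermonde d ts.
have uV : V \in unitmx.
  rewrite unitmxE det_Vandermonde unitfE.
  apply/prodf_neq0 => i _; apply/prodf_neq0 => j ij.
  by rewrite subr_eq0 (inj_eq inj) -val_eqE /= gtn_eqF.
have uB : block_mx V 0 0 (1%:M : 'M[k]_e) \in unitmx.
  by rewrite unitmxE det_ublock det1 mulr1 -unitmxE.
have [c hc] := generic_rational iota K_infinite uB gPhi.
exists (rVpoly (lsubmx c)), (rsubmx c); move: hc.
rewrite -{1}[c]hsubmxK map_row_mx mul_row_block !mulmx0 mulmx1 addr0 add0r.
rewrite (_ : _ *m V = \row_i (rVpoly (lsubmx c))@k.[ts 0 i]) //.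
apply/rowP => j; rewrite !mxE (@horner_coef_wide _ d); last first.
  by rewrite size_map_poly size_poly.
by apply: eq_bigr => i _; rewrite coef_map /= coef_rVpoly_ord !mxE.
Qed.

Hypothesis two0 : 2%:R != 0 :> K.

Lemma family_member n m e (cs : seq k) (Phi : 'rV[k]_(d + e) -> k) :
  m = n.*2.+1 -> (d + e = m.*2)%N -> generic Phi ->
  exists (A h q : {poly K}) (c : 'rV[K]_e),
    let z := row_mx (\row_i A@k.[ts 0 i]) (map_mx iota c) in
    [/\ [/\ size h = n.*2.+1, separable_poly h & forall w1 w2 w3 w4 a,
          uniq [:: w1; w2; w3; w4] -> all (root h@k) [:: w1; w2; w3; w4] ->
          a \in cs -> j_avoid a w1 w2 w3 w4 != 0],
        injective (fun i => A@k.[ts 0 i]),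
        q@L.[A@L.[theta]] ^+ 2 = h@L.[A@L.[theta]],
        forall j, q.[c 0 j] ^+ 2 = h.[c 0 j]
      & h@k = rem_poly m z /\ Phi z != 0].
Proof.
move=> em eD gPhi.
have two0k : 2%:R != 0 :> k by rewrite -(rmorph_nat iota) fmorph_eq0.
have m0 : (0 < m)%N by rewrite em.
pose Psi (z : 'rV[k]_(d + e)) := avoid n.*2 cs (rem_poly m z).
have gPsi : generic Psi.
  have co i : line_poly (fun z : 'rV[k]_(d + e) => (rem_poly m z)`_i).
    exact: rem_poly_coef.
  split.
    rewrite /Psi /avoid; apply: line_polyM => //.
    apply: line_poly_meval => i; apply: line_polyM; first exact: line_polyC.
    by apply: line_polyM => //; exact: line_polyX.
  have [w hw] := avoid_poly_nonzero n.*2 cs.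
  pose ws := [tuple w 0 i | i < n.*2].
  have [|z ez] := @rem_poly_onto k m (d + e) eD two0k (\prod_(x <- ws) ('X - x%:P)) m0.
    by rewrite size_prod_XsubC size_tuple em.
  exists z; rewrite /Psi ez -[\prod_(_ <- _) _]scale1r avoidE ?oner_neq0 // mul1r.
  rewrite (@meval_eq _ _ _ (w 0)) // => i.
  by rewrite mul1r tnth_mktuple.
pose Dis (z : 'rV[k]_(d + e)) := \prod_(p : 'I_d * 'I_d | p.1 != p.2)
  (z 0 (lshift e p.1) - z 0 (lshift e p.2)).
have gDis : generic Dis.
  apply: generic_prod => -[i j] /= ij; split.
    by apply: line_polyB; exact: line_poly_coord.
  exists (delta_mx 0 (lshift e i)); rewrite !mxE !eqxx /=.
  rewrite (inj_eq (@lshift_inj _ _)) [j == i]eq_sym (negbTE ij) subr0.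
  exact: oner_neq0.
have [A [c hz]] := generic_conjugates (genericM gPsi (genericM gDis gPhi)).
move: hz; set z := row_mx _ _; rewrite mulf_eq0 negb_or => /andP [n1].
rewrite mulf_eq0 negb_or => /andP [n2 n3].
have zl i : z 0 (lshift e i) = A@k.[ts 0 i] by rewrite row_mxEl mxE.
have inj : injective (fun i => A@k.[ts 0 i]).
  move=> i j eij; apply/eqP; apply: contraNT n2 => ij.
  by rewrite /Dis (bigD1 (i, j)) //= !zl eij subrr mul0r.
have [_ [f [mf sf fa fk]]] := generator_of_conjugates inj.
pose P := f * \prod_j ('X - (c 0 j)%:P).
have mP : P \is monic by rewrite monicMl ?monic_prod_XsubC.
have sP : size P = m.*2.+1.
  rewrite size_Mmonic ?monic_prod_XsubC // ?monic_neq0 // sf size_prod_XsubC.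
  by rewrite /index_enum -enumT size_enum_ord addnS /= addSn eD.
have hhf : 2%:R * 2%:R^-1 = 1 :> K by rewrite divff.
pose q := poly_sqrt 2%:R^-1 m P m; pose h := sqrt_rem 2%:R^-1 m P.
have [_ _ _ eP] := sqrt_remP hhf mP sP.
have eh : h@k = rem_poly m z.
  rewrite /h sqrt_rem_map /= fmorphV rmorph_nat /rem_poly; congr (sqrt_rem _ _ _).
  rewrite rmorphM /= fk rmorph_prod /root_poly big_split_ord /=; congr (_ * _).
    by apply: eq_bigr => i _; rewrite zl.
  by apply: eq_bigr => i _; rewrite rmorphB /= map_polyX map_polyC row_mxEr mxE.
exists A, h, q, c; rewrite -/z; split=> //.
- have sz : (size (rem_poly m z) <= n.*2.+1)%N by rewrite -em; exact: rem_poly_size.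
  have [s1 s2 s3] := avoidP sz n1; rewrite -eh in s1 s2 s3; split=> //.
    by rewrite -s1 size_map_poly.
  by rewrite -(separable_map iota).
- apply/eqP; rewrite -subr_eq0 -horner_exp -hornerN -hornerD -rmorphXn -rmorphB /= -eP.
  by rewrite rmorphM hornerM fa mul0r.
- move=> j; apply/eqP; rewrite -subr_eq0 -horner_exp -hornerN -hornerD -eP.
  rewrite hornerM horner_prod mulf_eq0; apply/orP; right.
  by rewrite (bigD1 j) //= !hornerE subrr mul0r.
Qed.

End Conjugates.

(** * The Jacobian of a quartic curve *)

(* For C : y^2 = h(x) with h quartic, the map of degree 4 from C to its
   Jacobian Y^2 = X^3 + c X^2 + (b d - 4 a e) X + (a d^2 + b^2 e - 4 a c e)
   sends (x, y) to X = jac_num / (4 h), Y = jac_sext / (8 h y). *)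
Section Jacobian.
Variable R : comNzRingType.
Implicit Types a b c d e x : R.

Definition quartic a b c d e x : R :=
  a * x ^+ 4 + b * x ^+ 3 + c * x ^+ 2 + d * x + e.
Definition jac_num a b c d e x : R :=
  (b ^+ 2 - 4 * a * c) * x ^+ 4 - 8 * a * d * x ^+ 3
  - (16 * a * e + 2 * b * d) * x ^+ 2 - 8 * b * e * x + (d ^+ 2 - 4 * c * e).
Definition jac_sext a b c d e x : R :=
  (b ^+ 3 + 8 * a ^+ 2 * d - 4 * a * b * c) * x ^+ 6
  + 2 * (16 * a ^+ 2 * e + 2 * a * b * d - 4 * a * c ^+ 2 + b ^+ 2 * c) * x ^+ 5
  + 5 * (8 * a * b * e + b ^+ 2 * d - 4 * a * c * d) * x ^+ 4
  + 20 * (b ^+ 2 * e - a * d ^+ 2) * x ^+ 3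
  - 5 * (8 * a * d * e + b * d ^+ 2 - 4 * b * c * e) * x ^+ 2
  - 2 * (16 * a * e ^+ 2 + 2 * b * d * e - 4 * c ^+ 2 * e + c * d ^+ 2) * x
  - (d ^+ 3 + 8 * b * e ^+ 2 - 4 * c * d * e).
Definition jac_p a b c d e : R := b * d - 4 * a * e.
Definition jac_r a b c d e : R := a * d ^+ 2 + b ^+ 2 * e - 4 * a * c * e.
Definition jac_cubic a b c d e x : R :=
  x ^+ 3 + c * x ^+ 2 + jac_p a b c d e * x + jac_r a b c d e.

Lemma jac_identity a b c d e x :
  let N := jac_num a b c d e x in let H := quartic a b c d e x in
  N ^+ 3 + 4 * c * N ^+ 2 * H + 16 * jac_p a b c d e * N * H ^+ 2
  + 64 * jac_r a b c d e * H ^+ 3 = jac_sext a b c d e x ^+ 2.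
Proof. by rewrite /jac_num /quartic /jac_sext /jac_p /jac_r; ring. Qed.

(* The Jacobian in the coordinate z = 1 / (X - x0). *)
Definition jac_poly a b c d e (x0 : R) : {poly R} :=
  jac_cubic a b c d e x0 *: 'X^4
  + (3 * x0 ^+ 2 + 2 * c * x0 + jac_p a b c d e) *: 'X^3
  + (3 * x0 + c) *: 'X^2 + 'X^1.

Lemma coef_jac_poly a b c d e x0 (g : R -> R -> R -> R -> R -> R) :
  let E := jac_poly a b c d e x0 in
  g E`_4 E`_3 E`_2 E`_1 E`_0 = g (jac_cubic a b c d e x0)
    (3 * x0 ^+ 2 + 2 * c * x0 + jac_p a b c d e) (3 * x0 + c) 1 0.
Proof.
by congr (g _ _ _ _ _); rewrite !coefD !coefZ !coefXn /=;
  rewrite !(mulr0, mulr1, add0r, addr0).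
Qed.

Lemma jac_poly_I a b c d e x0 :
  poly_I (jac_poly a b c d e x0) = quartic_I a b c d e.
Proof.
rewrite /poly_I coef_jac_poly /quartic_I /jac_cubic /jac_p /jac_r; ring.
Qed.

Lemma jac_poly_D a b c d e x0 :
  poly_D (jac_poly a b c d e x0) = quartic_D a b c d e.
Proof.
rewrite /poly_D coef_jac_poly /quartic_D /jac_cubic /jac_p /jac_r; ring.
Qed.

Lemma jac_poly_size a b c d e x0 : jac_cubic a b c d e x0 != 0 ->
  size (jac_poly a b c d e x0) = 5%N.
Proof.
move=> n0; apply/eqP; rewrite eqn_leq; apply/andP; split.
  apply/leq_sizeP => j hj; rewrite !coefD !coefZ !coefXn.
  by case: j hj => [|[|[|[|[|j]]]]] //= _; rewrite !mulr0 !addr0.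
apply: contraLR n0; rewrite -ltnNge ltnS negbK => /leq_sizeP /(_ 4%N isT).
rewrite !coefD !coefZ !coefXn /= !mulr0 mulr1 !addr0 => ->; exact: eqxx.
Qed.

Lemma quartic_horner (h : {poly R}) x : (size h <= 5)%N ->
  h.[x] = quartic h`_4 h`_3 h`_2 h`_1 h`_0 x.
Proof.
move=> sh; rewrite (horner_coef_wide _ sh) !big_ord_recl big_ord0 /= /bump /=.
by rewrite /quartic; ring.
Qed.

End Jacobian.

Lemma jac_poly_point (F : fieldType) (a b c d e x y x0 : F) :
  2%:R != 0 :> F -> y != 0 -> y ^+ 2 = quartic a b c d e x ->
  jac_num a b c d e x - 4%:R * x0 * quartic a b c d e x != 0 ->
  exists w, w ^+ 2 = (jac_poly a b c d e x0).[4%:R * quartic a b c d e x /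
    (jac_num a b c d e x - 4%:R * x0 * quartic a b c d e x)].
Proof.
move=> two0 y0 hy nz; have := jac_identity a b c d e x; rewrite -hy /=.
rewrite -hy in nz; move: nz.
move: (jac_num a b c d e x) (jac_sext a b c d e x) => N G nz eG.
exists (G / (8%:R * y ^+ 3) * (4%:R * y ^+ 2 / (N - 4%:R * x0 * y ^+ 2)) ^+ 2).
have -> : (jac_poly a b c d e x0).[4%:R * y ^+ 2 / (N - 4%:R * x0 * y ^+ 2)] =
  (4%:R * y ^+ 2 / (N - 4%:R * x0 * y ^+ 2)) ^+ 4 * ((N ^+ 3 + 4 * c * N ^+ 2 * y ^+ 2
    + 16 * jac_p a b c d e * N * (y ^+ 2) ^+ 2 + 64 * jac_r a b c d e * (y ^+ 2) ^+ 3)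
    / (64%:R * y ^+ 6)).
  rewrite /jac_poly !hornerD !hornerZ !hornerXn /jac_cubic.
  move: (jac_p a b c d e) (jac_r a b c d e) => p r.
  have four0 : 4%:R != 0 :> F by rewrite (natrM _ 2 2) mulf_neq0.
  have n64 : 64%:R != 0 :> F by rewrite (natrM _ 16 4) (natrM _ 4 4) !mulf_neq0.
  by field; rewrite nz y0 n64.
have n8 : 8%:R != 0 :> F by rewrite (natrM _ 2 4) (natrM _ 2 2) !mulf_neq0.
have n64 : 64%:R != 0 :> F by rewrite (natrM _ 8 8) !mulf_neq0.
rewrite eG; field; rewrite nz y0 n64 n8 //.
Qed.

Section JacobianGeneric.
Variables (k : closedFieldType) (m D : nat).
Hypothesis D_eq : D = m.*2.
Hypothesis m5 : m = 5%N.
Hypothesis two0 : 2%:R != 0 :> k.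

Definition jac_separates (i j : 'I_D) (z : 'rV[k]_D) : k :=
  let h := rem_poly m z in
  let num := jac_num h`_4 h`_3 h`_2 h`_1 h`_0 in
  let den := quartic h`_4 h`_3 h`_2 h`_1 h`_0 in
  num (z 0 i) * den (z 0 j) - num (z 0 j) * den (z 0 i).

Lemma jac_separates_generic i j : i != j -> generic (jac_separates i j).
Proof.
move=> ij; split.
  have co s : line_poly (fun z : 'rV[k]_D => (rem_poly m z)`_s) by exact: rem_poly_coef.
  have coord s := @line_poly_coord k D s.
  rewrite /jac_separates /jac_num /quartic.
  do ![exact: line_polyC | exact: co | exact: coord | apply: line_polyX
      | apply: line_polyB | apply: line_polyD | apply: line_polyM].
(* h = x and q = x^5 satisfy q^2 = h at x = 0 and x = 1 *)
have [||||z [ez zi zj]] := @rem_poly_surj k m D D_eq two0 'X^5 'X i j 0 1 ij.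
- exact: monicXn.
- by rewrite size_polyXn m5.
- by rewrite size_polyX m5.
- rewrite Gauss_dvdp; last by rewrite coprimep_XsubC root_XsubC oner_eq0.
  rewrite !dvdp_XsubCl /root !(hornerD, hornerN, hornerX, horner_exp).
  by rewrite !expr0n !expr1n !subrr eqxx.
- exists z; rewrite /jac_separates ez zi zj !coefX /= /jac_num /quartic.
  rewrite (_ : _ - _ = 1) ?oner_neq0 //; ring.
Qed.

End JacobianGeneric.

Section QuarticSeparable.
Variables (K : fieldType) (k : closedFieldType) (iota : {rmorphism K -> k}).

Lemma poly_I_map (h : {poly K}) : poly_I (map_poly iota h) = iota (poly_I h).
Proof.
by rewrite /poly_I /quartic_I !coef_map /=; ring.
Qed.

Lemma poly_D_map (h : {poly K}) : poly_D (map_poly iota h) = iota (poly_D h).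
Proof.
by rewrite /poly_D /quartic_D !coef_map /=; ring.
Qed.

Lemma quartic_separable (h : {poly K}) : size h = 5%N ->
  separable_poly h = (poly_D h != 0).
Proof.
move=> sh; rewrite -(separable_map iota) -(fmorph_eq0 iota) -poly_D_map.
have sk : size (map_poly iota h) = 5%N by rewrite size_map_poly.
move: sk; move: (map_poly iota h) => g sg.
have [rs ers] := closed_field_poly_normal g.
have l0 : lead_coef g != 0 by rewrite lead_coef_eq0 -size_poly_eq0 sg.
have srs : size rs = 4%N.
  by have := sg; rewrite {1}ers size_scale // size_prod_XsubC => [[]].
case: rs ers srs => [|w1 [|w2 [|w3 [|w4 [|]]]]] // ers _.
rewrite ers (eqp_separable (eqp_scale _ l0)) separable_prod_XsubC poly_D_roots.
rewrite mulf_eq0 expf_eq0 (negbTE l0) andbF orFb sqrf_eq0.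
apply/idP/idP; first exact: cross_S3_neq0.
rewrite /cross_S3 !mulf_eq0 !subr_eq0 !negb_or /= !inE !negb_or.
rewrite [w4 == w2]eq_sym.
by case: (w1 != w2) (w3 != w4) (w1 != w3) (w2 != w4) (w1 != w4) (w2 != w3) =>
  [] [] [] [] [] [].
Qed.

Lemma quartic_four_roots (g : {poly k}) w1 w2 w3 w4 : size g = 5%N ->
  uniq [:: w1; w2; w3; w4] -> all (root g) [:: w1; w2; w3; w4] ->
  g = lead_coef g *: \prod_(z <- [:: w1; w2; w3; w4]) ('X - z%:P).
Proof.
by move=> sg uw rw; apply: all_roots_prod_XsubC; rewrite ?sg // uniq_rootsE.
Qed.

End QuarticSeparable.

(** * Families of curves *)

Lemma infinite_family (T : eqType) (Q : T -> Prop) (R : T -> T -> Prop) :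
  (forall s : seq T, (forall y, y \in s -> Q y) ->
    exists x, Q x /\ forall y, y \in s -> ~ R x y /\ ~ R y x) ->
  exists X : nat -> T, (forall i, Q (X i)) /\
    forall i j, i <> j -> ~ R (X i) (X j).
Proof.
move=> H.
pose state := {s : seq T | forall y, y \in s -> Q y}.
have step (s : state) :
    {x | Q x /\ forall y, y \in sval s -> ~ R x y /\ ~ R y x}.
  by apply: constructive_indefinite_description; apply: H; exact: (svalP s).
have ok (s : state) y : y \in sval (step s) :: sval s -> Q y.
  by rewrite inE => /orP [/eqP ->|/(svalP s)//]; case: (svalP (step s)).
pose next (s : state) : state := exist _ (sval (step s) :: sval s) (ok s).
have nil_ok : forall y, y \in [::] -> Q y by [].
pose st i : state := iter i next (exist _ [::] nil_ok).
have mem i j : (i < j)%N -> sval (step (st i)) \in sval (st j).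
  elim: j => // j IH; rewrite ltnS leq_eqVlt /= inE => /orP [/eqP ->|/IH ->].
    by rewrite eqxx.
  by rewrite orbT.
exists (fun i => sval (step (st i))); split=> [i|i j].
  by case: (svalP (step (st i))).
case: (ltngtP i j) => // lt _.
  by have [_ /(_ _ (mem _ _ lt)) []] := svalP (step (st j)).
by have [_ /(_ _ (mem _ _ lt)) []] := svalP (step (st i)).
Qed.

Section Families.
Variables (K : fieldType) (k : closedFieldType) (iota : {rmorphism K -> k}).
Hypothesis K_infinite : forall s : seq K, exists x : K, x \notin s.
Hypothesis two0 : 2%:R != 0 :> K.
Variables (d : nat) (L : fieldExtType K).
Hypothesis L_sep : separable 1%VS {:L}.
Hypothesis L_dim : \dim {:L} = d.

Local Notation "A @L" := (map_poly (in_alg L) A) (at level 9).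
Local Notation "A @k" := (map_poly iota A) (at level 9).
Local Notation iso n h h' :=
  (isomorphic (base_change iota (model n h)) (base_change iota (model n h'))).

Let two0k : 2%:R != 0 :> k.
Proof. by rewrite -(rmorph_nat iota) fmorph_eq0. Qed.

Lemma j_values (s : seq {poly K}) :
  exists cs : seq k, forall h w1 w2 w3 w4, h \in s -> h != 0 ->
    all (root h@k) [:: w1; w2; w3; w4] ->
    cross_S2 w1 w2 w3 w4 ^+ 3 / cross_S3 w1 w2 w3 w4 ^+ 2 \in cs.
Proof.
elim: s => [|h s [cs IH]]; first by exists [::].
have [rs ers] := closed_field_poly_normal h@k.
pose quads := [seq (p, w) | p <- [seq (p, w) | p <- [seq (p, w) | p <- rs, w <- rs],
                                               w <- rs], w <- rs].
exists ([seq cross_S2 t.1.1.1 t.1.1.2 t.1.2 t.2 ^+ 3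
   / cross_S3 t.1.1.1 t.1.1.2 t.1.2 t.2 ^+ 2 | t <- quads] ++ cs) => h' w1 w2 w3 w4.
rewrite inE mem_cat => /orP [/eqP ->|hs] h0 rw; last by rewrite (IH h') ?orbT.
have mem w : root h@k w -> w \in rs.
  by rewrite ers rootZ ?root_prod_XsubC // lead_coef_eq0 map_poly_eq0.
move: rw => /and5P [/mem m1 /mem m2 /mem m3 /mem m4 _].
apply/orP; left; apply/mapP; exists (w1, w2, w3, w4) => //.
by do 3![apply: allpairs_f => //].
Qed.

Lemma special_family n e : (1 < n)%N -> (d + e = n.*2.+1.*2)%N ->
  exists X : nat -> {poly K}, (forall i,
      [/\ size (X i) = n.*2.+1, separable_poly (X i),
          has_new_special_point iota L (model n (X i))
        & (0 < e)%N -> has_rational_point (model n (X i))]) /\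
    forall i j, i <> j -> ~ iso n (X i) (X j).
Proof.
move=> n1 de; have n0 : (0 < n)%N by exact: ltnW.
apply: (@infinite_family {poly K} (fun h => [/\ size h = n.*2.+1, separable_poly h,
    has_new_special_point iota L (model n h)
  & (0 < e)%N -> has_rational_point (model n h)]) (fun h h' => iso n h h')) => s sQ.
have [cs ecs] := j_values s.
have [theta [ts conj]] := conjugates_exist iota L_sep L_dim.
have gen1 : generic (fun _ : 'rV[k]_(d + e) => 1 : k).
  by split; [exact: line_polyC|exists 0; exact: oner_neq0].
have [A [h [q [c [[sh seph av] inj qA qc _]]]]] :=
  family_member L_dim conj K_infinite two0 cs (erefl n.*2.+1) de gen1.
have [gA _] := generator_of_conjugates L_dim conj inj.
exists h; split.
  have new := model_new_special_point n0 sh seph iota two0k gA qA.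
  split=> //.
  by move=> e0; have := model_rational_point n0 sh (qc (Ordinal e0)).
move=> h' h's; have [sh' seph' _ _] := sQ _ h's.
have no w1 w2 w3 w4 w1' w2' w3' w4' :
  uniq [:: w1; w2; w3; w4] -> uniq [:: w1'; w2'; w3'; w4'] ->
  all (root h@k) [:: w1; w2; w3; w4] -> all (root h'@k) [:: w1'; w2'; w3'; w4'] ->
  ~ j_relation (w1, w2, w3, w4) (w1', w2', w3', w4').
  move=> uw uw' rw rw' e0.
  have cs' := ecs _ _ _ _ _ h's (separable_poly_neq0 seph') rw'.
  have /eqP[] := av _ _ _ _ _ uw rw cs'; rewrite /j_avoid.
  have s0 := cross_S3_neq0 uw'.
  apply: (mulIf (expf_neq0 2 s0)); rewrite mul0r mulrBl; move: e0; rewrite /j_relation => ->.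
  by rewrite [X in _ - X]mulrAC divfK ?expf_neq0 // subrr.
split=> H.
  have [w1 [w2 [w3 [w4 [w1' [w2' [w3' [w4' [u u' r r' j]]]]]]]]] :=
    iso_j_relation n1 sh seph sh' seph' two0k H.
  exact: no u u' r r' j.
have [w1 [w2 [w3 [w4 [w1' [w2' [w3' [w4' [u u' r r' j]]]]]]]]] :=
  iso_j_relation n1 sh' seph' sh seph two0k H.
by apply: (no _ _ _ _ _ _ _ _ u' u r' r); rewrite /j_relation in j *.
Qed.

Lemma quartic_roots (h : {poly K}) : size h = 5%N -> separable_poly h ->
  exists (l w1 w2 w3 w4 : k), [/\ l != 0, uniq [:: w1; w2; w3; w4],
    h@k = l *: \prod_(z <- [:: w1; w2; w3; w4]) ('X - z%:P)
    & all (root h@k) [:: w1; w2; w3; w4]].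
Proof.
move=> sh sep; have sk : separable_poly h@k by rewrite separable_map.
have [rs urs ers] := closed_separable_roots sk.
have l0 : lead_coef h@k != 0 by rewrite lead_coef_eq0 separable_poly_neq0.
have srs : size rs = 4%N.
  have : size h@k = 5%N by rewrite size_map_poly.
  by rewrite ers size_scale // size_prod_XsubC => [[]].
case: rs urs ers srs => [|w1 [|w2 [|w3 [|w4 [|]]]]] // urs ers _.
exists (lead_coef h@k), w1, w2, w3, w4; split=> //.
by apply/allP => w hw; rewrite ers rootZ // root_prod_XsubC.
Qed.

Lemma iso_invariants (h h' : {poly K}) : size h = 5%N -> separable_poly h ->
  size h' = 5%N -> separable_poly h' -> iso 2 h h' ->
  poly_I h ^+ 3 * poly_D h' = poly_I h' ^+ 3 * poly_D h.
Proof.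
move=> sh sep sh' sep' H.
have [w1 [w2 [w3 [w4 [w1' [w2' [w3' [w4' [u u' r r' j]]]]]]]]] :=
  iso_j_relation (n := 2) isT sh sep sh' sep' two0k H.
have ek := @quartic_four_roots _ h@k _ _ _ _ _ u r.
have ek' := @quartic_four_roots _ h'@k _ _ _ _ _ u' r'.
apply: (fmorph_inj iota); rewrite [LHS]rmorphM [RHS]rmorphM !rmorphXn -!poly_I_map -!poly_D_map.
rewrite ek ?size_map_poly // ek' ?size_map_poly // !poly_I_roots !poly_D_roots.
move: j; rewrite /j_relation.
move: (lead_coef h@k) (lead_coef h'@k) => l l'.
move: (cross_S2 w1 w2 w3 w4) (cross_S2 w1' w2' w3' w4') => s2 s2'.
move: (cross_S3 w1 w2 w3 w4) (cross_S3 w1' w2' w3' w4') => s3 s3' e.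
have -> : (- l ^+ 2 * s2) ^+ 3 * (l' ^+ 6 * s3' ^+ 2) =
  - l ^+ 6 * l' ^+ 6 * (s2 ^+ 3 * s3' ^+ 2) by ring.
by rewrite e; ring.
Qed.

Lemma rmorph_jac_num (R S : comNzRingType) (f : {rmorphism R -> S}) a b c d0 e x :
  f (jac_num a b c d0 e x) = jac_num (f a) (f b) (f c) (f d0) (f e) (f x).
Proof. by rewrite /jac_num; ring. Qed.

Lemma rmorph_quartic (R S : comNzRingType) (f : {rmorphism R -> S}) a b c d0 e x :
  f (quartic a b c d0 e x) = quartic (f a) (f b) (f c) (f d0) (f e) (f x).
Proof. by rewrite /quartic; ring. Qed.

Lemma map_jac_poly (R S : comNzRingType) (f : {rmorphism R -> S}) a b c d0 e x :
  map_poly f (jac_poly a b c d0 e x) =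
  jac_poly (f a) (f b) (f c) (f d0) (f e) (f x).
Proof.
rewrite /jac_poly !rmorphD /= !map_polyZ !map_polyXn.
by rewrite /jac_cubic /jac_p /jac_r; congr (_ *: _ + _ *: _ + _ *: _ + _); ring.
Qed.

Lemma jac_cubic_nonroot (a b c d0 e : K) : exists x, jac_cubic a b c d0 e x != 0.
Proof.
pose p := 'X^3 + c *: 'X^2 + jac_p a b c d0 e *: 'X + (jac_r a b c d0 e)%:P.
have p0 : p@k != 0.
  rewrite map_poly_eq0; apply/eqP => /(congr1 (fun r : {poly K} => r`_3)).
  rewrite !coefD !coefZ coefC !coefXn coefX coef0 /= !mulr0 !addr0 => /eqP.
  by rewrite oner_eq0.
have [x] := infinite_nonroot iota K_infinite p0; rewrite horner_map fmorph_eq0 => hx.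
exists x; move: hx.
by rewrite /p !(hornerD, hornerZ, hornerXn, hornerX, hornerC).
Qed.

Lemma jacobian_member (cs : seq k) : d = 10%N ->
  exists E : {poly K}, [/\ size E = 5%N, separable_poly E,
    has_new_point L (model 2 E), has_rational_point (model 2 E)
    & forall c, c \in cs -> iota (poly_I E) ^+ 3 != - c * iota (poly_D E)].
Proof.
move=> d10.
have [theta [ts conj]] := conjugates_exist iota L_sep L_dim.
have de : (d + 0 = 5.*2)%N by rewrite d10.
pose Phi (z : 'rV[k]_(d + 0)) := \prod_(p : 'I_(d + 0) * 'I_(d + 0) | p.1 != p.2)
  jac_separates 5 p.1 p.2 z.
have gPhi : generic Phi.
  by apply: generic_prod => p hp; apply: jac_separates_generic.
have [A [h [q [c]]]] := family_member L_dim conj K_infinite two0 (n := 2) cs (erefl 5%N) de gPhi.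
set z := row_mx _ _ => -[[sh seph av] inj qA _ [eh Phi0]].
have rel := conj; case: rel => [tinj trans gen].
pose al i := A@k.[ts 0 i].
pose num := jac_num (h`_4)%:P (h`_3)%:P (h`_2)%:P (h`_1)%:P (h`_0)%:P A.
pose den := quartic (h`_4)%:P (h`_3)%:P (h`_2)%:P (h`_1)%:P (h`_0)%:P A.
have evN (R : comNzRingType) (f : {rmorphism K -> R}) t : (map_poly f num).[t] =
    jac_num (f h`_4) (f h`_3) (f h`_2) (f h`_1) (f h`_0) (map_poly f A).[t].
  pose ev : {rmorphism {poly K} -> R} := horner_eval t \o map_poly f.
  have evC a : ev a%:P = f a by rewrite /ev /= /horner_eval map_polyC hornerC.
  by have := rmorph_jac_num ev (h`_4)%:P (h`_3)%:P (h`_2)%:P (h`_1)%:P (h`_0)%:P A; rewrite !evC.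
have evD (R : comNzRingType) (f : {rmorphism K -> R}) t : (map_poly f den).[t] =
    quartic (f h`_4) (f h`_3) (f h`_2) (f h`_1) (f h`_0) (map_poly f A).[t].
  pose ev : {rmorphism {poly K} -> R} := horner_eval t \o map_poly f.
  have evC a : ev a%:P = f a by rewrite /ev /= /horner_eval map_polyC hornerC.
  by have := rmorph_quartic ev (h`_4)%:P (h`_3)%:P (h`_2)%:P (h`_1)%:P (h`_0)%:P A; rewrite !evC.
have sep i j : i != j ->
    num@k.[ts 0 i] * den@k.[ts 0 j] - num@k.[ts 0 j] * den@k.[ts 0 i] != 0.
  move=> ij; move: Phi0; rewrite /Phi.
  have ij' : lshift 0 i != lshift 0 j by rewrite (inj_eq (@lshift_inj _ _)).
  rewrite (bigD1 (lshift 0 i, lshift 0 j)) //= mulf_eq0 negb_or => /andP [].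
  by rewrite /jac_separates -eh !coef_map !row_mxEl !mxE !evN !evD.
pose i0 : 'I_d := cast_ord (esym d10) (inord 0).
pose i1 : 'I_d := cast_ord (esym d10) (inord 1).
have i01 : i0 != i1 by rewrite -val_eqE /= !inordK.
have [x0 hx0] := jac_cubic_nonroot h`_4 h`_3 h`_2 h`_1 h`_0.
have nz0 (t : K) : num@L.[theta] - 4%:R * in_alg L t * den@L.[theta] != 0.
  apply/eqP => e.
  have e' : (num - (4%:R * t) *: den)@L.[theta] = 0.
    by rewrite raddfB /= map_polyZ !(hornerD, hornerN, hornerZ) rmorphM rmorph_nat.
  have ek i : num@k.[ts 0 i] = 4%:R * iota t * den@k.[ts 0 i].
    have := trans _ e' i.
    rewrite raddfB /= map_polyZ !(hornerD, hornerN, hornerZ) rmorphM rmorph_nat.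
    by move=> /eqP; rewrite subr_eq0 => /eqP.
  by have /eqP[] := sep _ _ i01; rewrite !ek; ring.
have den0 : den@L.[theta] != 0.
  by apply/eqP => e; have /eqP[] := sep _ _ i01; rewrite !(trans _ e); ring.
pose E := jac_poly h`_4 h`_3 h`_2 h`_1 h`_0 x0.
have sE : size E = 5%N by exact: jac_poly_size.
have IE : poly_I E = poly_I h by exact: jac_poly_I.
have DE : poly_D E = poly_D h by exact: jac_poly_D.
have sepE : separable_poly E.
  by rewrite (quartic_separable iota sE) DE -(quartic_separable iota sh).
exists E; split=> //.
- pose y := q@L.[A@L.[theta]].
  have hy : y ^+ 2 = den@L.[theta].
    by rewrite /y qA evD (@quartic_horner _ h@L) ?size_map_poly ?sh // !coef_map.
  have y0 : y != 0 by rewrite -sqrf_eq0 hy.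
  have two0L : 2%:R != 0 :> L by rewrite -(rmorph_nat (in_alg L)) fmorph_eq0.
  move: (nz0 x0); rewrite evN evD => nz; rewrite evD in hy.
  have [w ew] := jac_poly_point two0L y0 hy nz.
  rewrite -(map_jac_poly (in_alg L)) -/E in ew.
  set x := (X in _.[X]) in ew.
  apply: ex_intro; apply: (model_new_point (n := 2) isT sE _ ew).
  move=> M xM.
  have [B eB] := gen (num@L.[theta] / (4%:R * den@L.[theta])).
  have four0 : 4%:R != 0 :> L by rewrite (natrM _ 2 2) mulf_neq0.
  have BM : B@L.[theta] \in M.
    rewrite -eB; have -> : num@L.[theta] / (4%:R * den@L.[theta]) = x^-1 + in_alg L x0.
      rewrite /x -evN -evD; move: (nz0 x0) den0.
      move: (num@L.[theta]) (den@L.[theta]) (in_alg L x0) => N H X nN nH.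
      by field; rewrite nH nN four0.
    by rewrite rpredD ?rpredV //= rpredZ // mem1v.
  suff injB : injective (fun i => B@k.[ts 0 i]).
    by have [gB _] := generator_of_conjugates L_dim conj injB; exact: gB BM.
  have eB' : (B * (4%:R *: den) - num)@L.[theta] = 0.
    rewrite raddfB /= [map_poly _ (B * _)]rmorphM /= map_polyZ !(hornerD, hornerN, hornerM, hornerZ).
    by rewrite rmorph_nat -eB divfK ?subrr // mulf_neq0.
  have ek i : num@k.[ts 0 i] = B@k.[ts 0 i] * (4%:R * den@k.[ts 0 i]).
    have := trans _ eB' i.
    rewrite raddfB /= [map_poly _ (B * _)]rmorphM /= map_polyZ !(hornerD, hornerN, hornerM, hornerZ).
    by rewrite rmorph_nat => /eqP; rewrite subr_eq0 => /eqP.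
  move=> i j eij; apply/eqP; apply: contraT => /sep /eqP[].
  by rewrite !ek eij; ring.
- apply: (model_rational_point (n := 2) isT sE (x := 0) (y := 0)).
  by rewrite /E /jac_poly !(hornerD, hornerZ, hornerXn) !expr0n /= !mulr0 !addr0.
- move=> a acs; rewrite IE DE.
  have [l [w1 [w2 [w3 [w4 [l0 uw ew rw]]]]]] := quartic_roots sh seph.
  rewrite -poly_I_map -poly_D_map ew poly_I_roots poly_D_roots -subr_eq0.
  have := av _ _ _ _ _ uw rw acs; apply: contraNneq => e.
  apply/eqP/(mulfI (expf_neq0 6 l0)); rewrite mulr0 -[RHS]oppr0 -e /j_avoid.
  by move: (cross_S2 _ _ _ _) (cross_S3 _ _ _ _) => s2 s3; ring.
Qed.

Lemma jacobian_family : d = 10%N ->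
  exists X : nat -> {poly K}, (forall i, [/\ size (X i) = 5%N, separable_poly (X i),
      has_new_point L (model 2 (X i)) & has_rational_point (model 2 (X i))]) /\
    forall i j, i <> j -> ~ iso 2 (X i) (X j).
Proof.
move=> d10.
apply: (@infinite_family {poly K} (fun h => [/\ size h = 5%N, separable_poly h,
    has_new_point L (model 2 h) & has_rational_point (model 2 h)])
  (fun h h' => iso 2 h h')) => s sQ.
have [E [sE sepE nE rE av]] := jacobian_member
  [seq - iota (poly_I h) ^+ 3 / iota (poly_D h) | h <- s] d10.
exists E; split=> // h hs; have [sh seph _ _] := sQ _ hs.
have no : poly_I E ^+ 3 * poly_D h != poly_I h ^+ 3 * poly_D E.
  have D0 : iota (poly_D h) != 0 by rewrite fmorph_eq0 -(quartic_separable iota sh).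
  have := av _ (map_f _ hs); apply: contraNneq => /(congr1 iota) e.
  rewrite [LHS]rmorphM [RHS]rmorphM !rmorphXn /= in e; apply/eqP.
  by apply: (mulIf D0); rewrite e !mulNr opprK [RHS]mulrAC divfK.
by split=> /iso_invariants e; move/eqP: no; apply; rewrite e.
Qed.

End Families.

Unset Implicit Arguments.

Theorem corollary2p2 (K : fieldType) (Kbar : closedFieldType)
  (iota : {rmorphism K -> Kbar})
  (Kbar_algebraic : forall x : Kbar, algebraicOver iota x)
  (K_infinite : forall s : seq K, exists x : K, x \notin s)
  (K_char : 2%N \notin [pchar K])
  (d : nat) (L : fieldExtType K)
  (L_separable : separable 1%VS {:L}) (L_degree : \dim {:L} = d) :
  [/\ (d <= 9)%N ->
        infinitely_many iota (fun X =>
          elliptic iota X /\ has_new_special_point iota L X),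
      d = 10%N ->
        infinitely_many iota (fun X =>
          elliptic iota X /\ has_new_point L X),
      forall g : nat, (2 <= g)%N ->
        ((d %% 4 == 0)%N || (d %% 4 == 1)%N -> (d %/ 4 - 1 <= g)%N) ->
        ((d %% 4 == 2)%N || (d %% 4 == 3)%N -> (d %/ 4 <= g)%N) ->
        infinitely_many iota (fun X =>
          [/\ hyperelliptic iota X g, has_rational_point X
            & has_new_special_point iota L X])
    & forall g : nat, (d %% 4 = 2)%N -> (g = d %/ 4 - 1)%N -> (2 <= g)%N ->
        infinitely_many iota (fun X =>
          hyperelliptic iota X g /\ has_new_special_point iota L X)].
Proof.
have two0 : 2%:R != 0 :> K by apply: contraNneq K_char => e; rewrite inE /= e eqxx.
have two0k : 2%:R != 0 :> Kbar by rewrite -(rmorph_nat iota) fmorph_eq0.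
have fam := special_family iota K_infinite two0 L_separable L_degree.
have ell (h : {poly K}) : size h = 5%N -> separable_poly h -> has_rational_point (model 2 h) ->
    elliptic iota (model 2 h).
  move=> sh seph rat; split=> //.
    exact: (model_curve iota (n := 2) isT sh seph two0k).
  exact: (model_genus iota (n := 2) isT sh seph two0k).
split.
- move=> d9; have [X [hX iso]] := fam 2 (10 - d)%N isT ltac:(lia).
  exists (fun i => model 2 (X i)); split=> // i.
  by have [sh seph new rat] := hX i; split=> //; apply: ell => //; apply: rat; lia.
- move=> d10; have [X [hX iso]] := jacobian_family iota K_infinite two0 L_separable L_degree d10.
  exists (fun i => model 2 (X i)); split=> // i.
  by have [sh seph new rat] := hX i; split=> //; apply: ell.
- move=> g g2 h01 h23.
  have le : (d < g.*2.*2 + 6)%N by lia.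
  have [X [hX iso]] := fam g.+1 (g.+1.*2.+1.*2 - d)%N ltac:(lia) ltac:(lia).
  exists (fun i => model g.+1 (X i)); split=> // i.
  have [sh seph new rat] := hX i; split=> //; last by apply: rat; lia.
  exact: (model_hyperelliptic (n := g.+1) isT sh seph iota two0k (ltnW g2)).
- move=> g d2 dg g2.
  have [X [hX iso]] := fam g.+1 0%N ltac:(lia) ltac:(lia).
  exists (fun i => model g.+1 (X i)); split=> // i.
  have [sh seph new _] := hX i; split=> //.
  exact: (model_hyperelliptic (n := g.+1) isT sh seph iota two0k (ltnW g2)).
Qed.
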